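(* Suppose that $\mu \ge 0$, $0 < \nu \le 1$ and $a > 0$, and let $R_{\mu,\nu}(a,t) = \mathcal{L}^{-1}\{s^{-\mu} e^{-a s^{\nu}};t\}$ for $t>0$. Then the following properties hold. (i) $\displaystyle \lim_{t \to 0^+} R_{\mu,\nu}(a,t) = 0$. (ii) The function $y(t) = R_{\mu,\nu}(a,t)$ satisfies the fractional integral equation $$a \nu \, {}_{0}D_{t}^{-(1-\nu)} y(t) = t\, y(t) - \mu \int_0^t y(\tau)\, d\tau$$ and the fractional ordinary differential equation $$a \nu \, {}_{0}D_{t}^{\nu} y(t) = a\nu \, {}_{0}^{C}D_{t}^{\nu} y(t) = t\, y'(t) + (1-\mu)\, y(t).$$
   Context: $\mathcal{L}\{y(t);s\} = \hat y(s) = \int_0^\infty e^{-st} y(t)\, dt$ denotes the Laplace transform and $\mathcal{L}^{-1}$ its inverse; $s^{\nu}$ is the principal branch. For $\nu=1$ the inverse transform and the identities are understood in the sense of distributions where necessary (e.g. $R_{0,1}(a,t) = \delta(t-a)$ with $\delta$ the Dirac delta). For $\alpha>0$ the Riemann-Liouville fractional integral of order $\alpha$ is ${}_{0}D_{t}^{-\alpha} y(t) = \frac{1}{\Gamma(\alpha)} \int_0^t (t-\tau)^{\alpha-1} y(\tau)\, d\tau$, and ${}_{0}D_{t}^{0}$ is the identity. With $\lceil \alpha \rceil$ the least integer greater than or equal to $\alpha$ and $D^n$ the ordinary derivative of order $n$, the Riemann-Liouville fractional derivative of order $\alpha>0$ is ${}_{0}D_{t}^{\alpha} y(t) = D^{\lceil\alpha\rceil}\,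 {}_{0}D_{t}^{-(\lceil\alpha\rceil-\alpha)} y(t)$ and the Caputo fractional derivative of order $\alpha>0$ is ${}_{0}^{C}D_{t}^{\alpha} y(t) = {}_{0}D_{t}^{-(\lceil\alpha\rceil-\alpha)} D^{\lceil\alpha\rceil} y(t)$. *)

(* Defs.v *)
From HB Require Import structures.
From mathcomp Require Import all_boot all_order all_algebra.
From mathcomp Require Import all_classical all_reals all_analysis.
From mathcomp Require Import complex.

Set Implicit Arguments.
Unset Strict Implicit.
Unset Printing Implicit Defensive.

Import Order.TTheory GRing.Theory Num.Theory.
Import numFieldNormedType.Exports.

Local Open Scope classical_set_scope.
Local Open Scope ring_scope.
Local Open Scope complex_scope.

(* [Re] and [Im] are the projections of [R[i]] to [R]; mathcomp's generic ones
   take their values in [R[i]]. *)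
Local Notation Re := complex.Re.
Local Notation Im := complex.Im.

(** * Complex exponential and principal powers *)

Definition cexp (R : realType) (z : R[i]) : R[i] :=
  (expR (Re z) * cos (Im z)) +i* (expR (Re z) * sin (Im z)).

Definition cmod (R : realType) (z : R[i]) : R :=
  Num.sqrt (Re z ^+ 2 + Im z ^+ 2).

(* The principal argument, in ]-pi, pi] (for z != 0). *)
Definition carg (R : realType) (z : R[i]) : R :=
  if 0 <= Im z then acos (Re z / cmod z) else - acos (Re z / cmod z).

Definition cLog (R : realType) (z : R[i]) : R[i] := ln (cmod z) +i* carg z.

(* Only used for z != 0. *)
Definition cpow (R : realType) (z : R[i]) (p : R) : R[i] :=
  cexp (p%:C * cLog z).

(* s |-> s^(-mu) e^(- a s^nu), whose inverse Laplace transform is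
   R_{mu,nu}(a, .). *)
Definition Rsymbol (R : realType) (mu nu a : R) (s : R[i]) : R[i] :=
  cpow s (- mu) * cexp (- (a%:C * cpow s nu)).

(** * Laplace transform of functions *)

Definition laplace_kernel (R : realType) (s : R[i]) (t : R) : R[i] :=
  cexp (- (s * t%:C)).

Definition laplace_integrable (R : realType) (y : R -> R) (s : R[i]) : Prop :=
  lebesgue_measure.-integrable `]0, +oo[
    (EFin \o (fun t : R => Re (laplace_kernel s t) * y t)) /\
  lebesgue_measure.-integrable `]0, +oo[
    (EFin \o (fun t : R => Im (laplace_kernel s t) * y t)).

Definition laplace (R : realType) (y : R -> R) (s : R[i]) : R[i] :=
  (\int[lebesgue_measure]_(t in `]0, +oo[) (Re (laplace_kernel s t) * y t)) +i*
  (\int[lebesgue_measure]_(t in `]0, +oo[) (Im (laplace_kernel s t) * y t)).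

(* y is the inverse Laplace transform of F on ]0, +oo[: the Laplace transform
   of y converges (absolutely) to F on the half-plane Re s > c.  The Laplace
   transform only determines y up to a null set; continuity selects the usual
   representative.  The values of y outside ]0, +oo[ are irrelevant. *)
Definition inverse_laplace (R : realType) (c : R) (F : R[i] -> R[i])
    (y : R -> R) : Prop :=
  (forall t, 0 < t -> {for t, continuous y}) /\
  (forall s, c < Re s -> laplace_integrable y s /\ laplace y s = F s).

(** * Fractional calculus of functions *)

Definition Gamma (R : realType) (x : R) : R :=
  \int[lebesgue_measure]_(t in `]0, +oo[) (t `^ (x - 1) * expR (- t)).

Definition nceil (R : realType) (alpha : R) : nat := `|Num.ceil alpha|%N.

(* Riemann-Liouville integral of order alpha >= 0. *)
Definition RLint (R : realType) (alpha : R) (y : R -> R) (t : R) : R :=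
  if alpha == 0 then y t
  else (Gamma alpha)^-1 *
       \int[lebesgue_measure]_(tau in `]0, t[)
         ((t - tau) `^ (alpha - 1) * y tau).

(* [RLint alpha y t] is given by a convergent integral. *)
Definition RLintegrable (R : realType) (alpha : R) (y : R -> R) (t : R) :
    Prop :=
  alpha = 0 \/
  lebesgue_measure.-integrable `]0, t[
    (EFin \o (fun tau : R => (t - tau) `^ (alpha - 1) * y tau)).

Definition n_derivable (R : realType) (n : nat) (f : R -> R) (t : R) : Prop :=
  forall k, (k < n)%N -> \forall u \near t, derivable (derive1n k f) u 1.

(* Riemann-Liouville derivative of order alpha > 0. *)
Definition RLderiv (R : realType) (alpha : R) (y : R -> R) : R -> R :=
  derive1n (nceil alpha) (RLint ((nceil alpha)%:R - alpha) y).

Definition RLderivable (R : realType) (alpha : R) (y : R -> R) (t : R) :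
    Prop :=
  (\forall u \near t, RLintegrable ((nceil alpha)%:R - alpha) y u) /\
  n_derivable (nceil alpha) (RLint ((nceil alpha)%:R - alpha) y) t.

(* Caputo derivative of order alpha > 0. *)
Definition caputo (R : realType) (alpha : R) (y : R -> R) : R -> R :=
  RLint ((nceil alpha)%:R - alpha) (derive1n (nceil alpha) y).

Definition caputo_derivable (R : realType) (alpha : R) (y : R -> R) (t : R) :
    Prop :=
  (forall u, 0 < u <= t -> n_derivable (nceil alpha) y u) /\
  RLintegrable ((nceil alpha)%:R - alpha) (derive1n (nceil alpha) y) t.

(** * Laplace transformable distributions supported in [0, +oo[

   These are functionals on smooth functions all of whose derivatives decay at
   +oo faster than e^(- eta t) for some eta > c; this class contains the
   compactly supported smooth functions as well as t |-> e^(- s t) for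
   Re s > c, so that the Laplace transform of T at s is simply
   < T, e^(- s t) > (Zemanian's definition).  No condition is put on the
   behaviour of test functions on ]-oo, 0[, as supports lie in [0, +oo[. *)

Definition smooth (R : realType) (phi : R -> R) : Prop :=
  forall (n : nat) (t : R), derivable (derive1n n phi) t 1.

Definition test_function (R : realType) (c : R) (phi : R -> R) : Prop :=
  smooth phi /\
  exists2 eta, c < eta & forall n : nat, exists M : R, forall t, 0 <= t ->
    expR (eta * t) * `|derive1n n phi t| <= M.

(* Seminorm bounds only involve t >= 0, which encodes supp T in [0, +oo[.
   The values of T outside the space of test functions are irrelevant. *)
Definition distribution (R : realType) (c : R) (T : (R -> R) -> R) : Prop :=
  (forall (k : R) (phi psi : R -> R),
     test_function c phi -> test_function c psi ->
     T (fun t => k * phi t + psi t) = k * T phi + T psi) /\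
  (forall eta, c < eta -> exists (C : R) (m : nat),
     forall (phi : R -> R) (M : R), test_function c phi ->
       (forall n t, (n <= m)%N -> 0 <= t ->
          expR (eta * t) * `|derive1n n phi t| <= M) ->
       `|T phi| <= C * M).

Definition dlaplace (R : realType) (T : (R -> R) -> R) (s : R[i]) : R[i] :=
  T (fun t => Re (laplace_kernel s t)) +i*
  T (fun t => Im (laplace_kernel s t)).

Definition inverse_dlaplace (R : realType) (c : R) (F : R[i] -> R[i])
    (T : (R -> R) -> R) : Prop :=
  distribution c T /\ forall s, c < Re s -> dlaplace T s = F s.

(** ** Operations on distributions, by transposition *)

Definition dmulX (R : realType) (T : (R -> R) -> R) (phi : R -> R) : R :=
  T (fun t => t * phi t).

Definition dderiv (R : realType) (T : (R -> R) -> R) (phi : R -> R) : R :=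
  - T (derive1 phi).

(* The primitive "int_0^t T". *)
Definition dprim (R : realType) (T : (R -> R) -> R) (phi : R -> R) : R :=
  T (fun t => \int[lebesgue_measure]_(tau in `]t, +oo[) phi tau).

(* The transpose of [RLint alpha]. *)
Definition right_RLint (R : realType) (alpha : R) (phi : R -> R) (t : R) : R :=
  if alpha == 0 then phi t
  else (Gamma alpha)^-1 *
       \int[lebesgue_measure]_(tau in `]t, +oo[)
         ((tau - t) `^ (alpha - 1) * phi tau).

Definition dRLint (R : realType) (alpha : R) (T : (R -> R) -> R)
    (phi : R -> R) : R :=
  T (right_RLint alpha phi).

Definition dRLderiv (R : realType) (alpha : R) (T : (R -> R) -> R) :
    (R -> R) -> R :=
  iter (nceil alpha) (@dderiv R) (dRLint ((nceil alpha)%:R - alpha) T).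

Definition dcaputo (R : realType) (alpha : R) (T : (R -> R) -> R) :
    (R -> R) -> R :=
  dRLint ((nceil alpha)%:R - alpha) (iter (nceil alpha) (@dderiv R) T).

(* Near 0 on the right, T is given by a function with limit l at 0. *)
Definition dcvg_at_right0 (R : realType) (T : (R -> R) -> R) (l : R) : Prop :=
  exists2 eps : R, 0 < eps & exists f : R -> R,
    [/\ forall t, 0 < t < eps -> {for t, continuous f},
        f t @[t --> 0^'+] --> l &
        forall (phi : R -> R) (u v : R), smooth phi -> 0 < u -> v < eps ->
          (forall t, ~~ (u <= t <= v) -> phi t = 0) ->
          T phi = \int[lebesgue_measure]_(t in `]0, eps[) (f t * phi t)].

(* Main.v *)
(** Let [nu < 1] and F_mu(s) = s^(-mu) e^(-a s^nu), which decays faster than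
    any power of |s| in the half-plane Re s > 0.  Let Y_mu(t) be the Bromwich
    integral of e^(ts) F_mu(s) along a line Re s = sigma.  It does not depend on
    sigma > 0: its derivative in sigma is the integral of a derivative along the
    line.  Letting sigma tend to infinity gives Y_mu = 0 on ]-oo, 0], whence the
    limit at 0.  Differentiating under the integral gives Y_mu' = Y_(mu-1),
    integrating by parts gives t Y_mu = mu Y_(mu+1) + a nu Y_(mu+1-nu), and the
    Gamma integral of a complex parameter shows that the Riemann-Liouville
    integral of order b maps Y_mu to Y_(mu+b); both equations of the theorem are
    instances of the second identity.  That the Laplace transform of Y_mu is F_mu
    is, by Fubini, Cauchy's formula for F_mu on a line.

    For [nu = 1] the inverse transform is (t - a)_+^(mu-1) / Gamma(mu), read for
    small mu as the distribution
    phi |-> - Gamma(mu+1)^(-1) int_a^oo (t - a)^mu phi'(t) dt.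

    Inverse transforms are unique because, in the variable x = e^(-t),
    polynomials are dense (Weierstrass): what vanishes on the exponentials
    e^(-st) vanishes. *)

Require Import Defs.
From HB Require Import structures.
From mathcomp Require Import all_boot all_order all_algebra.
From mathcomp Require Import all_classical all_reals all_analysis.
From mathcomp Require Import measurable_realfun complex.
From mathcomp Require Import ring lra.
Set Implicit Arguments.
Unset Strict Implicit.
Unset Printing Implicit Defensive.
Import Order.TTheory GRing.Theory Num.Theory.
Import numFieldNormedType.Exports.
Local Open Scope classical_set_scope.
Local Open Scope ring_scope.
Local Open Scope complex_scope.
Local Notation leb := (@lebesgue_measure _).
Local Notation Re := complex.Re.
Local Notation Im := complex.Im.

(** * Derivatives and improper integrals of real functions *)

(** The decay of the symbol comes from |arg s| < pi / 2: the real part of s^nu is at least cos (nu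
    pi / 2) |s|^nu, and this cosine is positive because nu < 1. At nu = 1 it is 0 and the inverse
    transform loses its smoothness at [a], so that case needs its own construction.

    The basic estimate is C / Re z times 1 / (1 + (Im z)^2). The second factor is integrable on
    vertical lines; the first makes integrals vanish as the line moves to the right, even at t = 0,
    where e^(tz) does not help.

    Contours are never closed: paths are deformed by differentiating an integral in a real
    parameter, so holomorphy enters only as a chain rule along curves. Cauchy's formula is treated
    in this way too: the symbol is deformed to a constant, and the remaining rational integral has
    an explicit antiderivative.

    For distributions, density of polynomials is not enough by itself, because m derivatives must be
    approximated at once in a weighted norm. The m-th derivative is approximated, and the lower ones
    follow by integrating from infinity. *)

Definition rderive (R : realType) (f : R -> R) (t d : R) : Prop :=
  is_derive t 1 f d.

Section derivative_rules.
Context (R : realType).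
Implicit Types (f g : R -> R) (t d e : R).

Lemma rderive_eq f t d e : rderive f t d -> d = e -> rderive f t e.
Proof. by move=> ? <-. Qed.

Lemma rderive_cst (c t : R) : rderive (fun=> c) t 0.
Proof. exact: is_derive_cst. Qed.

Lemma rderive_id t : rderive (fun x => x) t 1.
Proof. exact: is_derive_id. Qed.

Lemma rderiveN f t d : rderive f t d -> rderive (fun x => - f x) t (- d).
Proof. exact: is_deriveN. Qed.

Lemma rderiveD f g t d e : rderive f t d -> rderive g t e ->
  rderive (fun x => f x + g x) t (d + e).
Proof. exact: is_deriveD. Qed.

Lemma rderiveM f g t d e : rderive f t d -> rderive g t e ->
  rderive (fun x => f x * g x) t (f t * e + g t * d).
Proof. exact: is_deriveM. Qed.

Lemma rderiveX f n t d : rderive f t d ->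
  rderive (fun x => f x ^+ n) t (n%:R * f t ^+ n.-1 * d).
Proof.
move=> df; have := @is_deriveX _ _ f n t 1 d df.
by rewrite exprfctE.
Qed.

Lemma rderive_comp (h : R -> R) f t d e : rderive h (f t) e -> rderive f t d ->
  rderive (fun x => h (f x)) t (e * d).
Proof. by move=> hh hf; exact: is_derive1_comp. Qed.

Lemma rderiveV f t d : f t != 0 -> rderive f t d ->
  rderive (fun x => (f x)^-1) t (- (f t) ^- 2 * d).
Proof. by move=> ft hf; exact: is_deriveV. Qed.

Lemma rderive_expR f t d : rderive f t d ->
  rderive (fun x => expR (f x)) t (expR (f t) * d).
Proof. by apply: rderive_comp; exact: is_derive_expR. Qed.

Lemma rderive_cos f t d : rderive f t d ->
  rderive (fun x => cos (f x)) t (- sin (f t) * d).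
Proof. by apply: rderive_comp; exact: is_derive_cos. Qed.

Lemma rderive_sin f t d : rderive f t d ->
  rderive (fun x => sin (f x)) t (cos (f t) * d).
Proof. by apply: rderive_comp; exact: is_derive_sin. Qed.

Lemma rderive_atan f t d : rderive f t d ->
  rderive (fun x => atan (f x)) t ((1 + f t ^+ 2)^-1 * d).
Proof. by apply: rderive_comp; exact: is_derive1_atan. Qed.

Lemma rderive_ln f t d : 0 < f t -> rderive f t d ->
  rderive (fun x => ln (f x)) t ((f t)^-1 * d).
Proof. by move=> ft; apply: rderive_comp; exact: is_derive1_ln. Qed.

Lemma rderive_powR f p t d : 0 < f t -> rderive f t d ->
  rderive (fun x => f x `^ p) t (p * f t `^ (p - 1) * d).
Proof.
move=> ft; apply: (@rderive_comp (fun x => x `^ p)).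
exact: is_derive1_powR.
Qed.

Lemma rderive_continuous f t d : rderive f t d -> {for t, continuous f}.
Proof.
move=> df; apply/differentiable_continuous/derivable1_diffP.
exact: (@ex_derive _ _ _ _ _ _ _ df).
Qed.

Lemma rderive_near f g t d : (\forall x \near t, f x = g x) ->
  rderive f t d -> rderive g t d.
Proof. by move=> fg; apply: near_eq_is_derive fg; rewrite oner_eq0. Qed.

End derivative_rules.

Ltac rder :=
  lazymatch goal with
  | H : rderive ?f ?t _ |- rderive ?f ?t _ => exact H
  | |- rderive (fun x => x) _ _ => exact (rderive_id _)
  | |- rderive (fun=> ?c) _ _ => exact (rderive_cst c _)
  | |- rderive (fun x => GRing.opp (@?f x)) _ _ =>
      eapply (@rderiveN _ f); rder
  | |- rderive (fun x => GRing.add (@?f x) (@?g x)) _ _ =>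
      eapply (@rderiveD _ f g); [rder | rder]
  | |- rderive (fun x => GRing.mul (@?f x) (@?g x)) _ _ =>
      eapply (@rderiveM _ f g); [rder | rder]
  | |- rderive (fun x => GRing.exp (@?f x) ?n) _ _ =>
      eapply (@rderiveX _ f n); rder
  | |- rderive (fun x => GRing.inv (@?f x)) _ _ =>
      eapply (@rderiveV _ f); [ | rder]
  | |- rderive (fun x => expR (@?f x)) _ _ => eapply (@rderive_expR _ f); rder
  | |- rderive (fun x => cos (@?f x)) _ _ => eapply (@rderive_cos _ f); rder
  | |- rderive (fun x => sin (@?f x)) _ _ => eapply (@rderive_sin _ f); rder
  | |- rderive (fun x => atan (@?f x)) _ _ => eapply (@rderive_atan _ f); rder
  | |- rderive (fun x => ln (@?f x)) _ _ => eapply (@rderive_ln _ f); [ | rder]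
  | |- rderive (fun x => powR (@?f x) ?p) _ _ =>
      eapply (@rderive_powR _ f p); [ | rder]
  end.

(** Dominated convergence for the restrictions of [f] to [A n], with |f| as the bound. Through it
    improper integrals inherit the fundamental theorem from compact intervals. *)
Lemma cvg_Rintegral_exhaust (R : realType) (D : set R) (A : nat -> set R)
    (f : R -> R) :
  measurable D -> (forall n, measurable (A n)) -> (forall n, A n `<=` D) ->
  (forall x, D x -> \forall n \near \oo, A n x) ->
  leb.-integrable D (EFin \o f) ->
  \int[leb]_(x in A n) f x @[n --> \oo] --> \int[leb]_(x in D) f x.
Proof.
move=> mD mA AD DA fi.
have mf := measurable_int _ fi.
rewrite (_ : (fun n => _) =
    fun n => fine (\int[leb]_(x in D) ((EFin \o f) \_ (A n)) x)%E); last first.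
  apply/funext => n; rewrite /Rintegral -integral_mkcondr.
  by rewrite (setIidr (AD n)).
apply: fine_cvg; rewrite fineK; last exact: integrable_fin_num.
apply: (@dominated_cvg _ _ _ leb D mD _ _ (fun x => `|(f x)%:E|%E)).
- move=> n; apply/(measurable_restrict _ (mA n) mD).
  by apply: measurable_funS mf => // x [].
- move=> x Dx; apply: cvg_near_cst; have := DA x Dx; apply: filterS => n Anx.
  by rewrite /= patchE mem_set.
- by [].
- exact: integrable_abse.
- move=> n x Dx /=; rewrite patchE; case: ifP => //= _.
  by rewrite normr0 lee_fin.
Qed.

(** Monotone convergence: the [A n] increase to [D], so the uniform bound on the partial integrals
    passes to the limit. *)
Lemma ge0_integrable_exhaust (R : realType) (D : set R) (A : nat -> set R)
    (f : R -> R) (M : R) :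
  measurable D -> (forall n, measurable (A n)) -> (forall n, A n `<=` D) ->
  (forall m n, (m <= n)%N -> A m `<=` A n) ->
  (forall x, D x -> exists n, A n x) ->
  measurable_fun D f -> (forall x, D x -> 0 <= f x) ->
  (forall n, (\int[leb]_(x in A n) (f x)%:E <= M%:E)%E) ->
  leb.-integrable D (EFin \o f).
Proof.
move=> mD mA AD A_mono DA mf f0 fM; apply/integrableP; split.
  exact/measurable_EFinP.
have -> : (\int[leb]_(x in D) `|(EFin \o f) x| = \int[leb]_(x in D) (f x)%:E)%E.
  by apply: eq_integral => x /set_mem Dx; rewrite /= ger0_norm// (f0 _ Dx).
have fc : (\int[leb]_(x in D) ((EFin \o f) \_ (A n)) x)%E @[n --> \oo] -->
    (\int[leb]_(x in D) (f x)%:E)%E.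
  have -> : (\int[leb]_(x in D) (f x)%:E)%E =
      (\int[leb]_(x in D) (limn (fun n => ((EFin \o f) \_ (A n)) x)))%E.
    apply: eq_integral => x /set_mem Dx; apply/esym/cvg_lim => //.
    have [n Anx] := DA x Dx.
    apply: cvg_near_cst; exists n => //= m /= nm.
    have Amx : x \in A m by apply/mem_set/(A_mono _ _ nm).
    by rewrite patchE Amx.
  apply: (@cvg_monotone_convergence _ _ _ leb D mD
    (fun n => (EFin \o f) \_ (A n))).
  - move=> n; apply/(measurable_restrict _ (mA n) mD).
    by apply/measurable_EFinP; apply: measurable_funS mf => // x [].
  - by move=> n x Dx; rewrite patchE; case: ifP => //= _; rewrite lee_fin (f0 _ Dx).
  - move=> x Dx m n mn; rewrite !patchE; case: ifPn => [/set_mem Am|_].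
      have -> // : x \in A n by apply/mem_set/(A_mono _ _ mn).
    by case: ifPn => //= _; rewrite lee_fin (f0 _ Dx).
apply: (@le_lt_trans _ _ M%:E); last exact: ltry.
apply: (cvge_to_le fc).
apply: nearW => n; rewrite -integral_mkcondr (setIidr (AD n)); exact: fM.
Qed.

Lemma cvgr_succn (R : realType) : n.+1%:R @[n --> \oo] --> (+oo : set_system R).
Proof.
apply/cvgryPge => M; exists (Num.truncn `|M|) => // n /= Mn.
have := truncnS_gt M; move/ltW/le_trans; apply; rewrite ler_nat ltnS.
by apply: leq_trans Mn; exact: le_truncn (ler_norm _).
Qed.

Section ftc.
Context (R : realType).
Implicit Types (F f : R -> R).

Lemma Rintegral_ftc F f (a b : R) : a < b ->
  (forall x, a <= x <= b -> rderive F x (f x)) ->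
  (forall x, a <= x <= b -> {for x, continuous f}) ->
  \int[leb]_(x in `[a, b]) f x = F b - F a.
Proof.
move=> ab dF cf; rewrite /Rintegral (@continuous_FTC2 _ f F)//.
- apply: continuous_in_subspaceT => x /set_mem/=; rewrite in_itv/=; exact: cf.
- have cF x : a <= x <= b -> F y @[y --> x] --> F x.
    by move=> /dF /rderive_continuous.
  split.
  + move=> x; rewrite in_itv/= => /andP[ax xb].
    by apply: (@ex_derive _ _ _ _ _ _ (f x)); apply: dF; rewrite !ltW.
  + by apply: cvg_at_right_filter; apply: cF; rewrite lexx ltW.
  + by apply: cvg_at_left_filter; apply: cF; rewrite lexx ltW.
- move=> x; rewrite in_itv/= => /andP[ax xb]; rewrite derive1E.
  by apply: derive_val; apply: dF; rewrite !ltW.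
Qed.

Lemma RintegralT_ftc F f (A B : R) :
  (forall x : R, rderive F x (f x)) -> continuous f ->
  leb.-integrable setT (EFin \o f) ->
  F x @[x --> -oo] --> A -> F x @[x --> +oo] --> B ->
  \int[leb]_x f x = B - A.
Proof.
move=> dF cf fi FA FB.
have h : \int[leb]_(x in `[- n.+1%:R, n.+1%:R]) f x @[n --> \oo] --> \int[leb]_x f x.
  apply: cvg_Rintegral_exhaust => // x _.
  exists (Num.truncn `|x|).+1 => // n /= xn; rewrite in_itv/= -ler_norml.
  have := truncnS_gt `|x|; move/ltW/le_trans; apply; rewrite ler_nat.
  exact: leq_trans (leqnSn _).
have cvgS : n.+1%:R @[n --> \oo] --> (+oo : set_system R).
  exact: cvgr_succn.
have g : \int[leb]_(x in `[- n.+1%:R, n.+1%:R]) f x @[n --> \oo] --> B - A.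
  rewrite (_ : (fun n => _) = fun n => F n.+1%:R - F (- n.+1%:R)); last first.
    apply/funext => n; apply: Rintegral_ftc => // [|x _]; last exact: cf.
    by rewrite gtrN// ltr0n.
  apply: cvgB.
    exact: cvg_comp FB.
  apply: cvg_comp FA.
  apply/cvgrNyPle => M; have /cvgryPge/(_ (- M)) := cvgS.
  by apply: filterS => n; rewrite lerNl.
exact: cvg_unique h g.
Qed.

Lemma Rintegraly_ftc F f (c A B : R) :
  (forall x : R, c < x -> rderive F x (f x)) ->
  (forall x : R, c < x -> {for x, continuous f}) ->
  leb.-integrable `]c, +oo[ (EFin \o f) ->
  F x @[x --> c^'+] --> A -> F x @[x --> +oo] --> B ->
  \int[leb]_(x in `]c, +oo[) f x = B - A.
Proof.
move=> dF cf fi FA FB.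
(* The indices n + 1 and n + 2 make the interval nondegenerate already at n = 0, since 1 / (n + 1)
   <= 1 < n + 2. *)
pose u n : R := c + n.+1%:R^-1.
pose v n : R := c + n.+2%:R.
have uc n : c < u n by rewrite ltrDl invr_gt0 ltr0n.
have uv n : u n < v n.
  rewrite ltrD2l (@le_lt_trans _ _ 1)//; last by rewrite ltr1n.
  by rewrite invf_le1 ?ltr0n// ler1n.
have cvgS : n.+1%:R @[n --> \oo] --> (+oo : set_system R).
  exact: cvgr_succn.
have cvgu : u n @[n --> \oo] --> c.
  rewrite -[X in _ --> X]addr0; apply: cvgD; first exact: cvg_cst.
  exact: cvg_harmonic.
have h : \int[leb]_(x in `[u n, v n]) f x @[n --> \oo] --> \int[leb]_(x in `]c, +oo[) f x.
  apply: cvg_Rintegral_exhaust => //.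
    move=> n x /=; rewrite !in_itv/= andbT => /andP[+ _].
    exact: lt_le_trans.
  move=> x /=; rewrite in_itv/= andbT => cx.
  have h1 : \forall n \near \oo, u n <= x.
    have := cvgu; move/cvgr_le; apply => //.
  have h2 : \forall n \near \oo, x - c <= n.+1%:R by move/cvgryPge : cvgS.
  near=> n; rewrite /= in_itv/=; apply/andP; split; first by near: n.
  rewrite -lerBlDl (@le_trans _ _ n.+1%:R)//; first by near: n.
  by rewrite ler_nat.
have g : \int[leb]_(x in `[u n, v n]) f x @[n --> \oo] --> B - A.
  rewrite (_ : (fun n => _) = fun n => F (v n) - F (u n)); last first.
    apply/funext => n; apply: Rintegral_ftc => [//|x /andP[ux _]|x /andP[ux _]].
      by apply: dF; exact: lt_le_trans ux.
    by apply: cf; exact: lt_le_trans ux.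
  apply: cvgB.
    apply: cvg_comp FB; apply/cvgryPge => M.
    have : \forall n \near \oo, M - c <= n.+1%:R by move/cvgryPge : cvgS.
    apply: filterS => n nM; rewrite -lerBlDl (le_trans nM)// ler_nat//.
  by move/cvg_at_rightP : FA; apply.
exact: cvg_unique h g.
Unshelve. all: end_near. Qed.

End ftc.

Lemma le_integrableR (R : realType) (D : set R) (f g : R -> R) :
  measurable D -> measurable_fun D f -> (forall x, D x -> `|f x| <= g x) ->
  leb.-integrable D (EFin \o g) -> leb.-integrable D (EFin \o f).
Proof.
move=> mD mf fg; apply: le_integrable => //; first exact/measurable_EFinP.
by move=> x Dx; rewrite lee_fin (le_trans (fg _ Dx))// ler_norm.
Qed.

Section integrable_real.
Context (R : realType) (D : set R).
Hypothesis mD : measurable D.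
Implicit Types f g : R -> R.

Lemma integrableDR f g : leb.-integrable D (EFin \o f) ->
  leb.-integrable D (EFin \o g) ->
  leb.-integrable D (EFin \o (fun x => f x + g x)).
Proof. by move=> fi gi; exact: (@integrableD _ _ _ leb D mD _ _ fi gi). Qed.

Lemma integrableBR f g : leb.-integrable D (EFin \o f) ->
  leb.-integrable D (EFin \o g) ->
  leb.-integrable D (EFin \o (fun x => f x - g x)).
Proof. by move=> fi gi; exact: (@integrableB _ _ _ leb D mD _ _ fi gi). Qed.

Lemma integrableZR k f : leb.-integrable D (EFin \o f) ->
  leb.-integrable D (EFin \o (fun x => k * f x)).
Proof. by move=> fi; exact: (@integrableZl _ _ _ leb D mD k _ fi). Qed.

End integrable_real.

(** * Change of variables for reflections and translations *)

Section measure_preserving.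
Context (R : realType) (phi : R -> R).
Hypothesis mphi : measurable_fun setT phi.
Hypothesis phi_leb : forall A : set R, measurable A ->
  pushforward leb (phi : _ -> measurableTypeR R) A = leb A.
Implicit Types (D : set R) (f : R -> R).

Let ge0_mp D (f : R -> \bar R) : measurable D -> measurable_fun D f ->
  (forall x, 0 <= f x)%E ->
  (\int[leb]_(x in phi @^-1` D) (f \o phi) x = \int[leb]_(x in D) f x)%E.
Proof.
move=> mD mf f0.
transitivity (\int[pushforward leb (phi : _ -> measurableTypeR R)]_(y in D) f y)%E.
  by apply/esym/ge0_integral_pushforward => // x _; exact: f0.
by apply: eq_measure_integral => A mA _; exact: phi_leb.
Qed.

Let mcomp D f : measurable D -> measurable_fun D f ->
  measurable_fun (phi @^-1` D) (f \o phi).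
Proof.
move=> mD mf; apply: (measurable_comp mD) => //.
  by move=> _ [x xD <-].
exact: measurable_funS mphi.
Qed.

Lemma integrable_mp D f : measurable D ->
  leb.-integrable D (EFin \o f) ->
  leb.-integrable (phi @^-1` D) (EFin \o (f \o phi)).
Proof.
move=> mD /integrableP[/measurable_EFinP mf fi]; apply/integrableP; split.
  by apply/measurable_EFinP; exact: mcomp.
rewrite (@ge0_mp D (fun x => `|(EFin \o f) x|%E))//.
by apply: measurableT_comp => //; exact/measurable_EFinP.
Qed.

(** Positive and negative parts are transported separately by the pushforward formula for
    nonnegative functions. *)
Lemma Rintegral_mp D f : measurable D -> measurable_fun D f ->
  \int[leb]_(x in D) f x = \int[leb]_(x in phi @^-1` D) f (phi x).
Proof.
move=> mD mf; rewrite /Rintegral; congr fine.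
rewrite integralE [RHS]integralE.
have mp : measurable_fun D (EFin \o f)^\+%E.
  exact/measurable_funepos/measurable_EFinP.
have mn : measurable_fun D (EFin \o f)^\-%E.
  exact/measurable_funeneg/measurable_EFinP.
congr (_ - _)%E.
  rewrite -[LHS](ge0_mp mD mp)//.
  by apply: eq_integral => x _; rewrite /= !funeposE.
rewrite -[LHS](ge0_mp mD mn)//.
by apply: eq_integral => x _; rewrite /= !funenegE.
Qed.

End measure_preserving.

(** Lebesgue measure is determined by half-open intervals, and reflecting []a, b]] preserves its
    length. *)
Lemma pushforward_leb_reflect (R : realType) (c : R) (A : set R) : measurable A ->
  pushforward leb ((fun x => c - x) : _ -> measurableTypeR R) A = leb A.
Proof.
move=> mA.
have mphi : measurable_fun setT (fun x : R => c - x).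
  by apply: measurable_funB.
apply/esym/lebesgue_measure_unique => //= _ [[a b]] _ <-.
rewrite /pushforward.
have -> : (fun x : R => c - x) @^-1` `]a, b] = `[c - b, c - a[%classic.
  by apply/seteqP; split => x /=; rewrite !in_itv/=; lra.
rewrite !lebesgue_measure_itv/= !lte_fin ltrD2l ltrN2.
by case: ifPn => // _; congr (_%:E); ring.
Qed.

Lemma pushforward_leb_shift (R : realType) (c : R) (A : set R) : measurable A ->
  pushforward leb ((fun x => x + c) : _ -> measurableTypeR R) A = leb A.
Proof.
move=> mA.
have mphi : measurable_fun setT (fun x : R => x + c).
  by apply: measurable_funD.
apply/esym/lebesgue_measure_unique => //= _ [[a b]] _ <-.
rewrite /pushforward.
have -> : (fun x : R => x + c) @^-1` `]a, b] = `]a - c, b - c]%classic.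
  by apply/seteqP; split => x /=; rewrite !in_itv/=; lra.
rewrite !lebesgue_measure_itv/= !lte_fin ltrD2r.
by case: ifPn => // _; congr (_%:E); ring.
Qed.

(** The tangent of slope [q] to the convex function [k * expR u], read off from 1 + x <= e^x at x =
    u + ln (k / q). With u the logarithm of a modulus, it says that an exponential beats every
    power. *)
Lemma lin_sub_exp_bounded (R : realType) (q k : R) : 0 <= q -> 0 < k ->
  exists K : R, forall u, q * u - k * expR u <= K.
Proof.
rewrite le_eqVlt => /predU1P[<-|q0] k0.
  by exists 0 => u; rewrite mul0r sub0r oppr_le0 mulr_ge0 ?expR_ge0 ?ltW.
exists (- (q * (1 + ln (k / q)))) => u.
have kq0 : 0 < k / q by rewrite divr_gt0.
have := expR_ge1Dx (u + ln (k / q)).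
rewrite expRD lnK ?posrE// => h.
have -> : k * expR u = q * (expR u * (k / q)) by field; rewrite gt_eqF.
have := ler_wpM2l (ltW q0) h; lra.
Qed.

(** * Integrability from antiderivatives *)

Section integrability.
Context (R : realType).
Implicit Types (F f : R -> R).

(** For a nonnegative function, bounded increments of an antiderivative bound the integrals over the
    exhausting segments. The exponential, the inverse quadratic and the powers on []0, 1]] are all
    treated by exhibiting such an antiderivative. *)
Lemma ge0_integrable_ftc (D : set R) (u v : nat -> R) F f (M : R) :
  measurable D -> (forall n, u n < v n) -> (forall n, `[u n, v n] `<=` D) ->
  (forall m n, (m <= n)%N -> u n <= u m /\ v m <= v n) ->
  (forall x, D x -> exists n, u n <= x <= v n) ->
  measurable_fun D f -> (forall x, D x -> 0 <= f x) ->
  (forall x : R, D x -> rderive F x (f x)) ->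
  (forall x : R, D x -> {for x, continuous f}) ->
  (forall x y, D x -> D y -> F y - F x <= M) ->
  leb.-integrable D (EFin \o f).
Proof.
move=> mD uv uvD mono exh mf f0 dF cf FM.
apply: (@ge0_integrable_exhaust _ D (fun n => `[u n, v n]%classic) f M) => //.
- move=> m n mn x /=; rewrite !in_itv/= => /andP[h1 h2].
  have [h3 h4] := mono _ _ mn; rewrite (le_trans h3 h1)/=.
  exact: le_trans h4.
- move=> n.
  have sub x : u n <= x <= v n -> D x.
    by move=> ?; apply: (uvD n); rewrite /= in_itv.
  have fi : leb.-integrable `[u n, v n] (EFin \o f).
    apply: continuous_compact_integrable; first exact: segment_compact.
    apply: continuous_in_subspaceT => x /set_mem/=; rewrite in_itv/= => h.
    exact/cf/sub.
  rewrite -[X in (X <= _)%E]fineK; last exact: integrable_fin_num fi.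
  rewrite lee_fin -/(Rintegral _ _ _) (@Rintegral_ftc _ F)//.
  - by apply: FM; apply: sub; rewrite lexx ltW.
  - by move=> x /sub; exact: dF.
  - by move=> x /sub; exact: cf.
Qed.

Lemma integrable_expRN (x : R) : 0 < x ->
  leb.-integrable `[0, +oo[ (EFin \o (fun t => expR (- (x * t)))).
Proof.
move=> x0.
have dF (t : R) : rderive (fun t => - x^-1 * expR (- (x * t))) t (expR (- (x * t))).
  by apply: rderive_eq; [rder|rewrite /=; field; rewrite gt_eqF].
have cf : continuous (fun t => expR (- (x * t))).
  move=> t; apply: continuous_comp; last exact: continuous_expR.
  by apply: cvgN; apply: cvgM; [exact: cvg_cst|exact: cvg_id].
apply: (@ge0_integrable_ftc _ (fun n => 0) (fun n => n.+1%:R)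
   (fun t => - x^-1 * expR (- (x * t))) _ x^-1) => //.
- by move=> n t /=; rewrite !in_itv/= => /andP[->].
- by move=> m n mn; rewrite lexx ler_nat.
- move=> t /=; rewrite in_itv/= andbT => t0; exists (Num.truncn t).
  by rewrite t0/=; exact/ltW/truncnS_gt.
- by apply: measurable_funTS; exact: continuous_measurable_fun.
- by move=> t _; exact: cf.
- move=> s t xs _.
  have h1 : expR (- (x * s)) <= 1.
    rewrite -[leRHS]expR0 ler_expR oppr_le0 mulr_ge0 ?(ltW x0)//.
    by move: xs; rewrite /= in_itv/= andbT.
  have h2 := expR_ge0 (- (x * t)).
  by rewrite -mulrBr mulNr -mulrN ler_piMr ?invr_ge0 ?(ltW x0)//; lra.
Qed.

Lemma integrable_inv_sqr (X : R) : 0 < X ->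
  leb.-integrable setT (EFin \o (fun u => (X ^+ 2 + u ^+ 2)^-1)).
Proof.
move=> X0.
have p0 (u : R) : 0 < X ^+ 2 + u ^+ 2 by rewrite ltr_wpDr ?sqr_ge0// exprn_gt0.
have n0 (u : R) : X ^+ 2 + u ^+ 2 != 0 by rewrite gt_eqF.
have df (u : R) : rderive (fun u => (X ^+ 2 + u ^+ 2)^-1) u
   (- 2 * u / (X ^+ 2 + u ^+ 2) ^+ 2).
  by apply: rderive_eq; [rder => //|rewrite /=; field].
have cf : continuous (fun u : R => (X ^+ 2 + u ^+ 2)^-1).
  by move=> u; exact: rderive_continuous (df u).
apply: (@ge0_integrable_ftc _ (fun n => - n.+1%:R) (fun n => n.+1%:R)
   (fun t => X^-1 * atan (t / X)) _ (X^-1 * pi)) => //.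
- by move=> n; rewrite gtrN// ltr0n.
- by move=> m n mn; rewrite lerN2 ler_nat.
- move=> t _; exists (Num.truncn `|t|); rewrite -ler_norml.
  exact/ltW/truncnS_gt.
- exact: continuous_measurable_fun.
- by move=> u _; rewrite invr_ge0 ltW.
- move=> u _; apply: rderive_eq; first by rder.
  rewrite /=; field; rewrite n0 gt_eqF//=.
- by move=> u _; exact: cf.
- move=> x y _ _; rewrite -mulrBr ler_pM2l ?invr_gt0//.
  have := atan_ltpi2 (y / X); have := atan_gtNpi2 (x / X); lra.
Qed.

Lemma integrable_powR01 (p : R) : -1 < p ->
  leb.-integrable `]0, 1] (EFin \o (fun t => t `^ p)).
Proof.
move=> p1; have p10 : 0 < p + 1 by lra.
have df (t : R) : 0 < t -> rderive (fun t => (p + 1)^-1 * t `^ (p + 1)) t (t `^ p).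
  move=> t0; apply: rderive_eq; first by rder.
  rewrite /= -addrA subrr addr0; field; lra.
(* The left ends start at 1 / 2, so that every segment up to 1 is nondegenerate. *)
apply: (@ge0_integrable_ftc _ (fun n => n.+2%:R^-1) (fun n => 1)
   (fun t => (p + 1)^-1 * t `^ (p + 1)) _ (p + 1)^-1) => //.
- by move=> n; rewrite invf_lt1 ?ltr0n// ltr1n.
- move=> n t /=; rewrite !in_itv/= => /andP[h ->]; rewrite andbT.
  by apply: lt_le_trans h; rewrite invr_gt0 ltr0n.
- by move=> m n mn; rewrite lexx lef_pV2 ?posrE ?ltr0n// ler_nat.
- move=> t /=; rewrite in_itv/= => /andP[t0 ->]; exists (Num.truncn t^-1).
  rewrite andbT invf_ple ?posrE ?ltr0n//.
  by rewrite (le_trans (ltW (truncnS_gt _)))// ler_nat.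
- by apply: measurable_funTS; exact: measurable_powR.
- by move=> t /=; rewrite powR_ge0.
- by move=> t /=; rewrite in_itv/= => /andP[t0 _]; exact: df.
- move=> t /=; rewrite in_itv/= => /andP[t0 _].
  by apply: rderive_continuous; apply: rderive_powR t0 (rderive_id t).
- move=> x y /=; rewrite !in_itv/= => /andP[x0 x1] /andP[y0 y1].
  rewrite -mulrBr ler_piMr ?invr_ge0 ?(ltW p10)//.
  have h1 : 0 <= x `^ (p + 1) by rewrite powR_ge0.
  have : y `^ (p + 1) <= 1 `^ (p + 1) by rewrite ge0_ler_powR ?nnegrE// ltW.
  rewrite powR1; lra.
Qed.

Lemma powR_expR_bounded (p k : R) : 0 <= p -> 0 < k ->
  exists2 C : R, 0 <= C & forall t, 0 < t -> t `^ p * expR (- (k * t)) <= C.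
Proof.
move=> p0 k0; have [K hK] := lin_sub_exp_bounded p0 k0.
exists (expR K); first exact: expR_ge0.
move=> t t0; rewrite /powR gt_eqF// -expRD ler_expR.
by have := hK (ln t); rewrite lnK.
Qed.

(** The power alone dominates on []0, 1]]; beyond 1, half of the exponential absorbs t^(max p 0),
    which is at least t^p there, and the other half stays as the bound. *)
Lemma integrable_powR_expR (p x : R) : -1 < p -> 0 < x ->
  leb.-integrable `]0, +oo[ (EFin \o (fun t => t `^ p * expR (- (x * t)))).
Proof.
move=> p1 x0.
have mf : measurable_fun setT (fun t : R => t `^ p * expR (- (x * t))).
  apply: measurable_funM; first exact: measurable_powR.
  by apply: measurableT_comp => //; exact: measurableT_comp.
have q0 : 0 <= Num.max p 0 by rewrite le_max lexx orbT.
have x20 : 0 < x / 2 by rewrite divr_gt0.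
have [C C0 hC] := powR_expR_bounded q0 x20.
have i1 : leb.-integrable `]0, +oo[
    (EFin \o (fun t => ((fun t => t `^ p) \_ `]0, 1]) t + C * expR (- (x / 2 * t)))).
  apply: (@integrableDR _ _ _ ((fun t => t `^ p) \_ `]0, 1])) => //.
    rewrite (_ : _ \o _ = (EFin \o (fun t => t `^ p)) \_ `]0, 1]); last first.
      by rewrite restrict_EFin.
    apply/integrable_restrict => //.
    apply: (integrableS _ _ _ (integrable_powR01 p1)) => //.
    exact: measurableI.
  apply: integrableZR => //.
  apply: (integrableS _ _ _ (integrable_expRN x20)) => //.
  by move=> t /=; rewrite !in_itv/= !andbT; exact: ltW.
apply: (le_integrableR _ _ _ i1) => //; first exact: measurable_funTS.
move=> t; rewrite /= in_itv/= andbT => t0.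
rewrite ger0_norm ?mulr_ge0 ?powR_ge0 ?expR_ge0// patchE.
case: ifPn => [_|].
  rewrite (@le_trans _ _ (t `^ p))//.
    rewrite ler_piMr ?powR_ge0// -expR0 ler_expR oppr_le0 mulr_ge0 ?ltW//.
  by rewrite lerDl mulr_ge0 ?expR_ge0.
move=> /negP; rewrite inE/= in_itv/= t0/= => /negP; rewrite -ltNge => t1.
rewrite add0r.
have -> : expR (- (x * t)) = expR (- (x / 2 * t)) * expR (- (x / 2 * t)).
  by rewrite -expRD; congr expR; field.
rewrite mulrA ler_wpM2r ?expR_ge0// (le_trans _ (hC t t0))//.
rewrite ler_wpM2r ?expR_ge0// ler_powR ?(ltW t1)// le_max lexx//.
Qed.

End integrability.

Lemma derive0_cst (R : realType) (f : R -> R) (x y : R) : x <= y ->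
  (forall z, x <= z <= y -> rderive f z 0) -> f x = f y.
Proof.
move=> xy df.
have [c _] : exists2 c, c \in `[x, y] & f y - f x = 0 * (y - x).
  apply: (@MVT_segment _ f (fun=> 0)) => //.
    by move=> z; rewrite in_itv/= => /andP[h1 h2]; apply: df; rewrite !ltW.
  apply: continuous_in_subspaceT => z /set_mem/=; rewrite in_itv/= => h.
  exact: rderive_continuous (df _ h).
by rewrite mul0r => /eqP; rewrite subr_eq0 => /eqP.
Qed.

Lemma rderive_Rintegral (R : realType) (B : set R) (f f' : R -> R -> R)
    (G : R -> R) (a u v : R) :
  measurable B -> u < a < v ->
  (forall x, u < x < v -> leb.-integrable B (EFin \o f x)) ->
  (forall x y, u < x < v -> B y -> rderive (f ^~ y) x (f' x y)) ->
  leb.-integrable B (EFin \o G) ->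
  (forall x y, u < x < v -> B y -> `|f' x y| <= G y) ->
  rderive (fun x => \int[leb]_(y in B) f x y) a (\int[leb]_(y in B) f' a y).
Proof.
move=> mB auv fi df Gi fG.
have I x : `]u, v[%classic x -> u < x < v by rewrite /= in_itv.
have Ia : `]u, v[%classic a by rewrite /= in_itv.
have d1 x y : u < x < v -> B y -> partial1of2 f x y = f' x y.
  by move=> xuv By; rewrite partial1of2E; apply: derive_val; exact: df.
have fi' x : `]u, v[%classic x -> leb.-integrable B (EFin \o f x).
  by move/I; exact: fi.
have df' x y : `]u, v[%classic x -> B y -> derivable (f ^~ y) x 1.
  by move=> /I xuv By; apply: (@ex_derive _ _ _ _ _ _ (f' x y)); exact: df.
have fG' x y : `]u, v[%classic x -> B y -> `|partial1of2 f x y| <= `|G y|.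
  by move=> /I xuv By; rewrite d1// (le_trans (fG _ _ _ _))// ler_norm.
have Gi' : leb.-integrable B (EFin \o (fun y => `|G y|)) by exact: integrable_norm.
have G0 y : 0 <= `|G y| by [].
apply: DeriveDef.
  exact: (@derivable_under_integral _ _ _ leb _ _ mB _ _ _ Ia fi' df' _ G0 Gi' fG').
rewrite -derive1E (@differentiation_under_integral _ _ _ leb _ _ mB _ _ _ Ia fi' df' _ G0 Gi' fG').
by apply: eq_Rintegral => y /set_mem By; rewrite d1// I.
Qed.

(** * Complex-valued functions *)

Section complex_algebra.
Context (R : realType).
Implicit Types (z w : R[i]) (x y p q : R).

Lemma ReD z w : Re (z + w) = Re z + Re w. Proof. by case: z; case: w. Qed.
Lemma ImD z w : Im (z + w) = Im z + Im w. Proof. by case: z; case: w. Qed.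
Lemma ReN z : Re (- z) = - Re z. Proof. by case: z. Qed.
Lemma ImN z : Im (- z) = - Im z. Proof. by case: z. Qed.
Lemma ReM z w : Re (z * w) = Re z * Re w - Im z * Im w.
Proof. by case: z; case: w. Qed.
Lemma ImM z w : Im (z * w) = Re z * Im w + Im z * Re w.
Proof. by case: z; case: w. Qed.
Lemma ReV z : Re z^-1 = Re z / (Re z ^+ 2 + Im z ^+ 2).
Proof. by case: z. Qed.
Lemma ImV z : Im z^-1 = - Im z / (Re z ^+ 2 + Im z ^+ 2).
Proof. by case: z => a b; rewrite mulNr. Qed.

Definition cE := (ReD, ImD, ReN, ImN, ReM, ImM).

Lemma complex_eq z w : Re z = Re w -> Im z = Im w -> z = w.
Proof. by case: z; case: w => a b c d /= -> ->. Qed.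

Lemma complex_neq0 z : 0 < Re z -> z != 0.
Proof. by move=> z0; apply/eqP => zE; rewrite zE ltxx in z0. Qed.

Lemma cmodE z : cmod z = ComplexField.Normc.normc z. Proof. by case: z. Qed.

Lemma cmod_ge0 z : 0 <= cmod z. Proof. exact: sqrtr_ge0. Qed.

Lemma cmodM z w : cmod (z * w) = cmod z * cmod w.
Proof. by rewrite !cmodE ComplexField.Normc.normcM. Qed.

Lemma cmodV z : cmod z^-1 = (cmod z)^-1.
Proof. by rewrite !cmodE ComplexField.Normc.normcV. Qed.

Lemma cmodN z : cmod (- z) = cmod z.
Proof. by rewrite /cmod !cE !sqrrN. Qed.

Lemma cmod_real x : cmod x%:C = `|x|.
Proof. by rewrite /cmod /= expr0n/= addr0 sqrtr_sqr. Qed.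

Lemma le_cmodD z w : cmod (z + w) <= cmod z + cmod w.
Proof. by rewrite !cmodE; exact: le_normcD. Qed.

Lemma Re_le_cmod z : `|Re z| <= cmod z.
Proof. by rewrite -sqrtr_sqr ler_wsqrtr// lerDl sqr_ge0. Qed.

Lemma Im_le_cmod z : `|Im z| <= cmod z.
Proof. by rewrite -sqrtr_sqr ler_wsqrtr// lerDr sqr_ge0. Qed.

Lemma cmod_le_ReIm z : cmod z <= `|Re z| + `|Im z|.
Proof.
rewrite -(ler_pXn2r (_ : 0 < 2)%N) ?nnegrE ?cmod_ge0 ?addr_ge0//.
rewrite sqr_sqrtr ?addr_ge0 ?sqr_ge0// sqrrD !real_normK ?num_real//.
by rewrite addrAC lerDl mulrn_wge0// mulr_ge0.
Qed.

Lemma cmod_gt0 z : 0 < Re z -> 0 < cmod z.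
Proof. by move=> z0; apply: lt_le_trans (Re_le_cmod z); rewrite gtr0_norm. Qed.

Lemma Re_cexp z : Re (cexp z) = expR (Re z) * cos (Im z). Proof. by []. Qed.
Lemma Im_cexp z : Im (cexp z) = expR (Re z) * sin (Im z). Proof. by []. Qed.

Lemma cexpD z w : cexp (z + w) = cexp z * cexp w.
Proof.
by apply: complex_eq; rewrite !(cE, Re_cexp, Im_cexp) expRD ?cosD ?sinD; ring.
Qed.

Lemma cexp0 : cexp 0 = 1 :> R[i].
Proof. by apply: complex_eq; rewrite /= expR0 ?cos0 ?sin0; ring. Qed.

Lemma cmod_cexp z : cmod (cexp z) = expR (Re z).
Proof.
rewrite /cmod /= !exprMn -mulrDr cos2Dsin2 mulr1 sqrtr_sqr ger0_norm// expR_ge0.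
Qed.

Lemma cexp_neq0 z : cexp z != 0.
Proof.
apply/eqP => h; have := cmod_cexp z; rewrite h.
by rewrite /cmod /= expr0n/= addr0 sqrtr0 => /eqP; rewrite lt_eqF ?expR_gt0.
Qed.

Lemma cexpN z : cexp (- z) = (cexp z)^-1.
Proof.
apply: (mulfI (cexp_neq0 z)); rewrite -cexpD subrr cexp0 divff//.
exact: cexp_neq0.
Qed.

Lemma cexp_real x : cexp x%:C = (expR x)%:C.
Proof. by apply: complex_eq; rewrite /= ?cos0 ?sin0; ring. Qed.

Lemma cos_atan_cmod z : 0 < Re z -> cos (atan (Im z / Re z)) = Re z / cmod z.
Proof.
move=> z0; have p0 : 0 < Re z ^+ 2 + Im z ^+ 2.
  by rewrite ltr_wpDr ?sqr_ge0// exprn_gt0.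
have -> : Re z / cmod z = (cmod z / Re z)^-1 by rewrite invf_div.
rewrite cos_atan; congr _^-1.
apply/eqP; rewrite -(@eqrXn2 _ 2)// ?sqrtr_ge0 ?divr_ge0 ?(ltW z0) ?cmod_ge0//.
rewrite sqr_sqrtr ?addr_ge0 ?sqr_ge0// !expr_div_n /cmod sqr_sqrtr ?(ltW p0)//.
by apply/eqP; field; rewrite gt_eqF.
Qed.

(** [acos] has no derivative at 1, hence causes trouble on the positive axis; on the right
    half-plane the arctangent gives the same argument and is differentiable everywhere. *)
Lemma carg_atan z : 0 < Re z -> carg z = atan (Im z / Re z).
Proof.
move=> z0; have E := cos_atan_cmod z0.
have lt2 := atan_ltpi2; have pi0 := @pi_gt0 R.
rewrite /carg -E; case: ifPn => [y0|].
  rewrite cosK// in_itv/= -[X in X <= _](@atan0 R) le_atan ?divr_ge0 ?(ltW z0)//=.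
  by have := lt2 R (Im z / Re z); lra.
rewrite -ltNge => y0.
have -> : atan (Im z / Re z) = - atan (- (Im z / Re z)) by rewrite atanN opprK.
rewrite cosN cosK// in_itv/= -[X in X <= _](@atan0 R) le_atan.
  by have := lt2 R (- (Im z / Re z)); lra.
by rewrite -mulNr divr_ge0// ?oppr_ge0 ltW.
Qed.

Lemma carg_lt z : 0 < Re z -> `|carg z| < pi / 2.
Proof.
by move=> /carg_atan->; rewrite ltr_norml atan_ltpi2 atan_gtNpi2.
Qed.

Lemma cexp_cLog z : 0 < Re z -> cexp (cLog z) = z.
Proof.
move=> z0; have m0 := cmod_gt0 z0.
have E : cos (carg z) = Re z / cmod z by rewrite carg_atan// cos_atan_cmod.
have c0 : cos (carg z) != 0 by rewrite E gt_eqF// divr_gt0.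
have F : sin (carg z) = Im z / cmod z.
  have : tan (carg z) = Im z / Re z by rewrite carg_atan// atanK.
  rewrite /tan => /(congr1 (fun x => x * cos (carg z))).
  rewrite mulfVK// => ->; rewrite E; field.
  by rewrite !gt_eqF.
apply: complex_eq; rewrite /= lnK ?posrE// ?E ?F; field; by rewrite gt_eqF.
Qed.

Lemma Re_realM x z : Re (x%:C * z) = x * Re z.
Proof. by rewrite ReM /= mul0r subr0. Qed.

Lemma Im_realM x z : Im (x%:C * z) = x * Im z.
Proof. by rewrite ImM /= mul0r addr0. Qed.

Lemma cpowD z p q : cpow z (p + q) = cpow z p * cpow z q.
Proof. by rewrite /cpow rmorphD mulrDl cexpD. Qed.

Lemma cpow1 z : 0 < Re z -> cpow z 1 = z.
Proof. by move=> z0; rewrite /cpow mul1r cexp_cLog. Qed.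

Lemma cpowN z p : cpow z (- p) = (cpow z p)^-1.
Proof. by rewrite /cpow rmorphN mulNr cexpN. Qed.

Lemma cpow_neq0 z p : cpow z p != 0. Proof. exact: cexp_neq0. Qed.

Lemma cpowN1 z : 0 < Re z -> cpow z (- 1) = z^-1.
Proof. by move=> z0; rewrite cpowN cpow1. Qed.

Lemma cLog_real x : 0 < x -> cLog x%:C = (ln x)%:C.
Proof.
move=> x0; rewrite /cLog cmod_real gtr0_norm//.
by rewrite carg_atan//= mul0r atan0.
Qed.

Lemma cpow_real x p : 0 < x -> cpow x%:C p = (x `^ p)%:C.
Proof.
move=> x0; rewrite /cpow cLog_real// -rmorphM/= cexp_real.
by rewrite /powR gt_eqF.
Qed.

End complex_algebra.

(** * Derivatives of complex functions of a real variable *)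

Section complex_derivative.
Context (R : realType).
Implicit Types (f g : R -> R[i]) (t : R) (d e : R[i]).

Definition cderive f t d : Prop :=
  rderive (fun x => Re (f x)) t (Re d) /\ rderive (fun x => Im (f x)) t (Im d).

Lemma cderive_eq f t d e : cderive f t d -> d = e -> cderive f t e.
Proof. by move=> ? <-. Qed.

Lemma cderive_cst (c : R[i]) t : cderive (fun=> c) t 0.
Proof. by split; exact: rderive_cst. Qed.

Lemma cderive_real (f : R -> R) t (d : R) :
  rderive f t d -> cderive (fun x => (f x)%:C) t d%:C.
Proof. by split => //; exact: rderive_cst. Qed.

Lemma cderive_pair (u v : R -> R) t (d e : R) :
  rderive u t d -> rderive v t e -> cderive (fun x => u x +i* v x) t (d +i* e).
Proof. by []. Qed.

Lemma cderiveN f t d : cderive f t d -> cderive (fun x => - f x) t (- d).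
Proof.
move=> [h1 h2]; split; rewrite ?cE; under eq_fun do rewrite cE; exact: rderiveN.
Qed.

Lemma cderiveD f g t d e : cderive f t d -> cderive g t e ->
  cderive (fun x => f x + g x) t (d + e).
Proof.
move=> [h1 h2] [h3 h4]; split; rewrite ?cE; under eq_fun do rewrite cE.
  exact: rderiveD.
exact: rderiveD.
Qed.

Lemma cderiveM f g t d e : cderive f t d -> cderive g t e ->
  cderive (fun x => f x * g x) t (f t * e + g t * d).
Proof.
move=> [h1 h2] [h3 h4]; split; under eq_fun do rewrite cE;
  (apply: rderive_eq; first by rder); rewrite !cE/=; ring.
Qed.

Lemma cderiveV f t d : f t != 0 -> cderive f t d ->
  cderive (fun x => (f x)^-1) t (- (f t) ^- 2 * d).
Proof.
move=> f0 [h1 h2].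
have n0 : Re (f t) ^+ 2 + Im (f t) ^+ 2 != 0.
  apply: contra f0; rewrite paddr_eq0 ?sqr_ge0// !sqrf_eq0.
  by move=> /andP[/eqP a /eqP b]; apply/eqP/complex_eq.
have E2 : f t ^- 2 = (f t)^-1 * (f t)^-1 by rewrite -exprVn expr2.
split.
  under eq_fun do rewrite ReV.
  apply: rderive_eq; [by rder|].
  by rewrite E2 !(cE, ReV, ImV)/=; field.
under eq_fun do rewrite ImV.
apply: rderive_eq; [by rder|].
by rewrite E2 !(cE, ReV, ImV)/=; field.
Qed.

Lemma cderive_cexp f t d : cderive f t d ->
  cderive (fun x => cexp (f x)) t (cexp (f t) * d).
Proof.
move=> [h1 h2]; split; [under eq_fun do rewrite Re_cexp|under eq_fun do rewrite Im_cexp];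
  (apply: rderive_eq; first by rder); rewrite !cE/=; ring.
Qed.

Lemma cderive_near f g t d : (\forall x \near t, f x = g x) ->
  cderive f t d -> cderive g t d.
Proof.
move=> fg [h1 h2]; split; [apply: rderive_near h1|apply: rderive_near h2].
  by apply: filterS fg => x ->.
by apply: filterS fg => x ->.
Qed.

(** Near [t] the logarithm is replaced by the smooth expression ln (x^2 + y^2) / 2 + i atan (y / x),
    which is legitimate because positivity of the real part is an open condition. *)
Lemma cderive_cLog f t d : 0 < Re (f t) -> cderive f t d ->
  cderive (fun x => cLog (f x)) t ((f t)^-1 * d).
Proof.
move=> f0 [h1 h2].
have np : \forall x \near t, 0 < Re (f x).
  have /cvgr_gt := rderive_continuous h1; exact.
have p0 : 0 < Re (f t) ^+ 2 + Im (f t) ^+ 2.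
  by rewrite ltr_wpDr ?sqr_ge0// exprn_gt0.
have h : cderive (fun x => (2^-1 * ln (Re (f x) ^+ 2 + Im (f x) ^+ 2)) +i*
    atan (Im (f x) / Re (f x))) t ((f t)^-1 * d).
  split => /=.
    apply: rderive_eq; [by rder|].
    by rewrite !(cE, ReV, ImV)/=; field; rewrite gt_eqF.
  apply: rderive_eq; [by rder; rewrite gt_eqF|].
  by rewrite !(cE, ReV, ImV)/=; field; rewrite !gt_eqF.
apply: cderive_near h; apply: filterS np => x fx0.
rewrite /cLog carg_atan//; congr (_ +i* _).
have q0 : 0 < Re (f x) ^+ 2 + Im (f x) ^+ 2.
  by rewrite ltr_wpDr ?sqr_ge0// exprn_gt0.
rewrite /cmod -powR12_sqrt ?ltW// ln_powR//.
Qed.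

Lemma cderive_Re_continuous f t d : cderive f t d ->
  {for t, continuous (fun x => Re (f x))}.
Proof. by case=> /rderive_continuous. Qed.

Lemma cderive_Im_continuous f t d : cderive f t d ->
  {for t, continuous (fun x => Im (f x))}.
Proof. by case=> _ /rderive_continuous. Qed.

End complex_derivative.

(* [H] is holomorphic with derivative [H'] on the half-plane Re > 0, in the
   form of the chain rule along differentiable curves. *)
Definition chol (R : realType) (H H' : R[i] -> R[i]) : Prop :=
  forall (g : R -> R[i]) t d, 0 < Re (g t) -> cderive g t d ->
    cderive (fun x => H (g x)) t (H' (g t) * d).

Section holomorphic.
Context (R : realType).
Implicit Types (H K : R[i] -> R[i]).

Lemma chol_cst (c : R[i]) : chol (fun=> c) (fun=> 0).
Proof. by move=> g t d _ _; rewrite mul0r; exact: cderive_cst. Qed.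

Lemma chol_id : chol (fun z : R[i] => z) (fun=> 1).
Proof. by move=> g t d _; rewrite mul1r. Qed.

Lemma chol_eq H H1 H2 : chol H H1 -> (forall z, 0 < Re z -> H1 z = H2 z) ->
  chol H H2.
Proof. by move=> h e g t d g0 dg; rewrite -e//; exact: h. Qed.

Lemma cholN H H' : chol H H' -> chol (fun z => - H z) (fun z => - H' z).
Proof. by move=> h g t d g0 dg; rewrite mulNr; apply: cderiveN; exact: h. Qed.

Lemma cholD H H' K K' : chol H H' -> chol K K' ->
  chol (fun z => H z + K z) (fun z => H' z + K' z).
Proof.
move=> h k g t d g0 dg; rewrite mulrDl; apply: cderiveD; [exact: h|exact: k].
Qed.

Lemma cholM H H' K K' : chol H H' -> chol K K' ->
  chol (fun z => H z * K z) (fun z => H z * K' z + K z * H' z).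
Proof.
move=> h k g t d g0 dg; rewrite mulrDl -!mulrA.
by apply: cderiveM; [exact: h|exact: k].
Qed.

Lemma chol_cexp H H' : chol H H' ->
  chol (fun z => cexp (H z)) (fun z => cexp (H z) * H' z).
Proof. by move=> h g t d g0 dg; rewrite -mulrA; apply: cderive_cexp; exact: h. Qed.

Lemma chol_cLog : chol (@cLog R) (fun z => z^-1).
Proof. by move=> g t d; exact: cderive_cLog. Qed.

Lemma cholV H H' : (forall z, 0 < Re z -> H z != 0) -> chol H H' ->
  chol (fun z => (H z)^-1) (fun z => - (H z) ^- 2 * H' z).
Proof.
move=> H0 h g t d g0 dg; rewrite -mulrA.
by apply: cderiveV; [exact: H0|exact: h].
Qed.

Lemma chol_cpow (p : R) : chol (@cpow R ^~ p) (fun z => p%:C * cpow z (p - 1)).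
Proof.
apply: chol_eq (chol_cexp (cholM (chol_cst p%:C) chol_cLog)) _.
move=> z z0; rewrite mulr0 addr0 -/(cpow z p) cpowD cpowN1//.
by rewrite [LHS]mulrC -mulrA [z^-1 * _]mulrC.
Qed.

Lemma chol_affine H H' (b k : R[i]) :
  (forall z, 0 < Re z -> 0 < Re (b + k * z)) -> chol H H' ->
  chol (fun z => H (b + k * z)) (fun z => H' (b + k * z) * k).
Proof.
move=> bk h g t d g0 dg; rewrite -mulrA; apply: (h (fun x => b + k * g x)).
  exact: bk.
apply: cderive_eq; first by apply: cderiveD (cderive_cst _ _) (cderiveM (cderive_cst _ _) dg).
by rewrite mulr0 addr0 add0r.
Qed.

End holomorphic.

(** * Measurability and integration of complex functions *)

Section complex_measurable.
Context (R : realType) d (T : measurableType d) (D : set T).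
Implicit Types f g : T -> R[i].

Definition cmeas f : Prop :=
  measurable_fun D (fun x => Re (f x)) /\ measurable_fun D (fun x => Im (f x)).

Lemma cmeas_cst (c : R[i]) : cmeas (fun=> c).
Proof. by split. Qed.

Lemma cmeas_real (f : T -> R) : measurable_fun D f -> cmeas (fun x => (f x)%:C).
Proof. by move=> mf; split. Qed.

Lemma cmeas_pair (u v : T -> R) : measurable_fun D u -> measurable_fun D v ->
  cmeas (fun x => u x +i* v x).
Proof. by []. Qed.

Lemma cmeasM f g : cmeas f -> cmeas g -> cmeas (fun x => f x * g x).
Proof.
move=> [f1 f2] [g1 g2]; split; under eq_fun do rewrite cE.
  by apply: measurable_funB; exact: measurable_funM.
by apply: measurable_funD; exact: measurable_funM.
Qed.

Lemma measurable_cos_comp (u : T -> R) : measurable_fun D u ->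
  measurable_fun D (fun x => cos (u x)).
Proof.
move=> mu; apply: measurableT_comp => //.
by apply: continuous_measurable_fun; exact: continuous_cos.
Qed.

Lemma measurable_sin_comp (u : T -> R) : measurable_fun D u ->
  measurable_fun D (fun x => sin (u x)).
Proof.
move=> mu; apply: measurableT_comp => //.
by apply: continuous_measurable_fun; exact: continuous_sin.
Qed.

Lemma cmeas_cexp f : cmeas f -> cmeas (fun x => cexp (f x)).
Proof.
move=> [f1 f2]; split; rewrite /=; apply: measurable_funM.
- exact: measurableT_comp.
- exact: measurable_cos_comp.
- exact: measurableT_comp.
- exact: measurable_sin_comp.
Qed.

End complex_measurable.

Lemma cmeas_comp (R : realType) d (T : measurableType d) (f : R -> R[i])
    (u : T -> R) : cmeas setT f -> measurable_fun setT u ->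
  cmeas setT (fun x => f (u x)).
Proof.
move=> [f1 f2] mu; split.
  exact: (measurableT_comp f1 mu).
exact: (measurableT_comp f2 mu).
Qed.

Lemma cmeas_derivable (R : realType) (f f' : R -> R[i]) :
  (forall t, cderive f t (f' t)) -> cmeas setT f.
Proof.
move=> df; split; apply: continuous_measurable_fun => t.
  exact: (cderive_Re_continuous (df t)).
exact: (cderive_Im_continuous (df t)).
Qed.

Definition ccvg (R : realType) (F : set_system R) (f : R -> R[i]) (l : R[i]) :=
  (Re (f x) @[x --> F] --> Re l) /\ (Im (f x) @[x --> F] --> Im l).

Lemma ccvg0_le (R : realType) (F : set_system R) (f : R -> R[i]) (g : R -> R) :
  Filter F -> (\forall x \near F, cmod (f x) <= g x) -> g x @[x --> F] --> 0 ->
  ccvg F f 0.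
Proof.
move=> FF fg g0.
have ng : - g x @[x --> F] --> 0 by rewrite -oppr0; exact: cvgN.
split; apply: (squeeze_cvgr _ ng g0); apply: filterS fg => x fx.
  by rewrite -ler_norml (le_trans (Re_le_cmod _)).
by rewrite -ler_norml (le_trans (Im_le_cmod _)).
Qed.

Section complex_integral.
Context (R : realType).
Implicit Types (D : set R) (f g : R -> R[i]) (h : R -> R) (c : R[i]).

Definition cinteg D f : Prop :=
  leb.-integrable D (EFin \o (fun x => Re (f x))) /\
  leb.-integrable D (EFin \o (fun x => Im (f x))).

Definition cint D f : R[i] :=
  (\int[leb]_(x in D) Re (f x)) +i* (\int[leb]_(x in D) Im (f x)).

Lemma cmeasS D f : measurable D -> cmeas setT f -> cmeas D f.
Proof. by move=> mD [f1 f2]; split; exact: measurable_funTS. Qed.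

Lemma cinteg_le D f h : measurable D -> cmeas D f ->
  (forall x, D x -> cmod (f x) <= h x) -> leb.-integrable D (EFin \o h) ->
  cinteg D f.
Proof.
move=> mD [f1 f2] fh hi; split; apply: le_integrableR hi => // x Dx.
  by rewrite (le_trans (Re_le_cmod _)) ?fh.
by rewrite (le_trans (Im_le_cmod _)) ?fh.
Qed.

Lemma eq_cint D f g : (forall x, D x -> f x = g x) -> cint D f = cint D g.
Proof.
move=> fg; rewrite /cint; congr (_ +i* _);
  by apply: eq_Rintegral => x /set_mem Dx; rewrite fg.
Qed.

Lemma eq_cinteg D f g : measurable D -> (forall x, D x -> f x = g x) ->
  cinteg D f -> cinteg D g.
Proof.
move=> mD fg [f1 f2]; split.
  by apply: (@eq_integrable _ _ _ leb D mD _ _ _ f1) => x /set_mem Dx; rewrite /= fg.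
by apply: (@eq_integrable _ _ _ leb D mD _ _ _ f2) => x /set_mem Dx; rewrite /= fg.
Qed.

Lemma cintegD D f g : measurable D -> cinteg D f -> cinteg D g ->
  cinteg D (fun x => f x + g x).
Proof.
move=> mD [f1 f2] [g1 g2]; split; under eq_fun do rewrite cE; exact: integrableDR.
Qed.

Lemma cintD D f g : measurable D -> cinteg D f -> cinteg D g ->
  cint D (fun x => f x + g x) = cint D f + cint D g.
Proof.
move=> mD [f1 f2] [g1 g2]; rewrite /cint; apply: complex_eq; rewrite !cE/=.
  rewrite -(@RintegralD _ _ _ leb D)//; apply: eq_Rintegral => x _; exact: ReD.
rewrite -(@RintegralD _ _ _ leb D)//; apply: eq_Rintegral => x _; exact: ImD.
Qed.

Lemma cintegZ D c f : measurable D -> cinteg D f -> cinteg D (fun x => c * f x).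
Proof.
move=> mD [f1 f2]; split; under eq_fun do rewrite cE.
  by apply: integrableBR => //; exact: integrableZR.
by apply: integrableDR => //; exact: integrableZR.
Qed.

Lemma cintZ D c f : measurable D -> cinteg D f ->
  cint D (fun x => c * f x) = c * cint D f.
Proof.
move=> mD [f1 f2]; rewrite /cint; apply: complex_eq; rewrite !cE/=.
  rewrite -!(@RintegralZl _ _ _ leb D)//.
  rewrite -(@RintegralB _ _ _ leb D)//; [|exact: integrableZR..].
  by apply: eq_Rintegral => x _; rewrite cE.
rewrite -!(@RintegralZl _ _ _ leb D)//.
rewrite -(@RintegralD _ _ _ leb D)//; [|exact: integrableZR..].
by apply: eq_Rintegral => x _; rewrite cE.
Qed.

Lemma cintegN D f : measurable D -> cinteg D f -> cinteg D (fun x => - f x).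
Proof.
move=> mD fi; apply: eq_cinteg (cintegZ (-1) mD fi) => // x _.
by rewrite mulN1r.
Qed.

Lemma cintN D f : measurable D -> cinteg D f ->
  cint D (fun x => - f x) = - cint D f.
Proof.
move=> mD fi; rewrite -mulN1r -cintZ//; apply: eq_cint => x _.
by rewrite mulN1r.
Qed.

(** Bounding the modulus by |Re| + |Im| costs the factor 2. It is harmless, as the estimate only
    serves to dominate integrals or to show that they vanish. *)
Lemma cmod_cint_le D f h : measurable D -> cmeas D f ->
  (forall x, D x -> cmod (f x) <= h x) -> leb.-integrable D (EFin \o h) ->
  cmod (cint D f) <= 2 * \int[leb]_(x in D) h x.
Proof.
move=> mD mf fh hi; have [f1 f2] := cinteg_le mD mf fh hi.
rewrite (le_trans (cmod_le_ReIm _))//= mulr_natl mulr2n lerD//.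
  rewrite (le_trans (@le_normr_Rintegral _ _ _ leb D _ mD f1))//.
  apply: (@le_Rintegral _ _ _ leb D) => //; first exact: integrable_norm.
  by move=> x Dx; rewrite (le_trans (Re_le_cmod _)) ?fh.
rewrite (le_trans (@le_normr_Rintegral _ _ _ leb D _ mD f2))//.
apply: (@le_Rintegral _ _ _ leb D) => //; first exact: integrable_norm.
by move=> x Dx; rewrite (le_trans (Im_le_cmod _)) ?fh.
Qed.

(** The derivative [g'] is there to make the integrand [g] continuous, as the real fundamental
    theorem demands. *)
Lemma cintT_ftc f g g' (A B : R[i]) :
  (forall x, cderive f x (g x)) -> (forall x, cderive g x (g' x)) ->
  cinteg setT g -> ccvg -oo f A -> ccvg +oo f B ->
  cint setT g = B - A.
Proof.
move=> df dg [g1 g2] [A1 A2] [B1 B2]; apply: complex_eq; rewrite !cE/=.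
  apply: (@RintegralT_ftc _ (fun x => Re (f x))) => //.
    by move=> x; have [] := df x.
  by move=> x; exact: cderive_Re_continuous (dg x).
apply: (@RintegralT_ftc _ (fun x => Im (f x))) => //.
  by move=> x; have [] := df x.
by move=> x; exact: cderive_Im_continuous (dg x).
Qed.

Lemma cinty_ftc f g g' (c : R) (A B : R[i]) :
  (forall x, c < x -> cderive f x (g x)) ->
  (forall x, c < x -> cderive g x (g' x)) ->
  cinteg `]c, +oo[ g -> ccvg c^'+ f A -> ccvg +oo f B ->
  cint `]c, +oo[ g = B - A.
Proof.
move=> df dg [g1 g2] [A1 A2] [B1 B2]; apply: complex_eq; rewrite !cE/=.
  apply: (@Rintegraly_ftc _ (fun x => Re (f x))) => //.
    by move=> x cx; have [] := df _ cx.
  by move=> x cx; exact: cderive_Re_continuous (dg _ cx).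
apply: (@Rintegraly_ftc _ (fun x => Im (f x))) => //.
  by move=> x cx; have [] := df _ cx.
by move=> x cx; exact: cderive_Im_continuous (dg _ cx).
Qed.

Lemma cderive_cint D (f f' : R -> R -> R[i]) h (a u v : R) :
  measurable D -> u < a < v ->
  (forall x, u < x < v -> cinteg D (f x)) ->
  (forall x y, u < x < v -> D y -> cderive (f ^~ y) x (f' x y)) ->
  leb.-integrable D (EFin \o h) ->
  (forall x y, u < x < v -> D y -> cmod (f' x y) <= h y) ->
  cderive (fun x => cint D (f x)) a (cint D (f' a)).
Proof.
move=> mD auv fi df hi fh; split => /=.
  apply: (@rderive_Rintegral _ D (fun x y => Re (f x y)) (fun x y => Re (f' x y))
    h a u v) => //.
  - by move=> x /fi[].
  - by move=> x y xuv Dy; have [] := df _ _ xuv Dy.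
  - by move=> x y xuv Dy; rewrite (le_trans (Re_le_cmod _)) ?fh.
apply: (@rderive_Rintegral _ D (fun x y => Im (f x y)) (fun x y => Im (f' x y))
  h a u v) => //.
- by move=> x /fi[].
- by move=> x y xuv Dy; have [] := df _ _ xuv Dy.
- by move=> x y xuv Dy; rewrite (le_trans (Im_le_cmod _)) ?fh.
Qed.

Lemma cint_reflect D f (c : R) : measurable D -> cmeas D f ->
  cint D f = cint [set x | D (c - x)] (fun x => f (c - x)).
Proof.
move=> mD [f1 f2].
have mphi : measurable_fun setT (fun x : R => c - x) by exact: measurable_funB.
rewrite /cint.
rewrite (Rintegral_mp mphi (@pushforward_leb_reflect _ c) mD f1).
by rewrite (Rintegral_mp mphi (@pushforward_leb_reflect _ c) mD f2).
Qed.

Lemma cint_shift D f (c : R) : measurable D -> cmeas D f ->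
  cint D f = cint [set x | D (x + c)] (fun x => f (x + c)).
Proof.
move=> mD [f1 f2].
have mphi : measurable_fun setT (fun x : R => x + c) by exact: measurable_funD.
rewrite /cint.
rewrite (Rintegral_mp mphi (@pushforward_leb_shift _ c) mD f1).
by rewrite (Rintegral_mp mphi (@pushforward_leb_shift _ c) mD f2).
Qed.

End complex_integral.

Section fubini.
Context (R : realType).

(** The bound in product form reduces joint integrability to two integrals in one variable, by
    Tonelli. It also makes every section integrable, not just almost every one, so real-valued and
    extended integrals agree throughout. *)
Lemma Rintegral_swap (D1 D2 : set R) (f : R -> R -> R) (g1 g2 : R -> R) :
  measurable D1 -> measurable D2 ->
  measurable_fun setT (fun p : R * R => f p.1 p.2) ->
  leb.-integrable D1 (EFin \o g1) -> leb.-integrable D2 (EFin \o g2) ->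
  (forall x y, D1 x -> D2 y -> `|f x y| <= g1 x * g2 y) ->
  \int[leb]_(x in D1) (\int[leb]_(y in D2) f x y) =
  \int[leb]_(y in D2) (\int[leb]_(x in D1) f x y).
Proof.
move=> mD1 mD2 mf ig1 ig2 fg.
have mi1 : measurable_fun setT (\1_D1 : R -> R) by exact: measurable_indic.
have mi2 : measurable_fun setT (\1_D2 : R -> R) by exact: measurable_indic.
have mfst : measurable_fun setT (fun p : R * R => p.1) by exact: measurable_fst.
have msnd : measurable_fun setT (fun p : R * R => p.2) by exact: measurable_snd.
(* Indicators move both integrals to the whole line, where Fubini's theorem for the product measure
   applies. *)
pose F x y := f x y * \1_D1 x * \1_D2 y.
have mF : measurable_fun setT (fun p : R * R => F p.1 p.2).
  apply: measurable_funM; first apply: measurable_funM => //.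
    exact: (measurableT_comp mi1 mfst).
  exact: (measurableT_comp mi2 msnd).
pose G1 x := `|g1 x| * \1_D1 x.
pose G2 x := `|g2 x| * \1_D2 x.
have E1 (h : R -> R) : (fun x => h x * \1_D1 x) = h \_ D1.
  by apply/funext => x; rewrite patchE indicE; case: (x \in D1); rewrite ?mulr1 ?mulr0.
have E2 (h : R -> R) : (fun x => h x * \1_D2 x) = h \_ D2.
  by apply/funext => x; rewrite patchE indicE; case: (x \in D2); rewrite ?mulr1 ?mulr0.
have iG1 : leb.-integrable setT (EFin \o G1).
  rewrite /G1 E1 -restrict_EFin; apply/integrable_restrict => //.
  by rewrite setTI; exact: integrable_norm.
have iG2 : leb.-integrable setT (EFin \o G2).
  rewrite /G2 E2 -restrict_EFin; apply/integrable_restrict => //.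
  by rewrite setTI; exact: integrable_norm.
have FG x y : `|F x y| <= G1 x * G2 y.
  rewrite /F /G1 /G2 !indicE !normrM.
  have [/set_mem xD|_] := boolP (x \in D1); last by rewrite /= normr0 !(mulr0, mul0r).
  have [/set_mem yD|_] := boolP (y \in D2); last by rewrite /= normr0 !(mulr0, mul0r).
  rewrite /= normr1 !mulr1 -normrM.
  by rewrite (le_trans (fg _ _ xD yD))// ler_norm.
have iFx x : leb.-integrable setT (EFin \o F x).
  apply: (@le_integrableR _ setT (F x) (fun y => G1 x * G2 y)) => //.
    exact: (measurableT_comp mF (pair1_measurable x)).
  exact: integrableZR.
have iFy y : leb.-integrable setT (EFin \o (F ^~ y)).
  apply: (@le_integrableR _ setT (F ^~ y) (fun x => G2 y * G1 x)) => //.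
  - exact: (measurableT_comp mF (pair2_measurable y)).
  - by move=> x _; rewrite mulrC.
  - exact: integrableZR.
have L : \int[leb]_(x in D1) (\int[leb]_(y in D2) f x y) =
   \int[leb]_x \int[leb]_y F x y.
  rewrite Rintegral_mkcond; apply: eq_Rintegral => x _; rewrite -E1.
  rewrite Rintegral_mkcond -E2 /F; rewrite indicE.
  have [xD|_] := boolP (x \in D1); last first.
    rewrite mulr0; under eq_Rintegral do rewrite mulr0 mul0r.
    by rewrite Rintegral_cst// mul0r.
  by rewrite mulr1; apply: eq_Rintegral => y _; rewrite mulr1.
have M : \int[leb]_(y in D2) (\int[leb]_(x in D1) f x y) =
   \int[leb]_y \int[leb]_x F x y.
  rewrite Rintegral_mkcond; apply: eq_Rintegral => y _; rewrite -E2.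
  rewrite Rintegral_mkcond -E1 /F; rewrite [X in _ * X]indicE.
  have [yD|yD] := boolP (y \in D2).
    by rewrite mulr1; apply: eq_Rintegral => x _; rewrite [X in _ = _ * X]indicE yD mulr1.
  have y0 : \1_D2 y = 0 :> R by rewrite indicE (negbTE yD).
  rewrite mulr0; under [RHS]eq_Rintegral do rewrite y0 mulr0.
  by rewrite Rintegral_cst// mul0r.
rewrite L M /Rintegral.
have mnF : measurable_fun setT (fun p : R * R => (`|F p.1 p.2|)%:E).
  by apply/measurable_EFinP; exact: measurableT_comp.
have nF0 (p : R * R) : (0 <= (`|F p.1 p.2|)%:E)%E by rewrite lee_fin.
have iF : (leb \x leb)%E.-integrable setT (fun p : R * R => (F p.1 p.2)%:E).
  apply/integrable12ltyP; first exact/measurable_EFinP.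
  apply: (@le_lt_trans _ _ (\int[leb]_x ((\int[leb]_y (G2 y)) * G1 x)%:E)%E).
    apply: ge0_le_integral => //.
    - by move=> x _; apply: integral_ge0.
    - exact: (@measurable_fun_fubini_tonelli_F _ _ _ _ _ leb (fun p : R * R => (`|F p.1 p.2|)%:E) mnF nF0).
    - apply/measurable_EFinP; apply: measurable_funM => //.
      by move/integrableP : iG1 => [/measurable_EFinP].
    - move=> x _; rewrite mulrC -RintegralZl//.
      rewrite /Rintegral fineK; last first.
        by apply: integrable_fin_num => //; exact: integrableZR.
      apply: ge0_le_integral => //.
      + exact: (measurable_int leb (integrable_norm (iFx x))).
      + exact: (measurable_int leb (integrableZR measurableT (G1 x) iG2)).
      + by move=> y _; rewrite lee_fin /=.
  exact: (integrable_lty measurableT (integrableZR measurableT _ iG1)).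
have := Fubini iF; rewrite /fubini_F /fubini_G /= => FF.
congr fine.
transitivity (\int[leb]_x \int[leb]_y (F x y)%:E)%E.
  apply: eq_integral => x _; rewrite fineK//.
  exact: (integrable_fin_num measurableT (iFx x)).
rewrite FF; apply: eq_integral => y _; rewrite fineK//.
exact: (integrable_fin_num measurableT (iFy y)).
Qed.

Lemma cint_swap (D1 D2 : set R) (f : R -> R -> R[i]) (g1 g2 : R -> R) :
  measurable D1 -> measurable D2 ->
  cmeas setT (fun p : R * R => f p.1 p.2) ->
  leb.-integrable D1 (EFin \o g1) -> leb.-integrable D2 (EFin \o g2) ->
  (forall x y, D1 x -> D2 y -> cmod (f x y) <= g1 x * g2 y) ->
  cint D1 (fun x => cint D2 (f x)) = cint D2 (fun y => cint D1 (f ^~ y)).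
Proof.
move=> mD1 mD2 [m1 m2] i1 i2 fg; rewrite /cint/=; congr (_ +i* _).
  apply: (@Rintegral_swap _ _ (fun x y => Re (f x y)) g1 g2) => // x y Dx Dy.
  by rewrite (le_trans (Re_le_cmod _)) ?fg.
apply: (@Rintegral_swap _ _ (fun x y => Im (f x y)) g1 g2) => // x y Dx Dy.
by rewrite (le_trans (Im_le_cmod _)) ?fg.
Qed.

End fubini.

(** * The Bromwich integral *)

Section lorentz.
Context (R : realType).

(** The common dominating function on vertical lines: it is integrable, and it vanishes at both
    infinities, which disposes of boundary terms. *)
Definition lorentz (x : R) : R := (1 + x ^+ 2)^-1.

Lemma lorentz_gt0 x : 0 < lorentz x.
Proof. by rewrite invr_gt0 ltr_wpDr ?sqr_ge0. Qed.

Lemma integrable_lorentz : leb.-integrable setT (EFin \o lorentz).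
Proof.
have := integrable_inv_sqr (@ltr01 R); rewrite (_ : (fun u => _) = lorentz)//.
by apply/funext => x; rewrite expr1n.
Qed.

Lemma cvgy_lorentz : lorentz x @[x --> +oo] --> 0.
Proof.
apply/gtr0_cvgV0; first by apply: nearW => x; rewrite ltr_wpDr ?sqr_ge0.
apply: (@ger_cvgy _ _ _ _ id); last exact: cvg_id.
by apply: nearW => x /=; have := sqr_ge0 (x - 2^-1); rewrite sqrrB; lra.
Qed.

Lemma cvgNy_lorentz : lorentz x @[x --> -oo] --> 0.
Proof.
apply/gtr0_cvgV0; first by apply: nearW => x; rewrite ltr_wpDr ?sqr_ge0.
apply/cvgryPge => M; exists (- M); split; first exact: num_real.
by move=> x xM; have := sqr_ge0 (x + 2^-1); rewrite sqrrD; lra.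
Qed.

End lorentz.

(** * Integrals along vertical lines *)

Section vertical_lines.
Context (R : realType).
Implicit Types (H K : R[i] -> R[i]) (c : R[i]).

(* A bound, locally uniform in [Re z], that makes [H] integrable along
   vertical lines. *)
Definition line_bounded H : Prop := forall s0 s1 : R, 0 < s0 ->
  exists2 C, 0 <= C & forall z, s0 <= Re z <= s1 -> cmod (H z) <= C * lorentz (Im z).

Lemma line_boundedD H K : line_bounded H -> line_bounded K ->
  line_bounded (fun z => H z + K z).
Proof.
move=> h k s0 s1 s00; have [C C0 hC] := h s0 s1 s00; have [B B0 hB] := k s0 s1 s00.
exists (C + B); first exact: addr_ge0.
move=> z zs; rewrite (le_trans (le_cmodD _ _))// mulrDl lerD//.
  exact: hC.
exact: hB.
Qed.

Lemma line_boundedZ c H : line_bounded H -> line_bounded (fun z => c * H z).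
Proof.
move=> h s0 s1 s00; have [C C0 hC] := h s0 s1 s00.
exists (cmod c * C); first by rewrite mulr_ge0 ?cmod_ge0.
by move=> z zs; rewrite cmodM -mulrA ler_wpM2l ?cmod_ge0// hC.
Qed.

Lemma line_boundedN H : line_bounded H -> line_bounded (fun z => - H z).
Proof.
move=> h s0 s1 s00; have [C C0 hC] := h s0 s1 s00.
by exists C => // z zs; rewrite cmodN hC.
Qed.

Lemma cderive_line_im (s w : R) : cderive (fun w => s +i* w) w 'i.
Proof. by apply: cderive_pair; [exact: rderive_cst|exact: rderive_id]. Qed.

Lemma cderive_line_re (s w : R) : cderive (fun s => s +i* w) s 1.
Proof. by apply: cderive_pair; [exact: rderive_id|exact: rderive_cst]. Qed.

Lemma cmeas_line H H' (s : R) : 0 < s -> chol H H' ->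
  cmeas setT (fun w => H (s +i* w)).
Proof.
move=> s0 hH; apply: cmeas_derivable => w; apply: hH => //.
exact: cderive_line_im.
Qed.

Lemma cinteg_line H H' (s : R) : 0 < s -> chol H H' -> line_bounded H ->
  cinteg setT (fun w => H (s +i* w)).
Proof.
move=> s0 hH /(_ s s s0)[C C0 hC].
apply: (@cinteg_le _ _ _ (fun w => C * lorentz w)) => //.
- exact: cmeas_line hH.
- by move=> w _; apply: hC; rewrite /= lexx.
- by apply: integrableZR => //; exact: integrable_lorentz.
Qed.

(** Along the line, i times the integrand is the derivative of w |-> [H (s +i* w)], whose limits at
    both ends are 0. *)
Lemma cint_line_derivative H H' H'' (s : R) : 0 < s ->
  chol H H' -> chol H' H'' -> line_bounded H -> line_bounded H' ->
  cint setT (fun w => H' (s +i* w)) = 0.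
Proof.
move=> s0 hH hH' bH bH'.
have iH' := cinteg_line s0 hH' bH'.
have [C C0 hC] := bH s s s0.
have i0 : 'i != 0 :> R[i] by rewrite eq_complex /= oner_eq0 andbF.
apply: (mulfI i0); rewrite mulr0 -cintZ//.
have lim (F : set_system R) : Filter F -> lorentz x @[x --> F] --> 0 ->
    ccvg F (fun w => H (s +i* w)) 0.
  move=> FF l0; apply: (@ccvg0_le _ _ _ (fun w => C * lorentz w)).
    by apply: nearW => w; apply: hC; rewrite /= lexx.
  by rewrite -(mulr0 C); apply: cvgM => //; exact: cvg_cst.
rewrite (@cintT_ftc _ (fun w => H (s +i* w)) _ (fun w => 'i * (H'' (s +i* w) * 'i)) 0 0).
- by rewrite subrr.
- move=> w; rewrite mulrC; apply: hH => //; exact: cderive_line_im.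
- move=> w; apply: cderive_eq.
    apply: (cderiveM (cderive_cst 'i _)); apply: hH' => //.
    exact: cderive_line_im.
  by rewrite mulr0 addr0.
- exact: cintegZ.
- exact: lim (@cvgNy_lorentz R).
- exact: lim (@cvgy_lorentz R).
Qed.

Lemma cint_line_cst H H' H'' (s s' : R) : 0 < s -> 0 < s' ->
  chol H H' -> chol H' H'' -> line_bounded H -> line_bounded H' ->
  cint setT (fun w => H (s +i* w)) = cint setT (fun w => H (s' +i* w)).
Proof.
move=> s0 s0' hH hH' bH bH'.
have d x : 0 < x -> cderive (fun x => cint setT (fun w => H (x +i* w))) x 0.
  move=> x0; rewrite -(cint_line_derivative x0 hH hH' bH bH').
  (* The domination is made on []x / 2, x + 1[], which stays away from the imaginary axis. *)
  have x20 : 0 < x / 2 by rewrite divr_gt0.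
  have [C C0 hC] := bH' (x / 2) (x + 1) x20.
  apply: (@cderive_cint _ _ (fun x w => H (x +i* w)) (fun x w => H' (x +i* w))
    (fun w => C * lorentz w) x (x / 2) (x + 1)) => //.
  - by rewrite ltrDl ltr01 andbT; lra.
  - move=> y /andP[xy _]; apply: (cinteg_line _ hH) => //; exact: lt_trans xy.
  - move=> y w /andP[xy _] _; rewrite -[H' _]mulr1; apply: hH.
      by rewrite /=; exact: lt_trans xy.
    exact: cderive_line_re.
  - by apply: integrableZR => //; exact: integrable_lorentz.
  - by move=> y w /andP[xy yx] _; apply: hC; rewrite /= !ltW.
wlog ss' : s s' s0 s0' / s <= s'.
  by move=> h; have [|/ltW] := leP s s'; [|move=> ?; apply/esym]; exact: h.
by apply: complex_eq; [apply: (@derive0_cst _ (fun x => Re (cint setT (fun w => H (x +i* w)))))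
  |apply: (@derive0_cst _ (fun x => Im (cint setT (fun w => H (x +i* w)))))] => // z /andP[sz _];
  have [] := d z (lt_le_trans s0 sz).
Qed.

End vertical_lines.

(** One factor 1 / |z| is bounded by 1 / Re z, to gain smallness on lines far to the right; the
    other two give a bound integrable in [Im z], since 1 + y^2 <= (1 + s0^-2) |z|^2. *)
Lemma cmod_inv3_le (R : realType) (s0 : R) (z : R[i]) : 0 < s0 -> s0 <= Re z ->
  (cmod z ^+ 3)^-1 <= (1 + s0 ^- 2) / Re z * lorentz (Im z).
Proof.
move=> s00 sz; have z0 := lt_le_trans s00 sz; have m0 := cmod_gt0 z0.
have mz : Re z <= cmod z by rewrite (le_trans _ (Re_le_cmod z))// ler_norm.
have q0 : 0 < 1 + Im z ^+ 2 by rewrite ltr_wpDr ?sqr_ge0.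
have e2 : cmod z ^+ 2 = Re z ^+ 2 + Im z ^+ 2 by rewrite sqr_sqrtr// addr_ge0 ?sqr_ge0.
have h1 : 1 + Im z ^+ 2 <= (1 + s0 ^- 2) * cmod z ^+ 2.
  have h2 : 1 <= s0 ^- 2 * Re z ^+ 2.
    rewrite mulrC ler_pdivlMr ?exprn_gt0// mul1r ler_pXn2r// nnegrE ltW//.
  have h3 : 0 <= s0 ^- 2 * Im z ^+ 2 by rewrite mulr_ge0 ?sqr_ge0// invr_ge0 sqr_ge0.
  have h4 := sqr_ge0 (Re z).
  rewrite e2; lra.
have h2 : Re z * (1 + Im z ^+ 2) <= (1 + s0 ^- 2) * cmod z ^+ 3.
  rewrite exprS mulrCA; apply: ler_pM => //; exact: ltW.
have -> : (1 + s0 ^- 2) / Re z * lorentz (Im z) =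
    (1 + s0 ^- 2) / (Re z * (1 + Im z ^+ 2)).
  by rewrite /lorentz [(Re z * _)^-1]invfM !mulrA.
rewrite ler_pdivlMr ?mulr_gt0// mulrC.
by rewrite ler_pdivrMr ?exprn_gt0.
Qed.

Lemma cmod_le_div_eq0 (R : realType) (c : R[i]) (M : R) :
  (forall x, 1 <= x -> cmod c <= M / x) -> c = 0.
Proof.
move=> b.
have M0 : 0 <= M by rewrite (le_trans (cmod_ge0 c))// (le_trans (b 1 _))// divr1.
have m0 : cmod c = 0.
  apply/eqP; rewrite eq_le cmod_ge0 andbT leNgt; apply/negP => c0.
  have x1 : 1 <= M / cmod c + 1 by rewrite lerDr divr_ge0 ?(ltW c0).
  have := b _ x1; rewrite ler_pdivlMr ?(lt_le_trans _ x1)//.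
  by rewrite mulrDr mulr1 mulrC divfK ?gt_eqF//; lra.
apply: complex_eq; apply/eqP; rewrite -normr_le0 -m0.
  exact: Re_le_cmod.
exact: Im_le_cmod.
Qed.

(** * The symbol and its inversion integral *)

Section symbol.
Context (R : realType) (nu a : R).
Hypotheses (nu0 : 0 < nu) (nu1 : nu < 1) (a0 : 0 < a).
Implicit Types (mu t : R) (z : R[i]).
Local Notation F mu := (Rsymbol mu nu a).

(** Closure of the family under differentiation is the Laplace side of both equations of the
    theorem. Here [mu] ranges over all reals, because derivatives in t lower it below 0. *)
Lemma chol_Rsymbol mu : chol (F mu)
  (fun z => - (mu%:C * F (mu + 1) z + (a * nu)%:C * F (mu + 1 - nu) z)).
Proof.
apply: chol_eq (cholM (chol_cpow (- mu)) (chol_cexp (cholN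
  (cholM (chol_cst a%:C) (chol_cpow nu))))) _ => z z0.
rewrite /Rsymbol (_ : - (mu + 1 - nu) = - mu + (nu - 1)); last by ring.
rewrite (_ : - (mu + 1) = - mu - 1); last by ring.
rewrite [cpow z (- mu + (nu - 1))]cpowD rmorphM rmorphN; ring.
Qed.

Lemma Rsymbol_mulpow mu b z : cpow z b * F mu z = F (mu - b) z.
Proof. by rewrite /Rsymbol opprB cpowD mulrA. Qed.

Lemma Rsymbol_mulz mu z : 0 < Re z -> z * F mu z = F (mu - 1) z.
Proof. by move=> z0; rewrite -Rsymbol_mulpow cpow1. Qed.

(** With c0 = cos (nu pi / 2) > 0, the modulus is at most |z|^(-mu) e^(- a c0 |z|^nu), because |arg
    z| < pi / 2. The exponential is then traded for three powers of 1 / |z|, to which [cmod_inv3_le]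
    applies. *)
Lemma Rsymbol_bound mu (s0 : R) : 0 < s0 ->
  exists2 C, 0 <= C & forall z, s0 <= Re z ->
    cmod (F mu z) <= C / Re z * lorentz (Im z).
Proof.
move=> s00.
have pi0 := @pi_gt0 R.
pose c0 := cos (nu * (pi / 2)).
have c00 : 0 < c0.
  apply: cos_gt0_pihalf; have : 0 < nu * (pi / 2) by rewrite mulr_gt0// divr_gt0.
  have : nu * (pi / 2) < pi / 2 by rewrite gtr_pMl// divr_gt0.
  lra.
(* Here r = ln |z|, and the claim is that |z|^(3 - mu) e^(- a c0 |z|^nu) <= e^K. If 3 - mu >= 0 this
   is [lin_sub_exp_bounded] in the variable nu r; otherwise the power is largest at the left end r =
   ln s0. *)
have [K hK] : exists K, forall r, ln s0 <= r -> (3 - mu) * r - a * c0 * expR (nu * r) <= K.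
  have [h|h] := leP 0 (3 - mu).
    have [K hK] := lin_sub_exp_bounded (divr_ge0 h (ltW nu0)) (mulr_gt0 a0 c00).
    exists K => r _; have := hK (nu * r).
    by rewrite mulrA divfK// gt_eqF.
  exists ((3 - mu) * ln s0) => r rs.
  have h1 : (3 - mu) * r <= (3 - mu) * ln s0 by rewrite ler_nM2l.
  by rewrite (le_trans _ h1)// gerBl mulr_ge0 ?expR_ge0// mulr_ge0// ltW.
exists (expR K * (1 + s0 ^- 2)).
  by rewrite mulr_ge0 ?expR_ge0// addr_ge0// invr_ge0 sqr_ge0.
move=> z sz; have z0 := lt_le_trans s00 sz.
have m0 := cmod_gt0 z0.
have mz : Re z <= cmod z by rewrite (le_trans _ (Re_le_cmod z))// ler_norm.
pose r := ln (cmod z).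
have sr : ln s0 <= r by rewrite ler_ln ?posrE// (le_trans sz).
have E3 : cmod (F mu z) <= expR K / cmod z ^+ 3.
  rewrite /Rsymbol cmodM !cmod_cexp -expRD !ReN !Re_realM -/r.
  rewrite [Re (cLog z)]/= -/r.
  have -> : expR K / cmod z ^+ 3 = expR (K - 3 * r).
    by rewrite expRD expRN mulrC [3 * r]mulrC -[3]/(3%:R) expRM_natr lnK// mulrC.
  rewrite ler_expR.
  have := hK r sr.
  have c1 : c0 <= cos (nu * carg z).
    have := carg_lt z0; rewrite -[cos (nu * carg z)]cos_norm normrM (gtr0_norm nu0).
    move=> cz; have h1 : nu * `|carg z| <= nu * (pi / 2) by rewrite ler_pM2l// ltW.
    have h2 : nu * (pi / 2) < pi / 2 by rewrite gtr_pMl// divr_gt0.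
    have h3 : 0 <= nu * `|carg z| by rewrite mulr_ge0 ?(ltW nu0).
    rewrite /c0; case: (ltgtP (nu * `|carg z|) (nu * (pi / 2))) h1 => // [h _|<- _//].
    by apply/ltW; rewrite ltr_cos// in_itv/=; apply/andP; split; lra.
  rewrite Re_cexp Re_realM Im_realM [Re (cLog z)]/= [Im (cLog z)]/= -/r.
  have : a * (expR (nu * r) * c0) <= a * (expR (nu * r) * cos (nu * carg z)).
    by rewrite ler_pM2l// ler_pM2l ?expR_gt0.
  lra.
rewrite (le_trans E3)// -!mulrA ler_pM2l ?expR_gt0// mulrA.
exact: cmod_inv3_le.
Qed.

Lemma line_bounded_Rsymbol mu : line_bounded (F mu).
Proof.
move=> s0 s1 s00; have [C C0 hC] := Rsymbol_bound mu s00.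
exists (C / s0); first by rewrite divr_ge0 ?(ltW s00).
move=> z /andP[sz _]; rewrite (le_trans (hC _ sz))// ler_wpM2r ?(ltW (lorentz_gt0 _))//.
by rewrite ler_wpM2l// lef_pV2 ?posrE// (lt_le_trans s00).
Qed.

Definition Bromwich mu t z : R[i] := cexp (t%:C * z) * F mu z.

Lemma chol_exp_line t : chol (fun z => cexp (t%:C * z)) (fun z => t%:C * cexp (t%:C * z)).
Proof.
apply: chol_eq (chol_cexp (cholM (chol_cst t%:C) (@chol_id R))) _ => z _.
by rewrite mulr0 addr0 mulr1 mulrC.
Qed.

Definition Bromwich' mu t z : R[i] :=
  t%:C * Bromwich mu t z +
  - (mu%:C * Bromwich (mu + 1) t z + (a * nu)%:C * Bromwich (mu + 1 - nu) t z).

Lemma chol_Bromwich mu t : chol (Bromwich mu t) (Bromwich' mu t).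
Proof.
apply: chol_eq (cholM (chol_exp_line t) (chol_Rsymbol mu)) _ => z _.
rewrite /Bromwich' /Bromwich; ring.
Qed.

Lemma cholZ c (H H' : R[i] -> R[i]) : chol H H' ->
  chol (fun z => c * H z) (fun z => c * H' z).
Proof.
move=> h; apply: chol_eq (cholM (chol_cst c) h) _ => z _.
by rewrite mulr0 addr0.
Qed.

(** Existence is all that matters: a further derivative provides the continuity of [Bromwich']
    required by the fundamental theorem. *)
Lemma chol_Bromwich' mu t : exists H, chol (Bromwich' mu t) H.
Proof.
eexists; apply: cholD.
  exact: cholZ (chol_Bromwich _ _).
apply: cholN; apply: cholD.
  exact: cholZ (chol_Bromwich _ _).
exact: cholZ (chol_Bromwich _ _).
Qed.

Lemma cmod_exp_line t z : cmod (cexp (t%:C * z)) = expR (t * Re z).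
Proof. by rewrite cmod_cexp Re_realM. Qed.

Lemma line_bounded_Bromwich mu t : line_bounded (Bromwich mu t).
Proof.
move=> s0 s1 s00; have [C C0 hC] := @line_bounded_Rsymbol mu s0 s1 s00.
exists (expR (`|t| * s1) * C); first by rewrite mulr_ge0 ?expR_ge0.
move=> z zs; rewrite cmodM cmod_exp_line -mulrA.
apply: ler_pM; rewrite ?expR_ge0 ?cmod_ge0 ?hC//.
have /andP[z0 z1] := zs; rewrite ler_expR.
rewrite (@le_trans _ _ (`|t| * Re z))//.
  by rewrite ler_wpM2r ?ler_norm// (le_trans _ z0)// ltW.
by rewrite ler_wpM2l.
Qed.

Lemma line_bounded_Bromwich' mu t : line_bounded (Bromwich' mu t).
Proof.
apply: line_boundedD; first exact/line_boundedZ/line_bounded_Bromwich.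
apply: line_boundedN.
by apply: line_boundedD; apply/line_boundedZ/line_bounded_Bromwich.
Qed.

(** The usual factor 1 / (2 i pi) loses its i because dz = i dw on the line of abscissa [s]. *)
Definition invL (s : R) mu t : R[i] :=
  (2 * pi)^-1%:C * cint setT (fun w => Bromwich mu t (s +i* w)).

Lemma cinteg_Bromwich (s : R) mu t : 0 < s ->
  cinteg setT (fun w => Bromwich mu t (s +i* w)).
Proof.
move=> s0; exact: cinteg_line s0 (chol_Bromwich mu t) (line_bounded_Bromwich mu t).
Qed.

Lemma invL_line (s s' : R) mu t : 0 < s -> 0 < s' -> invL s mu t = invL s' mu t.
Proof.
move=> s0 s0'; have [H hH] := chol_Bromwich' mu t.
rewrite /invL (cint_line_cst s0 s0' (chol_Bromwich mu t) hH)//.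
  exact: line_bounded_Bromwich.
exact: line_bounded_Bromwich'.
Qed.

Lemma invL_mulX (s : R) mu t : 0 < s -> t%:C * invL s mu t =
  mu%:C * invL s (mu + 1) t + (a * nu)%:C * invL s (mu + 1 - nu) t.
Proof.
move=> s0; have [H hH] := chol_Bromwich' mu t.
have := cint_line_derivative s0 (chol_Bromwich mu t) hH
  (line_bounded_Bromwich mu t) (line_bounded_Bromwich' mu t).
have i m := cinteg_Bromwich m t s0.
have iZ c m : cinteg setT (fun w => c * Bromwich m t (s +i* w)) by exact: cintegZ.
rewrite cintD//; last by apply: cintegN => //; exact: cintegD.
rewrite cintN//; last exact: cintegD.
rewrite cintD// !cintZ//.
move/eqP; rewrite subr_eq0 => /eqP E.
by rewrite /invL mulrCA E; ring.
Qed.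

Lemma cderive_invL (s : R) mu t : 0 < s ->
  cderive (invL s mu) t (invL s (mu - 1) t).
Proof.
move=> s0.
have [C C0 hC] := @line_bounded_Rsymbol (mu - 1) s s s0.
have d : cderive (fun t => cint setT (fun w => Bromwich mu t (s +i* w))) t
    (cint setT (fun w => Bromwich (mu - 1) t (s +i* w))).
  apply: (@cderive_cint _ _ (fun t w => Bromwich mu t (s +i* w))
    (fun t w => Bromwich (mu - 1) t (s +i* w))
    (fun w => expR ((`|t| + 1) * s) * C * lorentz w) t (t - 1) (t + 1)) => //.
  - by apply/andP; split; lra.
  - by move=> x _; exact: cinteg_Bromwich.
  - move=> x w _ _; apply: cderive_eq.
      apply: cderiveM; last exact: cderive_cst.
      apply: cderive_cexp; apply: cderiveM; last exact: cderive_cst.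
      by apply: cderive_real; exact: rderive_id.
    by rewrite /Bromwich -Rsymbol_mulz//; ring.
  - by apply: integrableZR => //; exact: integrable_lorentz.
  - move=> x w /andP[x1 x2] _; rewrite cmodM cmod_exp_line -mulrA.
    apply: ler_pM; rewrite ?expR_ge0 ?cmod_ge0//; last by rewrite hC//= lexx.
    rewrite ler_expR/= ler_wpM2r ?(ltW s0)//.
    by have := ler_norm t; lra.
by apply: cderive_eq; [exact: cderiveM (cderive_cst _ _) d|rewrite mulr0 addr0].
Qed.

(** For t <= 0 the exponential has modulus at most 1, and the factor 1 / Re z of [Rsymbol_bound]
    supplies the decay as the line moves right. It is what covers t = 0, the value that becomes the
    limit in (i). *)
Lemma invL_le0 (s : R) mu t : 0 < s -> t <= 0 -> invL s mu t = 0.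
Proof.
move=> s0 t0.
have [C C0 hC] := @Rsymbol_bound mu 1 ltr01.
pose M := (2 * pi)^-1 * (2 * (C * \int[leb]_x lorentz x)).
have b (x : R) : 1 <= x -> cmod (invL s mu t) <= M / x.
  move=> x1; have x0 : 0 < x by exact: lt_le_trans x1.
  rewrite (invL_line mu t s0 x0) cmodM cmod_real ger0_norm; last first.
    by rewrite invr_ge0 mulr_ge0// pi_ge0.
  rewrite /M -!mulrA ler_wpM2l ?invr_ge0 ?mulr_ge0 ?pi_ge0//.
  have -> : 2 * (C * (\int[leb]_x lorentz x / x)) = 2 * \int[leb]_w (C / x * lorentz w).
    rewrite (@RintegralZl _ _ _ leb)//; last exact: integrable_lorentz.
    by ring.
  apply: cmod_cint_le => //.
  - exact: cmeas_line x0 (chol_Bromwich mu t).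
  - move=> w _; rewrite cmodM cmod_exp_line/= -[leRHS]mul1r.
    apply: ler_pM; rewrite ?expR_ge0 ?cmod_ge0//; last exact: hC.
    by rewrite -expR0 ler_expR mulr_le0_ge0// ltW.
  - by apply: integrableZR => //; exact: integrable_lorentz.
exact: cmod_le_div_eq0 b.
Qed.

Lemma invL_bound (s : R) mu : 0 < s ->
  exists2 M, 0 <= M & forall t, cmod (invL s mu t) <= M * expR (s * t).
Proof.
move=> s0; have [C C0 hC] := @line_bounded_Rsymbol mu s s s0.
exists ((2 * pi)^-1 * (2 * (C * \int[leb]_x lorentz x))).
  rewrite mulr_ge0 ?invr_ge0 ?mulr_ge0 ?pi_ge0//.
  by apply: Rintegral_ge0 => x _; exact/ltW/lorentz_gt0.
move=> t; rewrite cmodM cmod_real ger0_norm; last first.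
  by rewrite invr_ge0 mulr_ge0// pi_ge0.
rewrite -!mulrA ler_wpM2l ?invr_ge0 ?mulr_ge0 ?pi_ge0//.
have -> : 2 * (C * (\int[leb]_x lorentz x * expR (s * t))) =
    2 * \int[leb]_w (expR (s * t) * C * lorentz w).
  rewrite (@RintegralZl _ _ _ leb)//; last exact: integrable_lorentz.
  by ring.
apply: cmod_cint_le => //.
- exact: cmeas_line s0 (chol_Bromwich mu t).
- move=> w _; rewrite cmodM cmod_exp_line/= -mulrA [t * s]mulrC.
  by rewrite ler_wpM2l ?expR_ge0// hC//= lexx.
- by apply: integrableZR => //; exact: integrable_lorentz.
Qed.

(** A single exchange of integrals for two uses: [k] will be the Laplace kernel or the
    Riemann-Liouville kernel. The weight e^(s t) in the hypothesis is the modulus of the Bromwich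
    exponential on the line. *)
Lemma cint_mul_invL (s : R) mu (D : set R) (k : R -> R[i]) (g : R -> R) :
  0 < s -> measurable D -> cmeas setT k ->
  leb.-integrable D (EFin \o g) ->
  (forall t, D t -> cmod (k t) * expR (s * t) <= g t) ->
  cint D (fun t => k t * invL s mu t) = (2 * pi)^-1%:C *
    cint setT (fun w => F mu (s +i* w) * cint D (fun t => k t * cexp (t%:C * (s +i* w)))).
Proof.
move=> s0 mD mk gi kg; have [C C0 hC] := @line_bounded_Rsymbol mu s s s0.
have mF := cmeas_line s0 (chol_Rsymbol mu).
have mexp : cmeas setT (fun p : R * R => cexp (p.1%:C * (s +i* p.2))).
  apply: cmeas_cexp; apply: cmeasM.
    by apply: cmeas_real; exact: measurable_fst.
  by apply: cmeas_pair => //; exact: measurable_snd.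
have mk1 : cmeas setT (fun p : R * R => k p.1).
  by apply: cmeas_comp => //; exact: measurable_fst.
have mF2 : cmeas setT (fun p : R * R => F mu (s +i* p.2)).
  by apply: (cmeas_comp mF); exact: measurable_snd.
have ke t w : cmod (k t * cexp (t%:C * (s +i* w))) = cmod (k t) * expR (s * t).
  by rewrite cmodM cmod_exp_line/= [t * s]mulrC.
have ik w : cinteg D (fun t => k t * cexp (t%:C * (s +i* w))).
  apply: cinteg_le gi => //; last by move=> t Dt; rewrite ke kg.
  apply: cmeasS => //; apply: cmeasM => //; apply: cmeas_cexp; apply: cmeasM.
    by apply: cmeas_real.
  exact: cmeas_cst.
have [M M0 hM] := invL_bound mu s0.
have ikY : cinteg D (fun t => k t * invL s mu t).
  apply: (@cinteg_le _ _ _ (fun t => M * g t)) => //; last exact: integrableZR.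
    apply: cmeasS => //; apply: cmeasM => //.
    by apply: cmeas_derivable => t; exact: cderive_invL.
  move=> t Dt; rewrite cmodM mulrC (le_trans (ler_wpM2r _ (hM t)))// ?cmod_ge0//.
  by rewrite -mulrA ler_wpM2l// mulrC kg.
have pi2 : (2 * pi)%:C != 0 :> R[i].
  by rewrite eq_complex /= eqxx andbT gt_eqF// mulr_gt0// pi_gt0.
transitivity ((2 * pi)^-1%:C *
    cint D (fun t => cint setT (fun w => k t * Bromwich mu t (s +i* w)))).
  rewrite (@eq_cint _ _ (fun t => cint setT _) (fun t => (2 * pi)%:C * (k t * invL s mu t))).
    by rewrite cintZ// fmorphV mulKf.
  move=> t Dt; rewrite cintZ//; last exact: cinteg_Bromwich.
  by rewrite /invL fmorphV mulrCA mulVKf.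
congr (_ * _).
rewrite (@cint_swap _ D setT (fun t w => k t * Bromwich mu t (s +i* w)) g
  (fun w => C * lorentz w))//.
- apply: eq_cint => w _; rewrite -cintZ//; apply: eq_cint => t _.
  by rewrite /Bromwich; ring.
- by apply: cmeasM => //; exact: cmeasM.
- by apply: integrableZR => //; exact: integrable_lorentz.
- move=> t w Dt _; rewrite /Bromwich mulrA cmodM ke.
  apply: ler_pM; rewrite ?mulr_ge0 ?cmod_ge0 ?expR_ge0 ?kg//.
  by rewrite hC//= lexx.
Qed.

End symbol.

(** * The Laplace transform of the Bromwich integral *)

Section laplace_exponential.
Context (R : realType).
Implicit Types (p z : R[i]).

Lemma laplace_kernelE p (t : R) : laplace_kernel p t = cexp (t%:C * - p).
Proof. by rewrite /laplace_kernel; congr cexp; ring. Qed.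

Lemma cmod_laplace_kernel p (t : R) : cmod (laplace_kernel p t) = expR (- (Re p * t)).
Proof. by rewrite laplace_kernelE cmod_exp_line ReN; congr expR; ring. Qed.

Lemma cderive_laplace_kernel p (t : R) :
  cderive (laplace_kernel p) t (- p * laplace_kernel p t).
Proof.
apply: cderive_eq.
  apply: cderive_cexp; apply: cderiveN.
  by apply: cderiveM (cderive_cst _ _) (cderive_real (rderive_id _)).
rewrite /laplace_kernel; ring.
Qed.

Lemma cmeas_laplace_kernel p : cmeas setT (laplace_kernel p).
Proof. by apply: cmeas_derivable => t; exact: cderive_laplace_kernel. Qed.

Lemma cvgy_expRN (x : R) : 0 < x -> expR (- (x * t)) @[t --> +oo] --> 0.
Proof.
move=> x0; apply: (cvg_comp (fun t => x * t) (fun t => expR (- t))); last exact: cvgr_expR.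
apply/cvgryPge => M; exists (M / x); split; first exact: num_real.
by move=> t Mt; rewrite mulrC -ler_pdivrMr// ltW.
Qed.

Lemma integrable_expRN_oo (x : R) : 0 < x ->
  leb.-integrable `]0, +oo[ (EFin \o (fun t => expR (- (x * t)))).
Proof.
move=> x0; apply: (@integrableS _ _ _ leb `[0, +oo[%classic) (integrable_expRN x0) => //.
by move=> t /=; rewrite !in_itv/= !andbT; exact: ltW.
Qed.

Lemma cinteg_laplace_kernel p : 0 < Re p -> cinteg `]0, +oo[ (laplace_kernel p).
Proof.
move=> p0; apply: cinteg_le (integrable_expRN_oo p0) => //.
  by apply: cmeasS => //; exact: cmeas_laplace_kernel.
by move=> t _; rewrite cmod_laplace_kernel.
Qed.

Lemma cint_laplace_kernel p : 0 < Re p -> cint `]0, +oo[ (laplace_kernel p) = p^-1.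
Proof.
move=> p0; have p1 := complex_neq0 p0.
rewrite (@cinty_ftc _ (fun t => - p^-1 * laplace_kernel p t) _
  (fun t => - p * laplace_kernel p t) 0 (- p^-1) 0).
- by rewrite sub0r opprK.
- move=> t _; apply: cderive_eq.
    exact: cderiveM (cderive_cst _ _) (cderive_laplace_kernel p t).
  by rewrite mulr0 addr0 mulrA mulNr mulrN opprK mulVf// mul1r.
- by move=> t _; exact: cderive_laplace_kernel.
- exact: cinteg_laplace_kernel.
- have d : cderive (fun t => - p^-1 * laplace_kernel p t) 0 _ :=
    cderiveM (cderive_cst _ _) (cderive_laplace_kernel p 0).
  have e : - p^-1 = - p^-1 * laplace_kernel p 0.
    by rewrite laplace_kernelE mul0r cexp0 mulr1.
  rewrite /ccvg [in X in _ --> X]e [X in _ /\ (_ --> Im X)]e; split.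
    by apply: cvg_at_right_filter; exact: (cderive_Re_continuous d).
  by apply: cvg_at_right_filter; exact: (cderive_Im_continuous d).
- apply: (@ccvg0_le _ _ _ (fun t => cmod p^-1 * expR (- (Re p * t)))).
    by apply: nearW => t; rewrite cmodM cmodN cmod_laplace_kernel.
  by rewrite -(mulr0 (cmod p^-1)); apply: cvgM; [exact: cvg_cst|exact: cvgy_expRN].
Qed.

End laplace_exponential.

(** * A rational integral along a vertical line *)

Section partial_fractions.
Context (R : realType).
Implicit Types (p z : R[i]).

Lemma sqrt_lorentz_cvg (F : set_system R) (C : R) : Filter F ->
  lorentz x @[x --> F] --> 0 -> Num.sqrt (C * lorentz x) @[x --> F] --> 0.
Proof.
move=> FF l0; rewrite -(@sqrtr0 R); apply: continuous_cvg; first exact: sqrt_continuous.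
by rewrite -(mulr0 C); apply: cvgM => //; exact: cvg_cst.
Qed.

(** The constant comes from 1 + w^2 <= (1 + 2 y^2) + 2 (w - y)^2, each summand being divided by X^2
    + (w - y)^2. *)
Lemma lorentz_shift_le (X y : R) : 0 < X -> exists2 C, 0 <= C &
  forall w, (X ^+ 2 + (w - y) ^+ 2)^-1 <= C * lorentz w.
Proof.
move=> X0; have X2 : 0 < X ^+ 2 by rewrite exprn_gt0.
exists ((1 + 2 * y ^+ 2) / X ^+ 2 + 2).
  by rewrite addr_ge0// divr_ge0 ?(ltW X2)// addr_ge0// mulr_ge0// sqr_ge0.
move=> w; have d0 : 0 < X ^+ 2 + (w - y) ^+ 2 by rewrite ltr_wpDr ?sqr_ge0.
rewrite /lorentz ler_pdivlMr; last by rewrite ltr_wpDr ?sqr_ge0.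
rewrite mulrC ler_pdivrMr//.
set A := (1 + 2 * y ^+ 2) / X ^+ 2.
have A0 : 0 <= A by rewrite divr_ge0 ?(ltW X2)// addr_ge0// mulr_ge0// sqr_ge0.
have h1 : A * X ^+ 2 = 1 + 2 * y ^+ 2 by rewrite /A divfK// gt_eqF.
have h2 : 0 <= A * (w - y) ^+ 2 by rewrite mulr_ge0// sqr_ge0.
have h3 : 0 <= (w - 2 * y) ^+ 2 by rewrite sqr_ge0.
nra.
Qed.

Lemma ccvg_inv_line (F : set_system R) (s : R) : Filter F -> 0 < s ->
  lorentz x @[x --> F] --> 0 -> ccvg F (fun w => (s +i* w)^-1) 0.
Proof.
move=> FF s0 l0; have [C C0 hC] := lorentz_shift_le 0 s0.
apply: (@ccvg0_le _ _ _ (fun w => Num.sqrt (C * lorentz w))); last exact: sqrt_lorentz_cvg.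
apply: nearW => w; rewrite cmodV /cmod/= -sqrtrV ?addr_ge0 ?sqr_ge0//.
by rewrite ler_wsqrtr//; have := hC w; rewrite subr0.
Qed.

Lemma ccvgM (F : set_system R) (f g : R -> R[i]) l m : Filter F ->
  ccvg F f l -> ccvg F g m -> ccvg F (fun x => f x * g x) (l * m).
Proof.
move=> FF [f1 f2] [g1 g2]; split; rewrite cE; under eq_fun do rewrite cE.
  by apply: cvgB; exact: cvgM.
by apply: cvgD; exact: cvgM.
Qed.

Lemma ccvgZ (F : set_system R) c (f : R -> R[i]) l : Filter F ->
  ccvg F f l -> ccvg F (fun x => c * f x) (c * l).
Proof. by move=> FF; apply: ccvgM; split; exact: cvg_cst. Qed.

Lemma ccvgD (F : set_system R) (f g : R -> R[i]) l m : Filter F ->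
  ccvg F f l -> ccvg F g m -> ccvg F (fun x => f x + g x) (l + m).
Proof.
move=> FF [f1 f2] [g1 g2]; split; rewrite cE; under eq_fun do rewrite cE; exact: cvgD.
Qed.

Lemma ln_sub_le (u v : R) : 0 < u -> 0 < v -> ln u - ln v <= (u - v) / v.
Proof.
move=> u0 v0; rewrite -ln_div ?posrE//.
have := @expR_ge1Dx R (ln (u / v)); rewrite lnK ?posrE ?divr_gt0//.
have -> : (u - v) / v = u / v - 1 by field; rewrite gt_eqF.
lra.
Qed.

(** Both logarithms diverge, but the squared moduli u and v grow like w^2 and differ by O(1 + |w|).
    So |ln u - ln v| <= |u - v| max (1 / u, 1 / v) is of order (1 + |w|) / (1 + w^2), which the
    square root of [2 * lorentz w] dominates. *)
Lemma cvg_ln_line (F : set_system R) (s X y : R) : Filter F -> 0 < s -> 0 < X ->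
  lorentz x @[x --> F] --> 0 ->
  ln (cmod (s +i* w)) - ln (cmod (X +i* (y - w))) @[w --> F] --> 0.
Proof.
move=> FF s0 X0 l0.
have [C C0 hC] := lorentz_shift_le 0 s0.
have [B B0 hB] := lorentz_shift_le y X0.
pose A := s ^+ 2 + X ^+ 2 + y ^+ 2 + 2 * `|y|.
have A0 : 0 <= A by rewrite /A !addr_ge0 ?sqr_ge0// mulr_ge0.
pose g (w : R) := 2^-1 * (A * (B + C)) * Num.sqrt (2 * lorentz w).
have g0 : g w @[w --> F] --> 0.
  rewrite -(mulr0 (2^-1 * (A * (B + C)))); apply: cvgM; first exact: cvg_cst.
  exact: sqrt_lorentz_cvg.
have ng0 : - g w @[w --> F] --> 0 by rewrite -oppr0; exact: cvgN.
apply: (squeeze_cvgr _ ng0 g0); apply: nearW => w.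
pose u := s ^+ 2 + w ^+ 2; pose v := X ^+ 2 + (w - y) ^+ 2.
have u0 : 0 < u by rewrite /u ltr_wpDr ?sqr_ge0// exprn_gt0.
have v0 : 0 < v by rewrite /v ltr_wpDr ?sqr_ge0// exprn_gt0.
have -> : ln (cmod (s +i* w)) - ln (cmod (X +i* (y - w))) = 2^-1 * (ln u - ln v).
  rewrite /cmod/= -[(y - w) ^+ 2]sqrrN opprB -/u -/v -!powR12_sqrt ?ltW// !ln_powR//.
  ring.
have uv : `|u - v| <= A * (1 + `|w|).
  rewrite /u /v (_ : _ - _ = s ^+ 2 - X ^+ 2 - y ^+ 2 + 2 * (y * w)); last by ring.
  rewrite (le_trans (ler_normD _ _))// normrM normrM (@ger0_norm _ 2)//.
  have h1 : `|s ^+ 2 - X ^+ 2 - y ^+ 2| <= s ^+ 2 + X ^+ 2 + y ^+ 2.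
    rewrite ler_norml; have := sqr_ge0 s; have := sqr_ge0 X; have := sqr_ge0 y; lra.
  rewrite (le_trans (lerD h1 (lexx _)))// /A.
  have := normr_ge0 y; have := normr_ge0 w; have := sqr_ge0 s; have := sqr_ge0 X.
  have := sqr_ge0 y; nra.
have wl : (1 + `|w|) * lorentz w <= Num.sqrt (2 * lorentz w).
  have L0 := lorentz_gt0 w.
  rewrite -[leLHS]ger0_norm; last by rewrite mulr_ge0 ?(ltW L0)// addr_ge0.
  rewrite -sqrtr_sqr ler_wsqrtr// exprMn [lorentz w ^+ 2]expr2 mulrA ler_wpM2r ?(ltW L0)//.
  rewrite /lorentz ler_pdivrMr; last by rewrite ltr_wpDr ?sqr_ge0.
  rewrite -(real_normK (num_real w)) sqrrD expr1n mul1r.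
  by have := sqr_ge0 (`|w| - 1); rewrite sqrrB expr1n mulr1; lra.
have bnd : `|ln u - ln v| <= A * (B + C) * Num.sqrt (2 * lorentz w).
  have q0 : 0 <= `|u - v| by [].
  have iu : u^-1 <= C * lorentz w by have := hC w; rewrite subr0.
  have iv : v^-1 <= B * lorentz w by exact: hB.
  have L0 := ltW (lorentz_gt0 w).
  have hh : `|u - v| * ((B + C) * lorentz w) <= A * (B + C) * Num.sqrt (2 * lorentz w).
    rewrite (@le_trans _ _ (A * (1 + `|w|) * ((B + C) * lorentz w)))//.
      by rewrite ler_wpM2r// mulr_ge0// addr_ge0.
    rewrite (_ : _ * _ = A * (B + C) * ((1 + `|w|) * lorentz w)); last by ring.
    by rewrite ler_wpM2l// mulr_ge0// addr_ge0.
  have BC q : q <= B * lorentz w \/ q <= C * lorentz w -> q <= (B + C) * lorentz w.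
    have := mulr_ge0 B0 L0; have := mulr_ge0 C0 L0.
    by rewrite mulrDl => ? ? []; lra.
  have half (p q : R) : 0 < p -> 0 < q -> q^-1 <= (B + C) * lorentz w ->
      ln p - ln q <= `|p - q| * ((B + C) * lorentz w).
    move=> p0' q0' hq; rewrite (le_trans (ln_sub_le p0' q0'))//.
    rewrite (@le_trans _ _ (`|p - q| / q))//.
      by rewrite ler_wpM2r ?ler_norm// invr_ge0 ltW.
    by rewrite ler_wpM2l.
  have := half u v u0 v0 (BC _ (or_introl iv)).
  have := half v u v0 u0 (BC _ (or_intror iu)); rewrite [`|v - u|]distrC.
  by rewrite ler_norml; move=> ? ?; apply/andP; split; lra.
rewrite -ler_norml normrM ger0_norm ?invr_ge0// /g -!mulrA ler_wpM2l ?invr_ge0//.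
by rewrite mulrA.
Qed.

Lemma chol_inv3 : chol (fun z : R[i] => z^-1 ^+ 3) (fun z => - 3 * z^-1 ^+ 4).
Proof.
have hV := cholV (@complex_neq0 R) (@chol_id R).
apply: chol_eq (cholM hV (cholM hV hV)) _ => z z0.
have := complex_neq0 z0 => zn; field; exact: zn.
Qed.

Lemma cvgy_atan_affine (X y : R) : 0 < X ->
  atan ((y - w) / X) @[w --> +oo] --> - (pi / 2).
Proof.
move=> X0.
have h : atan ((w - y) / X) @[w --> +oo] --> pi / 2.
  apply: (cvg_comp (fun w => (w - y) / X) atan); last exact: cvgy_atan.
  apply/cvgryPge => M; exists (M * X + y); split; first exact: num_real.
  by move=> w Mw; rewrite ler_pdivlMr// lerBrDr ltW.
rewrite (_ : (fun w => _) = fun w => - atan ((w - y) / X)); first exact: cvgN.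
by apply/funext => w; rewrite -atanN -mulNr opprB.
Qed.

Lemma cvgNy_atan_affine (X y : R) : 0 < X ->
  atan ((y - w) / X) @[w --> -oo] --> pi / 2.
Proof.
move=> X0; apply: (cvg_comp (fun w => (y - w) / X) atan); last exact: cvgy_atan.
apply/cvgryPge => M; exists (y - M * X); split; first exact: num_real.
by move=> w Mw; rewrite ler_pdivlMr//; lra.
Qed.

Lemma cderive_kernel (s : R) p w : 0 < s -> s < Re p ->
  cderive (fun w => (s +i* w)^-1 ^+ 3 * (p - (s +i* w))^-1) w
    ((s +i* w)^-1 ^+ 3 * (- (p - (s +i* w)) ^- 2 * (0 - 'i)) +
     (p - (s +i* w))^-1 * (- 3 * (s +i* w)^-1 ^+ 4 * 'i)).
Proof.
move=> s0 sp; have z0 : 0 < Re (s +i* w) by [].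
have q0 : 0 < Re (p - (s +i* w)) by rewrite !cE/= subr_gt0.
apply: cderiveM; first by apply: chol_inv3 => //; exact: cderive_line_im.
apply: cderiveV; first exact: complex_neq0.
by apply: cderiveD (cderive_cst _ _) (cderiveN (cderive_line_im _ _)).
Qed.

Lemma cmeas_kernel (s : R) p : 0 < s -> s < Re p ->
  cmeas setT (fun w => (s +i* w)^-1 ^+ 3 * (p - (s +i* w))^-1).
Proof. by move=> s0 sp; apply: cmeas_derivable => w; exact: cderive_kernel. Qed.

Lemma cmod_resolvent_le (s : R) p w : s < Re p ->
  cmod (p - (s +i* w))^-1 <= (Re p - s)^-1.
Proof.
move=> sp; have q0 : 0 < Re (p - (s +i* w)) by rewrite !cE/= subr_gt0.
rewrite cmodV lef_pV2 ?posrE ?subr_gt0// ?cmod_gt0//.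
by rewrite (le_trans _ (Re_le_cmod _))// !cE/= ler_norm.
Qed.

Lemma cmod_inv3_line_le (s s0 : R) w : 0 < s0 -> s0 <= s ->
  cmod ((s +i* w)^-1 ^+ 3) <= (1 + s0 ^- 2) / s * lorentz w.
Proof.
move=> s00 ss; have := @cmod_inv3_le _ s0 (s +i* w) s00 ss; apply: le_trans.
by rewrite exprVn cmodV 2!exprS expr1 !cmodM !exprS expr0 mulr1.
Qed.

Lemma cmod_kernel_le (s : R) p w : 0 < s -> s < Re p ->
  cmod ((s +i* w)^-1 ^+ 3 * (p - (s +i* w))^-1) <=
  (1 + s ^- 2) / s / (Re p - s) * lorentz w.
Proof.
move=> s0 sp; rewrite cmodM [leRHS]mulrAC.
apply: ler_pM; rewrite ?cmod_ge0 ?cmod_resolvent_le//.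
exact: cmod_inv3_line_le.
Qed.

Lemma cinteg_kernel (s : R) p : 0 < s -> s < Re p ->
  cinteg setT (fun w => (s +i* w)^-1 ^+ 3 * (p - (s +i* w))^-1).
Proof.
move=> s0 sp.
apply: (@cinteg_le _ _ _ (fun w => (1 + s ^- 2) / s / (Re p - s) * lorentz w)) => //.
- exact: cmeas_kernel.
- by move=> w _; exact: cmod_kernel_le.
- by apply: integrableZR => //; exact: integrable_lorentz.
Qed.

(** The antiderivative comes from 1 / (z^3 (p - z)) = 1 / (p z^3) + 1 / (p^2 z^2) + 1 / (p^3 z) + 1
    / (p^3 (p - z)). Its rational terms vanish at infinity, while the arguments of z and of p - z
    turn by pi in opposite directions, which produces 2 pi. *)
Lemma cint_kernel (s : R) p : 0 < s -> s < Re p ->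
  cint setT (fun w => (s +i* w)^-1 ^+ 3 * (p - (s +i* w))^-1) =
  (2 * pi)%:C * p^-1 ^+ 3.
Proof.
move=> s0 sp; pose X := Re p - s; pose y := Im p.
have X0 : 0 < X by rewrite subr_gt0.
have p0 : 0 < Re p by exact: lt_trans sp.
have pn := complex_neq0 p0.
have i0 : 'i != 0 :> R[i] by rewrite eq_complex /= oner_eq0 andbF.
have Xyw w : p - (s +i* w) = X +i* (y - w) by apply: complex_eq; rewrite !cE.
(* The two logarithms are kept together, since only their difference has a limit. *)
pose Ld w : R[i] := cLog (s +i* w) - cLog (X +i* (y - w)).
pose f w : R[i] := 'i^-1 * ((- (2 * p)^-1) * ((s +i* w)^-1 * (s +i* w)^-1)
   + (- p^-1 ^+ 2) * (s +i* w)^-1 + p^-1 ^+ 3 * Ld w).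
have lim (F : set_system R) (th : R) : Filter F -> lorentz x @[x --> F] --> 0 ->
    atan ((0 - w) / s) @[w --> F] --> - th -> atan ((y - w) / X) @[w --> F] --> - th ->
    ccvg F f (p^-1 ^+ 3 * (2 * th)%:C).
  move=> FF l0 a1 a2.
  have Lc : ccvg F Ld (0 +i* (2 * th)).
    split.
      rewrite (_ : (fun w => _) = fun w => ln (cmod (s +i* w)) - ln (cmod (X +i* (y - w)))).
        exact: cvg_ln_line.
      by apply/funext => w; rewrite /Ld !cE.
    rewrite (_ : Im _ = - - th - - th); last by rewrite /=; ring.
    rewrite (_ : (fun w => _) = fun w => - atan ((0 - w) / s) - atan ((y - w) / X)).
      by apply: cvgB => //; exact: cvgN.
    apply/funext => w; rewrite /Ld !cE /= !carg_atan//=.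
    by rewrite sub0r mulNr atanN opprK.
  have I := ccvg_inv_line FF s0 l0.
  have -> : p^-1 ^+ 3 * (2 * th)%:C = 'i^-1 *
      (- (2 * p)^-1 * (0 * 0) + - p^-1 ^+ 2 * 0 + p^-1 ^+ 3 * (0 +i* (2 * th))).
    rewrite (_ : 0 +i* (2 * th) = 'i * (2 * th)%:C); last first.
      by apply: complex_eq; rewrite !cE /=; ring.
    by rewrite !mulr0 !add0r [p^-1 ^+ 3 * ('i * _)]mulrCA mulKf.
  apply: ccvgZ; apply: ccvgD; last exact: ccvgZ.
  apply: ccvgD; last exact: ccvgZ.
  by apply: ccvgZ; exact: (ccvgM FF I I).
have dV w : cderive (fun w => (s +i* w)^-1) w (- (s +i* w) ^- 2 * 'i).
  apply: cderiveV; first exact: complex_neq0.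
  exact: cderive_line_im.
have dq w : cderive (fun w => X +i* (y - w)) w (- 'i).
  rewrite (_ : (fun w => _) = fun w => p - (s +i* w)).
    apply: cderive_eq.
      by apply: cderiveD (cderive_cst _ _) (cderiveN (cderive_line_im _ _)).
    by rewrite add0r.
  by apply/funext => x; rewrite Xyw.
have dL w : cderive Ld w ((s +i* w)^-1 * 'i - (X +i* (y - w))^-1 * - 'i).
  apply: cderiveD; first by apply: cderive_cLog => //; exact: cderive_line_im.
  by apply: cderiveN; exact: cderive_cLog.
have df w : cderive f w ((s +i* w)^-1 ^+ 3 * (p - (s +i* w))^-1).
  apply: cderive_eq.
    apply: cderiveM (cderive_cst _ _) _.
    apply: cderiveD; last exact: cderiveM (cderive_cst _ _) (dL w).
    apply: cderiveD; last exact: cderiveM (cderive_cst _ _) (dV w).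
    exact: cderiveM (cderive_cst _ _) (cderiveM (dV w) (dV w)).
  have zn : (s +i* w) != 0 by exact: complex_neq0.
  have qn : (X +i* (y - w)) != 0 by exact: complex_neq0.
  have pE : p = (s +i* w) + (X +i* (y - w)) by rewrite -Xyw addrC subrK.
  rewrite Xyw; move: pn; rewrite pE.
  move: (s +i* w) (X +i* (y - w)) zn qn => z q zn qn pn.
  by field; rewrite pn zn qn i0.
rewrite (cintT_ftc (A := p^-1 ^+ 3 * (2 * - (pi / 2))%:C)
   (B := p^-1 ^+ 3 * (2 * (pi / 2))%:C) df (fun w => cderive_kernel w s0 sp)).
- rewrite -mulrBr -rmorphB mulrC; congr (_%:C * _); by field.
- exact: cinteg_kernel.
- apply: lim; first exact: cvgNy_lorentz.
    by rewrite opprK; exact: cvgNy_atan_affine.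
  by rewrite opprK; exact: cvgNy_atan_affine.
- apply: lim; first exact: cvgy_lorentz.
    exact: cvgy_atan_affine.
  exact: cvgy_atan_affine.
Qed.

End partial_fractions.

(** * Pushing a line to the right *)

Section right_bounded.
Context (R : realType).
Implicit Types (H K : R[i] -> R[i]).

(** Unlike in [line_bounded], one bound serves all large [Re z], so lines may go to infinity.
    Without decay in [Im z] the notion is stable under products; the factor z^-3 provides
    integrability separately. *)
Definition right_bounded H : Prop := forall s0 : R, 0 < s0 ->
  exists2 B, 0 <= B & forall z, s0 <= Re z -> cmod (H z) <= B.

Lemma right_boundedD H K : right_bounded H -> right_bounded K ->
  right_bounded (fun z => H z + K z).
Proof.
move=> h k s0 s00; have [B B0 hB] := h s0 s00; have [C C0 hC] := k s0 s00.
exists (B + C); first exact: addr_ge0.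
by move=> z sz; rewrite (le_trans (le_cmodD _ _))// lerD ?hB ?hC.
Qed.

Lemma right_boundedM H K : right_bounded H -> right_bounded K ->
  right_bounded (fun z => H z * K z).
Proof.
move=> h k s0 s00; have [B B0 hB] := h s0 s00; have [C C0 hC] := k s0 s00.
exists (B * C); first exact: mulr_ge0.
by move=> z sz; rewrite cmodM; apply: ler_pM; rewrite ?cmod_ge0 ?hB ?hC.
Qed.

Lemma right_bounded_cst c : right_bounded (fun=> c).
Proof. by move=> s0 s00; exists (cmod c); rewrite ?cmod_ge0. Qed.

Lemma right_bounded_inv : right_bounded (fun z => z^-1).
Proof.
move=> s0 s00; exists s0^-1; first by rewrite invr_ge0 ltW.
move=> z sz; have z0 := lt_le_trans s00 sz.
rewrite cmodV lef_pV2 ?posrE ?cmod_gt0//.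
by rewrite (le_trans sz)// (le_trans _ (Re_le_cmod z))// ler_norm.
Qed.

Lemma right_bounded_inv3_le H (s0 : R) : right_bounded H -> 0 < s0 ->
  exists2 C, 0 <= C & forall z, s0 <= Re z ->
    cmod (H z * z^-1 ^+ 3) <= C / Re z * lorentz (Im z).
Proof.
move=> h s00; have [B B0 hB] := h s0 s00.
have D0 : 0 <= 1 + s0 ^- 2 by rewrite addr_ge0// invr_ge0 sqr_ge0.
exists (B * (1 + s0 ^- 2)); first exact: mulr_ge0.
case=> x y sz; rewrite cmodM -!mulrA; apply: ler_pM; rewrite ?cmod_ge0 ?hB//.
by rewrite mulrA; exact: cmod_inv3_line_le.
Qed.

Lemma line_bounded_inv3 H : right_bounded H ->
  line_bounded (fun z => H z * z^-1 ^+ 3).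
Proof.
move=> h s0 s1 s00; have [C C0 hC] := right_bounded_inv3_le h s00.
exists (C / s0); first by rewrite divr_ge0 ?(ltW s00).
move=> z /andP[sz _]; rewrite (le_trans (hC _ sz))// ler_wpM2r ?(ltW (lorentz_gt0 _))//.
by rewrite ler_wpM2l// lef_pV2 ?posrE// (lt_le_trans s00).
Qed.

(** The integral does not depend on the abscissa x and is O(1 / x). This takes the place of closing
    the contour on the right. *)
Lemma cint_line_inv3_eq0 H H' H'' (s : R) : 0 < s -> chol H H' -> chol H' H'' ->
  right_bounded H -> right_bounded H' ->
  cint setT (fun w => H (s +i* w) * (s +i* w)^-1 ^+ 3) = 0.
Proof.
move=> s0 hH hH' bH bH'.
pose K1 z := (H' z + H z * (- 3 * z^-1)) * z^-1 ^+ 3.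
have hK : chol (fun z => H z * z^-1 ^+ 3) K1.
  by apply: chol_eq (cholM hH (@chol_inv3 R)) _ => z _; rewrite /K1; ring.
have hV := cholV (@complex_neq0 R) (@chol_id R).
have [K2 hK1] : exists K2, chol K1 K2.
  eexists; apply: cholM; last exact: chol_inv3.
  exact: cholD hH' (cholM hH (cholM (chol_cst _) hV)).
have bK : line_bounded (fun z => H z * z^-1 ^+ 3) by exact: line_bounded_inv3.
have bK1 : line_bounded K1.
  apply: line_bounded_inv3; apply: right_boundedD => //; apply: right_boundedM => //.
  exact: right_boundedM (right_bounded_cst _) right_bounded_inv.
have [C C0 hC] := right_bounded_inv3_le bH ltr01.
apply: (@cmod_le_div_eq0 _ _ (2 * (C * \int[leb]_x lorentz x))) => x x1.
have x0 : 0 < x by exact: lt_le_trans x1.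
rewrite (cint_line_cst s0 x0 hK hK1 bK bK1).
have -> : 2 * (C * (\int[leb]_x lorentz x)) / x = 2 * \int[leb]_w (C / x * lorentz w).
  by rewrite (@RintegralZl _ _ _ leb)//; [ring|exact: integrable_lorentz].
apply: cmod_cint_le => //.
- exact: cmeas_line x0 hK.
- by move=> w _; exact: hC.
- by apply: integrableZR => //; exact: integrable_lorentz.
Qed.

End right_bounded.

(** * Cauchy's formula for the symbol *)

Section cauchy.
Context (R : realType) (nu a : R).
Hypotheses (nu0 : 0 < nu) (nu1 : nu < 1) (a0 : 0 < a).
Implicit Types (mu : R) (p z : R[i]).
Local Notation F mu := (Rsymbol mu nu a).

(** The linear span of the symbols is closed under differentiation, so one boundedness statement
    covers the symbol and all the derivatives used in Cauchy's formula. *)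
Inductive symbol_span : (R[i] -> R[i]) -> Prop :=
  | span_symbol mu : symbol_span (F mu)
  | spanZ c H : symbol_span H -> symbol_span (fun z => c * H z)
  | spanD H K : symbol_span H -> symbol_span K -> symbol_span (fun z => H z + K z).

Lemma symbol_span_chol H : symbol_span H -> exists2 H', symbol_span H' & chol H H'.
Proof.
elim=> [mu|c {}H _ [H' sH' dH']|{}H K _ [H' sH' dH'] _ [K' sK' dK']].
- exists (fun z => - 1 * (mu%:C * F (mu + 1) z + (a * nu)%:C * F (mu + 1 - nu) z)).
    by apply: spanZ; apply: spanD; apply: spanZ; exact: span_symbol.
  by apply: chol_eq (chol_Rsymbol nu a mu) _ => z _; rewrite mulN1r.
- by exists (fun z => c * H' z); [exact: spanZ|exact: cholZ].
- by exists (fun z => H' z + K' z); [exact: spanD|exact: cholD].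
Qed.

Lemma right_bounded_Rsymbol mu : right_bounded (F mu).
Proof.
move=> s0 s00; have [C C0 hC] := Rsymbol_bound nu0 nu1 a0 mu s00.
exists (C / s0); first by rewrite divr_ge0 ?(ltW s00).
move=> z sz; have z0 := lt_le_trans s00 sz.
rewrite (le_trans (hC z sz))// -[leRHS]mulr1.
apply: ler_pM; rewrite ?divr_ge0 ?(ltW z0) ?(ltW (lorentz_gt0 _))//.
  by rewrite ler_wpM2l// lef_pV2.
by rewrite invf_le1 ?lerDl ?sqr_ge0// ltr_wpDr ?sqr_ge0.
Qed.

Lemma right_bounded_span H : symbol_span H -> right_bounded H.
Proof.
elim=> [mu|c {}H _ bH|{}H K _ bH _ bK].
- exact: right_bounded_Rsymbol.
- exact: right_boundedM (right_bounded_cst _) bH.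
- exact: right_boundedD.
Qed.

(** A convex combination of [p] and [z] has real part at least min (Re p, s0). *)
Lemma right_bounded_affine H p (l : R) : 0 < Re p -> 0 <= l <= 1 ->
  right_bounded H -> right_bounded (fun z => H (p * (1 - l)%:C + l%:C * z)).
Proof.
move=> p0 /andP[l0 l1] h s0 s00.
have m0 : 0 < Num.min (Re p) s0 by rewrite lt_min p0.
have [B B0 hB] := h _ m0; exists B => // z sz; apply: hB.
rewrite !cE/= !(mulr0, mul0r, subr0).
have mp : Num.min (Re p) s0 <= Re p by rewrite ge_min lexx.
have ms : Num.min (Re p) s0 <= Re z by rewrite ge_min sz orbT.
have := ler_wpM2r (_ : 0 <= 1 - l) mp; rewrite subr_ge0 => /(_ l1).
have := ler_wpM2l l0 ms; lra.
Qed.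

(* Move the pole [p] away along the homotheties [z |-> p + l (z - p)]: the
   derivative with respect to [l] of the integral of
   [Phi (p + l (z - p)) z^-3 / (p - z)] has no pole any more and integrates to 0. *)
Lemma cint_cauchy mu p (s : R) : 0 < s -> s < Re p ->
  cint setT (fun w => F mu (s +i* w) * (p - (s +i* w))^-1) = (2 * pi)%:C * F mu p.
Proof.
move=> s0 sp; have p0 : 0 < Re p by exact: lt_trans sp.
(* Three powers of 1 / z are moved from the symbol to the kernel, which thus becomes integrable by
   itself; of [Phi] and its derivatives only boundedness is then required. *)
pose Phi := F (mu - 3).
have sPhi : symbol_span Phi by exact: span_symbol.
have Fz z : 0 < Re z -> F mu z = Phi z * z^-1 ^+ 3.
  move=> z0; rewrite /Phi /Rsymbol.
  rewrite (_ : - mu = - (mu - 3) + - 1 + - 1 + - 1); last by ring.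
  by rewrite 3!cpowD cpowN1//; ring.
clearbody Phi.
have [Phi1 sPhi1 hPhi] := symbol_span_chol sPhi.
have [Phi2 sPhi2 hPhi1] := symbol_span_chol sPhi1.
have [Phi3 sPhi3 hPhi2] := symbol_span_chol sPhi2.
pose ker w := (s +i* w)^-1 ^+ 3 * (p - (s +i* w))^-1.
pose z l w : R[i] := p * (1 - l)%:C + l%:C * (s +i* w).
pose g l := cint setT (fun w => Phi (z l w) * ker w).
have X0 : 0 < Re p - s by rewrite subr_gt0.
(* Chosen so that Re (z l w) >= s / 2 up to l = 1 + e: differentiating at l = 1 needs a
   neighbourhood of 1. *)
pose e := s / (2 * (Re p - s)).
have e0 : 0 < e by rewrite divr_gt0// mulr_gt0.
have zE l w : Re (z l w) = Re p - l * (Re p - s).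
  by rewrite /z !cE/=; ring.
have zs l w : - 1 < l < 1 + e -> s / 2 <= Re (z l w).
  move=> /andP[l1 l2]; rewrite zE.
  have : l * (Re p - s) <= (1 + e) * (Re p - s) by rewrite ler_wpM2r// ltW.
  rewrite (_ : (1 + e) * (Re p - s) = Re p - s + s / 2); first by lra.
  by rewrite /e; field; rewrite gt_eqF.
have s20 : 0 < s / 2 by rewrite divr_gt0.
have z0 l w : - 1 < l < 1 + e -> 0 < Re (z l w).
  by move=> h; exact: lt_le_trans (zs _ _ h).
have [B B0 hB] := right_bounded_span sPhi s20.
have [B1 B10 hB1] := right_bounded_span sPhi1 s20.
pose Cs := (1 + s ^- 2) / s.
have dzw l w : cderive (z l) w (l%:C * 'i).
  apply: cderive_eq.
    apply: cderiveD (cderive_cst _ _) _.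
    exact: cderiveM (cderive_cst _ _) (cderive_line_im _ _).
  by rewrite add0r mulr0 addr0.
have dzl l w : cderive (z ^~ w) l ((s +i* w) - p).
  apply: cderive_eq.
    apply: cderiveD.
      apply: cderiveM (cderive_cst _ _) (cderive_real _).
      exact: rderiveD (rderive_cst _ _) (rderiveN (rderive_id _)).
    exact: cderiveM (cderive_real (rderive_id _)) (cderive_cst _ _).
  rewrite add0r rmorphN/=; ring.
have mP (H H' : R[i] -> R[i]) l : chol H H' -> - 1 < l < 1 + e ->
    cmeas setT (fun w => H (z l w)).
  by move=> hH hl; apply: cmeas_derivable => w; apply: hH; [exact: z0|exact: dzw].
have iL C : leb.-integrable setT (EFin \o (fun w => C * @lorentz R w)).
  by apply: integrableZR => //; exact: integrable_lorentz.
have dg l : 0 <= l <= 1 -> cderive g l 0.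
  move=> l01; have hl : - 1 < l < 1 + e.
    by have /andP[? ?] := l01; apply/andP; split; lra.
  have -> : 0 = cint setT (fun w => - (Phi1 (z l w) * (s +i* w)^-1 ^+ 3)) :> R[i].
    have bk x : 0 < Re x -> 0 < Re (p * (1 - l)%:C + l%:C * x).
      move=> x0; rewrite !cE/= !(mulr0, mul0r, subr0); have /andP[l0 l1] := l01.
      have [->|lN0] := eqVneq l 0; first by rewrite subr0 mulr1 mul0r addr0.
      rewrite ltr_wpDl ?mulr_ge0 ?subr_ge0 ?(ltW p0)// mulr_gt0//.
      by rewrite lt_neqAle eq_sym lN0.
    have E := @cint_line_inv3_eq0 _ (fun x => Phi1 (p * (1 - l)%:C + l%:C * x)) _ _ s s0
      (chol_affine bk hPhi1) (cholM (chol_affine bk hPhi2) (chol_cst _)).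
    rewrite cintN//.
      rewrite E ?oppr0//; first exact/right_bounded_affine/right_bounded_span.
      apply: right_boundedM (right_bounded_cst _).
      exact/right_bounded_affine/right_bounded_span.
    apply: (@cinteg_line _ (fun x => Phi1 (p * (1 - l)%:C + l%:C * x) * x^-1 ^+ 3) _ s s0).
      exact: cholM (chol_affine bk hPhi1) (@chol_inv3 R).
    exact/line_bounded_inv3/right_bounded_affine/right_bounded_span.
  apply: (@cderive_cint _ _ (fun l w => Phi (z l w) * ker w)
    (fun l w => - (Phi1 (z l w) * (s +i* w)^-1 ^+ 3)) (fun w => B1 * Cs * lorentz w)
    l (- 1) (1 + e)) => //.
  - move=> x hx; apply: (@cinteg_le _ _ _ (fun w => B * (Cs / (Re p - s)) * lorentz w)) => //.
      by apply: cmeasM; [exact: mP hPhi hx|exact: cmeas_kernel].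
    move=> w _; rewrite cmodM -mulrA; apply: ler_pM; rewrite ?cmod_ge0 ?hB ?zs//.
    exact: cmod_kernel_le.
  - move=> x w hx _; apply: cderive_eq.
      apply: cderiveM (cderive_cst _ _); apply: hPhi; [exact: z0|exact: dzl].
    rewrite mulr0 add0r /ker.
    have : p - (s +i* w) != 0 by apply: complex_neq0; rewrite !cE.
    move: (s +i* w)^-1 => v; move: (s +i* w) => q qn; field; exact: qn.
  - move=> x w hx _; rewrite cmodN cmodM -mulrA.
    apply: ler_pM; rewrite ?cmod_ge0 ?hB1 ?zs//.
    exact: cmod_inv3_line_le.
have g01 : g 0 = g 1.
  by apply: complex_eq; apply: (@derive0_cst _ (fun l => _ (g l))) => // l /dg[].
transitivity (g 1).
  have z1E w : z 1 w = s +i* w by rewrite /z subrr mulr0 add0r mul1r.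
  by apply: eq_cint => w _; rewrite z1E (Fz (s +i* w) s0) -mulrA.
(* At l = 0 the homothety collapses onto the pole, and [Phi] becomes the constant [Phi p]. *)
rewrite -g01 /g.
have z0E w : z 0 w = p by rewrite /z subr0 mulr1 mul0r addr0.
rewrite (@eq_cint _ _ _ (fun w => Phi p * ker w)); last by move=> w _; rewrite z0E.
have iker : cinteg setT ker by exact: cinteg_kernel.
by rewrite (cintZ (Phi p) _ iker)// /ker (cint_kernel s0 sp) (Fz p p0) mulrCA.
Qed.

End cauchy.

(** * Fractional integrals of the Bromwich integral *)

Section complex_gamma.
Context (R : realType).
Implicit Types (b x t : R) (z : R[i]).

Lemma Gamma_gt0 b : 0 < b -> 0 < Gamma b.
Proof.
move=> b0.
have i : leb.-integrable `]0, +oo[ (EFin \o (fun t : R => t `^ (b - 1) * expR (- t))).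
  rewrite (_ : (fun t : R => _) = fun t : R => t `^ (b - 1) * expR (- (1 * t))).
    by apply: integrable_powR_expR => //; lra.
  by apply/funext => t; rewrite mul1r.
(* A lower bound for the integrand on [1, 2], whatever the sign of b - 1. *)
pose c := expR (- (`|b - 1| * ln 2) - 2) : R.
have sub : `[1, 2]%classic `<=` (`]0, +oo[%classic : set R).
  by move=> t /=; rewrite !in_itv/= andbT => /andP[+ _]; exact: lt_le_trans.
have i12 : leb.-integrable `[1, 2] (EFin \o (fun t : R => t `^ (b - 1) * expR (- t))).
  exact: (@integrableS _ _ _ leb `]0, +oo[%classic).
rewrite /Gamma (@lt_le_trans _ _ c)// ?expR_gt0//.
rewrite (@le_trans _ _ (\int[leb]_(t in `[1, 2]) (t `^ (b - 1) * expR (- t))))//.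
  rewrite (@le_trans _ _ (\int[leb]_(t in `[1, 2]) (c : R)))//.
    rewrite Rintegral_cst//= lebesgue_measure_itv/= lte_fin ltr1n/=.
    by rewrite (_ : 2 - 1 = 1) ?mulr1//; ring.
  apply: (@le_Rintegral _ _ _ leb `[1, 2]%classic) => //.
    apply: measurable_bounded_integrable => //.
      by rewrite /= lebesgue_measure_itv/= lte_fin ltr1n/= ltry.
    by exists `|c|; split; [exact: num_real|move=> y cy t _ /=; exact: ltW].
  move=> t /=; rewrite in_itv/= => /andP[t1 t2].
  have t0 : 0 < t by exact: lt_le_trans t1.
  rewrite /powR gt_eqF// -expRD ler_expR.
  have l0 : 0 <= ln t by rewrite ln_ge0.
  have l2 : ln t <= ln 2 by rewrite ler_ln ?posrE.
  have := ler_norm (- (b - 1)); rewrite normrN => n1.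
  have : `|b - 1| * ln t <= `|b - 1| * ln 2 by rewrite ler_wpM2l.
  have : - (b - 1) * ln t <= `|b - 1| * ln t by rewrite ler_wpM2r.
  lra.
rewrite /Rintegral fine_le//; [exact: integrable_fin_num i12|exact: integrable_fin_num i|].
apply: ge0_subset_integral => //=.
  by have /integrableP[] := i.
by move=> t _; rewrite lee_fin mulr_ge0 ?powR_ge0 ?expR_ge0.
Qed.

Definition gamma_int b z : R[i] :=
  cint `]0, +oo[ (fun t => (t `^ (b - 1))%:C * laplace_kernel z t).

Lemma cmeas_gamma b z :
  cmeas setT (fun t => (t `^ (b - 1))%:C * laplace_kernel z t).
Proof.
apply: cmeasM; last exact: cmeas_laplace_kernel.
by apply: cmeas_real; exact: measurable_powR.
Qed.

Lemma cmod_gamma b z t : cmod ((t `^ (b - 1))%:C * laplace_kernel z t) =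
  t `^ (b - 1) * expR (- (Re z * t)).
Proof. by rewrite cmodM cmod_real ger0_norm ?powR_ge0// cmod_laplace_kernel. Qed.

Lemma cinteg_gamma b z : 0 < b -> 0 < Re z ->
  cinteg `]0, +oo[ (fun t => (t `^ (b - 1))%:C * laplace_kernel z t).
Proof.
move=> b0 z0; have b1 : -1 < b - 1 by lra.
apply: cinteg_le (integrable_powR_expR b1 z0) => //.
  by apply: cmeasS => //; exact: cmeas_gamma.
by move=> t _; rewrite cmod_gamma.
Qed.

Lemma cvgy_powR_expR b x : 0 <= b -> 0 < x -> t `^ b * expR (- (x * t)) @[t --> +oo] --> 0.
Proof.
move=> b0 x0; have x20 : 0 < x / 2 by rewrite divr_gt0.
have [C C0 hC] := powR_expR_bounded b0 x20.
have h : C * expR (- (x / 2 * t)) @[t --> +oo] --> 0.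
  by rewrite -(mulr0 C); apply: cvgM; [exact: cvg_cst|exact: cvgy_expRN].
apply: (squeeze_cvgr _ (cvg_cst 0) h); exists 0; split; first exact: num_real.
move=> t t0; rewrite mulr_ge0 ?powR_ge0 ?expR_ge0//=.
have -> : expR (- (x * t)) = expR (- (x / 2 * t)) * expR (- (x / 2 * t)).
  by rewrite -expRD; congr expR; field.
by rewrite mulrA ler_wpM2r ?expR_ge0// hC.
Qed.

(* The two exponents are kept apart by [b'], as comparing [b - 1] with
   [b' - 1] is expensive. *)
Lemma gamma_int_parts b b' z : b' = b + 1 -> 0 < b -> 0 < Re z ->
  z * gamma_int b' z = b%:C * gamma_int b z.
Proof.
move=> b'E b0 z0; have b10 : 0 < b' by rewrite b'E addr_gt0.
have b'1 : b' - 1 = b by rewrite b'E addrK.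
move: b'E => _.
pose f t : R[i] := (t `^ b)%:C * laplace_kernel z t.
pose g t : R[i] := b%:C * ((t `^ (b - 1))%:C * laplace_kernel z t) +
  (- z) * ((t `^ (b' - 1))%:C * laplace_kernel z t).
have ig1 := cintegZ b%:C (measurable_itv _) (cinteg_gamma b0 z0).
have ig2 := cintegZ (- z) (measurable_itv _) (cinteg_gamma b10 z0).
have dp c t : 0 < t -> cderive (fun t => (t `^ c)%:C) t (c * t `^ (c - 1))%:C.
  move=> t0; apply: cderive_real; apply: rderive_eq; first by rder.
  by rewrite mulr1.
have H0 : cint `]0, +oo[ g = 0 - 0.
  apply: (cinty_ftc (f := f) (g' := fun t =>
     b%:C * (((t `^ (b - 1))%:C * (- z * laplace_kernel z t)) +
       laplace_kernel z t * ((b - 1) * t `^ (b - 1 - 1))%:C) +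
     - z * (((t `^ (b' - 1))%:C * (- z * laplace_kernel z t)) +
       laplace_kernel z t * ((b' - 1) * t `^ (b' - 1 - 1))%:C))).
  - move=> t t0; apply: cderive_eq.
      exact: cderiveM (dp b t t0) (cderive_laplace_kernel z t).
    by rewrite /g b'1 rmorphM; ring.
  - move=> t t0; apply: cderive_eq.
      apply: cderiveD.
        apply: cderiveM (cderive_cst _ _) _.
        exact: cderiveM (dp _ t t0) (cderive_laplace_kernel z t).
      apply: cderiveM (cderive_cst _ _) _.
      exact: cderiveM (dp _ t t0) (cderive_laplace_kernel z t).
    by rewrite !mulr0 !addr0.
  - exact: cintegD.
  - apply: (@ccvg0_le _ _ _ (fun t => t `^ b)); last exact: powR_cvg0.
    near=> t; have t0 : 0 < t by near: t; exact: nbhs_right_gt.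
    rewrite /f cmodM cmod_real ger0_norm ?powR_ge0// cmod_laplace_kernel.
    by rewrite ler_piMr ?powR_ge0// -expR0 ler_expR oppr_le0 mulr_ge0 ?ltW.
  - apply: (@ccvg0_le _ _ _ (fun t => t `^ b * expR (- (Re z * t)))).
      by apply: nearW => t; rewrite /f cmodM cmod_real ger0_norm ?powR_ge0// cmod_laplace_kernel.
    by apply: cvgy_powR_expR => //; exact: ltW.
have E := cintD (measurable_itv _) ig1 ig2.
have E1 := cintZ b%:C (measurable_itv _) (cinteg_gamma b0 z0).
have E2 := cintZ (- z) (measurable_itv _) (cinteg_gamma b10 z0).
have : b%:C * gamma_int b z + - z * gamma_int b' z = 0 - 0.
  apply: etrans H0; apply: etrans (esym E).
  by congr (_ + _); [exact: (esym E1)|exact: (esym E2)].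
rewrite [0 - 0]subrr mulNr => /eqP; rewrite subr_eq0 => /eqP/esym; exact.
Unshelve. all: end_near. Qed.

Lemma gamma_int1 b : 0 < b -> gamma_int b 1 = (Gamma b)%:C.
Proof.
move=> b0; rewrite /gamma_int /Gamma; apply: complex_eq => /=.
  apply: eq_Rintegral => t _.
  by rewrite !(mul1r, mul0r, mulr0, subr0, addr0, oppr0, cos0, mulr1).
rewrite -[RHS](mul0r (fine (lebesgue_measure (`]0, +oo[%classic : set R)))).
rewrite -Rintegral_cst//; apply: eq_Rintegral => t _.
by rewrite !(mul1r, mul0r, mulr0, subr0, addr0, oppr0, sin0).
Qed.

(** Along the segment from [z] to 1, the product of the integral with the b-th power has zero
    derivative: differentiating raises [b] by one, and [gamma_int_parts] brings it back. At the end
    point 1 the integral is [Gamma b]. *)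
Lemma gamma_intE b z : 0 < b -> 0 < Re z ->
  gamma_int b z = (Gamma b)%:C * cpow z (- b).
Proof.
move=> b0 z0.
pose g (l : R) : R[i] := z + l%:C * (1 - z).
pose m := Num.min (Re z) 1.
have m0 : 0 < m by rewrite lt_min z0 ltr01.
have mz : m <= Re z by rewrite ge_min lexx.
have m1 : m <= 1 by rewrite ge_min lexx orbT.
have gE l : Re (g l) = (1 - l) * Re z + l by rewrite /g !cE/=; ring.
have gm l : 0 <= l <= 1 -> m <= Re (g l).
  move=> /andP[l0 l1]; rewrite gE.
  have := ler_wpM2l l0 m1; have := ler_wpM2l (_ : 0 <= 1 - l) mz.
  by rewrite subr_ge0 => /(_ l1); lra.
have dg l : cderive g l (1 - z).
  apply: cderive_eq.
    apply: cderiveD (cderive_cst _ _) _.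
    exact: cderiveM (cderive_real (rderive_id _)) (cderive_cst _ _).
  by rewrite add0r mulr0 add0r mulr1.
have [b' b'E] : exists b', b' = b + 1 by exists (b + 1).
have b'1 : b' - 1 = b by rewrite b'E addrK.
have dI l : 0 <= l <= 1 -> cderive (fun l => gamma_int b (g l)) l
    (- (1 - z) * gamma_int b' (g l)).
  move=> l01; have gl := gm _ l01.
  (* Within [e] of [l] the real part of [g] moves by at most m / 2; the added 1 covers Re z = 1. *)
  pose e := m / (2 * (`|1 - Re z| + 1)).
  have n0 : 0 < `|1 - Re z| + 1 by rewrite ltr_wpDl.
  have e0 : 0 < e by rewrite divr_gt0// mulr_gt0.
  have ge x : l - e < x < l + e -> m / 2 <= Re (g x).
    move=> /andP[x1 x2].
    have E : Re (g x) = Re (g l) + (x - l) * (1 - Re z) by rewrite !gE; ring.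
    have h1 : `|x - l| <= e by rewrite ler_norml; lra.
    have h2 : `|(x - l) * (1 - Re z)| <= e * (`|1 - Re z| + 1).
      by rewrite normrM; apply: ler_pM => //; rewrite lerDl.
    have h3 : e * (`|1 - Re z| + 1) = m / 2 by rewrite /e; field; rewrite gt_eqF.
    move: h2; rewrite h3 E ler_norml => /andP[? ?]; lra.
  have m20 : 0 < m / 2 by rewrite divr_gt0.
  have b10 : 0 < b' by rewrite b'E addr_gt0.
  have b11 : -1 < b by lra.
  have -> : - (1 - z) * gamma_int b' (g l) =
     cint `]0, +oo[ (fun t => - (1 - z) * ((t `^ (b' - 1))%:C * laplace_kernel (g l) t)).
    rewrite cintZ//; apply: cinteg_gamma => //; exact: lt_le_trans gl.
  apply: (@cderive_cint _ _ (fun l t => (t `^ (b - 1))%:C * laplace_kernel (g l) t)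
    (fun l t => - (1 - z) * ((t `^ (b' - 1))%:C * laplace_kernel (g l) t))
    (fun t => cmod (1 - z) * (t `^ b * expR (- (m / 2 * t)))) l (l - e) (l + e)) => //.
  - by apply/andP; split; lra.
  - by move=> x hx; apply: cinteg_gamma => //; exact: lt_le_trans (ge _ hx).
  - move=> x t hx; rewrite /= in_itv/= andbT => t0; apply: cderive_eq.
      apply: cderiveM (cderive_cst _ _) _.
      apply: cderive_cexp; apply: cderiveN; exact: cderiveM (dg x) (cderive_cst _ _).
    have -> : t `^ (b' - 1) = t `^ (b - 1) * t.
      rewrite b'1 -[X in _ * X](powRr1 (ltW t0)) -powRD; last by rewrite (gt_eqF t0) implybT.
      by rewrite subrK.
    rewrite rmorphM /laplace_kernel; ring.
  - by apply: integrableZR => //; exact: integrable_powR_expR.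
  - move=> x t hx; rewrite /= in_itv/= andbT => t0.
    rewrite mulNr cmodN cmodM cmod_gamma b'1.
    rewrite ler_wpM2l ?cmod_ge0// ler_wpM2l ?powR_ge0// ler_expR lerN2 ler_pM2r//.
    exact: ge.
have dJ l : 0 <= l <= 1 -> cderive (fun l => gamma_int b (g l) * cpow (g l) b) l 0.
  move=> l01; have gl : 0 < Re (g l) by exact: lt_le_trans (gm _ l01).
  apply: cderive_eq.
    apply: cderiveM (dI _ l01) _.
    exact: (chol_cpow b gl (dg l)).
  have gn := complex_neq0 gl.
  (* Multiplying by [g l] creates the left-hand side of the recursion. *)
  apply: (mulfI gn); rewrite mulr0.
  have -> : g l * (gamma_int b (g l) * (b%:C * cpow (g l) (b - 1) * (1 - z)) +
      cpow (g l) b * (- (1 - z) * gamma_int b' (g l))) =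
     (1 - z) * (b%:C * gamma_int b (g l) * (g l * cpow (g l) (b - 1)) -
      cpow (g l) b * (g l * gamma_int b' (g l))).
    by move: (gamma_int b (g l)) (gamma_int b' (g l)) => A B; ring.
  rewrite (gamma_int_parts b'E)// cpowD cpowN1// [g l * (_ * _)]mulrCA mulfV//; ring.
have J : gamma_int b (g 0) * cpow (g 0) b = gamma_int b (g 1) * cpow (g 1) b.
  by apply: complex_eq;
    apply: (@derive0_cst _ (fun l => _ (gamma_int b (g l) * cpow (g l) b))) => // l /dJ[].
have g0 : g 0 = z by rewrite /g mul0r addr0.
have g1 : g 1 = 1 by rewrite /g mul1r addrC subrK.
rewrite g0 g1 gamma_int1// in J.
have c1 : cpow 1 b = 1 :> R[i] by rewrite cpow_real// powR1.
by rewrite cpowN -[LHS](mulfK (cpow_neq0 z b)) J c1 mulr1.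
Qed.

End complex_gamma.

(** * Conjugation symmetry *)

Section conjugation.
Context (R : realType).
Implicit Types (z w : R[i]) (p : R).

Lemma conjM z w : conjc (z * w) = conjc z * conjc w.
Proof. by case: z w => ? ? [? ?]; apply: complex_eq => /=; ring. Qed.

Lemma conjN z : conjc (- z) = - conjc z.
Proof. by case: z. Qed.

Lemma conj_real (x : R) : conjc x%:C = x%:C.
Proof. by apply: complex_eq; rewrite //= oppr0. Qed.

Lemma Im_conj z : Im (conjc z) = - Im z.
Proof. by case: z. Qed.

Lemma cexp_conj z : cexp (conjc z) = conjc (cexp z).
Proof. by case: z => x y; apply: complex_eq; rewrite /= ?cosN ?sinN ?mulrN. Qed.

Lemma cmod_conj z : cmod (conjc z) = cmod z.
Proof. by case: z => x y; rewrite /cmod /= sqrrN. Qed.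

Lemma cLog_conj z : 0 < Re z -> cLog (conjc z) = conjc (cLog z).
Proof.
move=> z0; have z0' : 0 < Re (conjc z) by case: z z0.
rewrite /cLog cmod_conj !carg_atan//; case: z z0 {z0'} => x y x0 /=.
by rewrite mulNr atanN.
Qed.

Lemma cpow_conj z p : 0 < Re z -> cpow (conjc z) p = conjc (cpow z p).
Proof.
by move=> z0; rewrite /cpow cLog_conj// -cexp_conj conjM conj_real.
Qed.

Lemma Rsymbol_conj (mu nu a : R) z : 0 < Re z ->
  Rsymbol mu nu a (conjc z) = conjc (Rsymbol mu nu a z).
Proof.
move=> z0; rewrite /Rsymbol !cpow_conj// conjM; congr (_ * _).
by rewrite -cexp_conj conjN conjM conj_real.
Qed.

End conjugation.

Section inverse_laplace.
Context (R : realType) (nu a : R).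
Hypotheses (nu0 : 0 < nu) (nu1 : nu < 1) (a0 : 0 < a).
Implicit Types (mu b t : R) (p z : R[i]).
Local Notation F mu := (Rsymbol mu nu a).
Local Notation Y := (invL nu a).

(** Conjugation exchanges the points s + iw and s - iw of the line, so the imaginary part of the
    integrand is odd in w. *)
Lemma invL_real (s : R) mu t : 0 < s -> Im (Y s mu t) = 0.
Proof.
move=> s0; set I := cint setT (fun w => Bromwich nu a mu t (s +i* w)).
have mB := cmeas_line s0 (chol_Bromwich nu a mu t).
have [_ i2] := cinteg_Bromwich nu0 nu1 a0 mu t s0.
have e w : Bromwich nu a mu t (s +i* (0 - w)) = conjc (Bromwich nu a mu t (s +i* w)).
  rewrite sub0r /Bromwich conjM -cexp_conj conjM conj_real -Rsymbol_conj//.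
have E : Im I = - Im I.
  rewrite {1}/I (cint_reflect 0 measurableT mB).
  rewrite (_ : [set x | _] = setT); last by apply/seteqP; split.
  rewrite (eq_cint (fun w _ => e w)) -[RHS]mulN1r.
  apply: etrans (@RintegralZl _ _ _ leb setT _ (-1) _ i2) => //.
  by apply: eq_Rintegral => w _; rewrite mulN1r Im_conj.
have I0 : Im I = 0 by lra.
by rewrite /invL -/I Im_realM I0 mulr0.
Qed.

(** After the exchange the inner integral is the resolvent (p - z)^-1, because the line lies to the
    left of [p]; Cauchy's formula evaluates the outer one. *)
Lemma cint_laplace_invL (s : R) mu p : 0 < s -> s < Re p ->
  cint `]0, +oo[ (fun t => laplace_kernel p t * Y s mu t) = F mu p.
Proof.
move=> s0 sp; have X0 : 0 < Re p - s by rewrite subr_gt0.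
have pi2 : (2 * pi)%:C != 0 :> R[i].
  by rewrite eq_complex /= eqxx andbT gt_eqF// mulr_gt0// pi_gt0.
rewrite (@cint_mul_invL _ _ _ nu0 nu1 a0 s mu _ _ (fun t => expR (- ((Re p - s) * t))))//.
- rewrite (@eq_cint _ _ _ (fun w => F mu (s +i* w) * (p - (s +i* w))^-1)).
    by rewrite (cint_cauchy nu0 nu1 a0)// fmorphV mulKf.
  move=> w _; congr (_ * _); rewrite -cint_laplace_kernel; last by rewrite !cE.
  apply: eq_cint => t _; rewrite !laplace_kernelE -cexpD; congr cexp; ring.
- exact: cmeas_laplace_kernel.
- exact: integrable_expRN_oo.
- move=> t _; rewrite cmod_laplace_kernel -expRD ler_expR; lra.
Qed.

Lemma cinteg_laplace_invL (s : R) mu p : 0 < s -> s < Re p ->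
  cinteg `]0, +oo[ (fun t => laplace_kernel p t * Y s mu t).
Proof.
move=> s0 sp; have X0 : 0 < Re p - s by rewrite subr_gt0.
have [M M0 hM] := invL_bound nu0 nu1 a0 mu s0.
apply: (@cinteg_le _ _ _ (fun t => M * expR (- ((Re p - s) * t)))) => //.
- apply: cmeasS => //; apply: cmeasM; first exact: cmeas_laplace_kernel.
  by apply: cmeas_derivable => t; exact: (cderive_invL nu0 nu1 a0).
- move=> t _; rewrite cmodM cmod_laplace_kernel.
  rewrite (le_trans (ler_wpM2l (expR_ge0 _) (hM t)))// mulrCA ler_wpM2l//.
  by rewrite -expRD ler_expR; lra.
- by apply: integrableZR => //; exact: integrable_expRN_oo.
Qed.

(** The reflection u |-> t - u turns this into e^(s t) times a Gamma integrand. *)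
Lemma integrable_RL_kernel b (s t : R) : 0 < b -> 0 < s ->
  leb.-integrable `]-oo, t[ (EFin \o (fun u => (t - u) `^ (b - 1) * expR (s * u))).
Proof.
move=> b0 s0; have b1 : -1 < b - 1 by lra.
have i := @integrableZR _ _ (measurable_itv _) (expR (s * t)) _ (integrable_powR_expR b1 s0).
have mphi : measurable_fun setT (fun x : R => t - x) by exact: measurable_funB.
have := integrable_mp mphi (@pushforward_leb_reflect _ t) (measurable_itv _) i.
rewrite (_ : (fun x : R => t - x) @^-1` `]0, +oo[ = `]-oo, t[%classic); last first.
  by apply/seteqP; split => x /=; rewrite !in_itv/= ?andbT subr_gt0.
apply: (@eq_integrable _ _ _ leb _ (measurable_itv _)) => u _ /=; congr EFin.
rewrite mulrCA -expRD; congr (_ * expR _); ring.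
Qed.

(** Integrating from -oo makes each exponential e^(zu) an eigenfunction, with eigenvalue Gamma(b)
    z^(-b). Since the inversion integral vanishes on the negative axis, nothing is added to the
    Riemann-Liouville integral from 0. *)
Lemma cint_RL_invL b (s : R) mu t : 0 < b -> 0 < s ->
  cint `]-oo, t[ (fun u => ((t - u) `^ (b - 1))%:C * Y s mu u) =
  (Gamma b)%:C * Y s (mu + b) t.
Proof.
move=> b0 s0.
have mk : cmeas setT (fun u : R => ((t - u) `^ (b - 1))%:C).
  apply: cmeas_real; apply: (measurableT_comp (measurable_powR _)).
  exact: measurable_funB.
have i := integrable_RL_kernel t b0 s0.
rewrite (@cint_mul_invL _ _ _ nu0 nu1 a0 s mu _ _
  (fun u => (t - u) `^ (b - 1) * expR (s * u)))//; last first.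
  by move=> u _; rewrite cmod_real ger0_norm ?powR_ge0.
rewrite /invL mulrCA; congr (_ * _); rewrite -cintZ//; last exact: cinteg_Bromwich.
apply: eq_cint => w _.
have z0 : 0 < Re (s +i* w) by [].
have mD : measurable (`]-oo, t[%classic : set R) by [].
rewrite (cint_reflect t mD); last first.
  apply: cmeasS => //; apply: cmeasM => //; apply: cmeas_cexp; apply: cmeasM.
    by apply: cmeas_real.
  exact: cmeas_cst.
rewrite (_ : [set x | _] = `]0, +oo[%classic); last first.
  by apply/seteqP; split => x /=; rewrite !in_itv/= ?andbT; lra.
rewrite (@eq_cint _ _ _ (fun u => cexp (t%:C * (s +i* w)) *
   ((u `^ (b - 1))%:C * laplace_kernel (s +i* w) u))); last first.
  move=> u _; rewrite (_ : t - (t - u) = u); last by ring.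
  rewrite mulrCA laplace_kernelE -cexpD; congr (_ * cexp _); rewrite rmorphB; ring.
rewrite cintZ//; last exact: cinteg_gamma.
have := gamma_intE b0 z0; rewrite /gamma_int => ->.
have E : cpow (s +i* w) (- b) * F mu (s +i* w) = F (mu + b) (s +i* w).
  by rewrite Rsymbol_mulpow// opprK.
by rewrite /Bromwich -E; ring.
Qed.

End inverse_laplace.

(** * The equations for nu < 1 *)

Section fractional_operators.
Context (R : realType).
Implicit Types (al nu t : R) (f g : R -> R).

Lemma eq_RLint al f g t : 0 < t -> (forall u, 0 < u -> f u = g u) ->
  RLint al f t = RLint al g t.
Proof.
move=> t0 fg; rewrite /RLint; case: ifP => _; first exact: fg.
congr (_ * _); apply: eq_Rintegral => u; rewrite inE/= in_itv/= => /andP[u0 _].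
by rewrite fg.
Qed.

Lemma eq_RLintegrable al f g t : (forall u, 0 < u -> f u = g u) ->
  RLintegrable al f t -> RLintegrable al g t.
Proof.
move=> fg [->|i]; [by left|right]; move: i.
apply: (@eq_integrable _ _ _ leb _ (measurable_itv _)) => u.
by rewrite inE/= in_itv/= => /andP[u0 _]; rewrite fg.
Qed.

Lemma nceil1 nu : 0 < nu -> nu <= 1 -> nceil nu = 1%N.
Proof.
move=> nu0 nu1; rewrite /nceil; suff -> : Num.ceil nu = 1 by [].
by apply: ceil_def; rewrite subrr nu0.
Qed.

Lemma near_pos (t : R) : 0 < t -> \forall u \near t, 0 < u.
Proof. by move=> t0; exact: lt_nbhsr. Qed.

Lemma rderive1 f t d : rderive f t d -> derive1 f t = d.
Proof. by move=> h; rewrite derive1E; exact: derive_val. Qed.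

(** Shared by nu < 1 and nu = 1: facts about a model [y0] are transported to any [y] equal to it on
    the positive axis. As the ceiling of [nu] is 1, both fractional derivatives reduce to [yr']: one
    differentiates the fractional integral [yr], the other integrates [y']. [C] is the condition
    under which the differential equation is claimed. *)
Lemma fractional_equations (mu nu a : R) (C : Prop) (y0 y yr y' yr' : R -> R) :
  0 < nu -> nu <= 1 -> (forall t, 0 < t -> y t = y0 t) ->
  y0 t @[t --> 0^'+] --> 0 ->
  (forall t, 0 < t ->
     [/\ leb.-integrable `]0, t[ (EFin \o y0), RLintegrable (1 - nu) y0 t,
         RLint (1 - nu) y0 t = yr t &
         a * nu * yr t = t * y0 t - mu * \int[leb]_(tau in `]0, t[) y0 tau]) ->
  (C -> forall t, 0 < t ->
     [/\ rderive y0 t (y' t), rderive yr t (yr' t), RLintegrable (1 - nu) y' t,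
         RLint (1 - nu) y' t = yr' t &
         a * nu * yr' t = t * y' t + (1 - mu) * y0 t]) ->
  [/\ y t @[t --> 0^'+] --> 0,
      forall t, 0 < t ->
        [/\ leb.-integrable `]0, t[ (EFin \o y), RLintegrable (1 - nu) y t &
            a * nu * RLint (1 - nu) y t =
            t * y t - mu * \int[leb]_(tau in `]0, t[) y tau] &
      C -> forall t, 0 < t ->
        [/\ derivable y t 1, RLderivable nu y t, caputo_derivable nu y t,
            a * nu * RLderiv nu y t = a * nu * caputo nu y t &
            a * nu * caputo nu y t = t * derive1 y t + (1 - mu) * y t]].
Proof.
move=> nu0 nu1 E lim H1 H2; split.
- apply: (cvg_trans _ lim); apply: near_eq_cvg; near=> t.
  by rewrite E//; near: t; exact: nbhs_right_gt.
- move=> t t0; have [i ri rE eq] := H1 _ t0.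
  have -> : \int[leb]_(tau in `]0, t[) y tau = \int[leb]_(tau in `]0, t[) y0 tau.
    by apply: eq_Rintegral => u; rewrite inE/= in_itv/= => /andP[u0 _]; rewrite E.
  split.
  + move: i; apply: (@eq_integrable _ _ _ leb _ (measurable_itv _)) => u.
    by rewrite inE/= in_itv/= => /andP[u0 _] /=; rewrite E.
  + by apply: eq_RLintegrable ri => u u0; rewrite E.
  + by rewrite (eq_RLint _ t0 E) rE eq E.
move=> hC.
have dy t : 0 < t -> rderive y t (y' t).
  move=> t0; have [d _ _ _ _] := H2 hC _ t0; apply: rderive_near d.
  by near=> u; rewrite E//; near: u; exact: near_pos.
have dyr t : 0 < t -> rderive (RLint (1 - nu) y) t (yr' t).
  move=> t0; have [_ d _ _ _] := H2 hC _ t0; apply: rderive_near d.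
  near=> u; have u0 : 0 < u by near: u; exact: near_pos.
  by have [_ _ <- _] := H1 _ u0; apply/esym; exact: eq_RLint.
have E' u : 0 < u -> derive1 y u = y' u by move=> /dy/rderive1.
move=> t t0; have [_ _ ri rE eq] := H2 hC _ t0.
have n1 := nceil1 nu0 nu1.
have RL : RLderiv nu y t = yr' t by rewrite /RLderiv n1 /=; exact/rderive1/dyr.
have ca : caputo nu y t = yr' t.
  by rewrite /caputo n1 /= (eq_RLint _ t0 E') rE.
rewrite RL ca E' // E //; split => //.
- by have /(_ t t0) := dy; case.
- split; rewrite n1.
    near=> u; have u0 : 0 < u by near: u; exact: near_pos.
    by have [_ i _ _] := H1 _ u0; apply: eq_RLintegrable i => v v0; rewrite E.
  move=> [|//] _ /=; near=> u.
  by have /dyr[] : 0 < u by near: u; exact: near_pos.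
- split; rewrite n1.
    move=> u /andP[u0 _] [|//] _ /=; near=> v.
    by have /dy[] : 0 < v by near: v; exact: near_pos.
  by apply: eq_RLintegrable ri => v v0; rewrite /= E'.
Unshelve. all: end_near. Qed.

End fractional_operators.

Section inverse_laplace_real.
Context (R : realType) (nu a : R).
Hypotheses (nu0 : 0 < nu) (nu1 : nu < 1) (a0 : 0 < a).
Implicit Types (mu b t : R) (p z : R[i]).
Local Notation F mu := (Rsymbol mu nu a).

Definition invLr mu t : R := Re (invL nu a 1 mu t).

Lemma invLrE s mu t : 0 < s -> invL nu a s mu t = (invLr mu t)%:C.
Proof.
move=> s0; rewrite (invL_line nu0 nu1 a0 _ _ s0 ltr01).
by apply: complex_eq => //; rewrite (invL_real nu0 nu1 a0)//.
Qed.

Lemma rderive_invLr mu t : rderive (invLr mu) t (invLr (mu - 1) t).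
Proof. by have [] := cderive_invL nu0 nu1 a0 mu t ltr01. Qed.

Lemma invLr_continuous mu t : {for t, continuous (invLr mu)}.
Proof. exact: rderive_continuous (rderive_invLr mu t). Qed.

Lemma invLr_le0 mu t : t <= 0 -> invLr mu t = 0.
Proof. by move=> t0; rewrite /invLr (invL_le0 nu0 nu1 a0)//. Qed.

Lemma invLr_mulX mu t :
  t * invLr mu t = mu * invLr (mu + 1) t + a * nu * invLr (mu + 1 - nu) t.
Proof.
have := invL_mulX nu0 nu1 a0 mu t ltr01; rewrite !(invLrE _ _ ltr01).
by rewrite -!rmorphM -rmorphD => /complexI.
Qed.

(** The line may be chosen for each [p]; the abscissa Re p / 2 lies to its left, which gives the
    transform on the whole half-plane. *)
Lemma laplace_invLr mu p : 0 < Re p ->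
  laplace_integrable (invLr mu) p /\ laplace (invLr mu) p = F mu p.
Proof.
move=> p0; have s0 : 0 < Re p / 2 by rewrite divr_gt0.
have sp : Re p / 2 < Re p by lra.
have E t : laplace_kernel p t * invL nu a (Re p / 2) mu t =
   (Re (laplace_kernel p t) * invLr mu t) +i* (Im (laplace_kernel p t) * invLr mu t).
  by rewrite invLrE//; case: (laplace_kernel p t) => x y; apply: complex_eq => /=; ring.
have [i1 i2] := cinteg_laplace_invL nu0 nu1 a0 mu s0 sp.
split.
  split; [move: i1|move: i2];
    by apply: (@eq_integrable _ _ _ leb _ (measurable_itv _)) => t _;
      rewrite /comp E.
rewrite -(cint_laplace_invL nu0 nu1 a0 mu s0 sp).
by apply: complex_eq; apply: eq_Rintegral => t _; rewrite E.
Qed.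

Lemma integrable_invLr mu t : leb.-integrable `]0, t[ (EFin \o invLr mu).
Proof.
have [t0|t0] := leP t 0.
  by rewrite set_itv_ge ?bnd_simp -?leNgt//; exact: integrable_set0.
apply: (@integrableS _ _ _ leb `[0, t]%classic) => //.
  by move=> x /=; rewrite !in_itv/= => /andP[x0 xt]; rewrite !ltW.
apply: continuous_compact_integrable; first exact: segment_compact.
by apply: continuous_subspaceT => x; exact: invLr_continuous.
Qed.

Lemma Rintegral_invLr mu t : 0 < t ->
  \int[leb]_(u in `]0, t[) invLr mu u = invLr (mu + 1) t.
Proof.
move=> t0.
rewrite Rintegral_itv_bndo_bndc//; last exact: integrable_invLr.
rewrite Rintegral_itv_obnd_cbnd//; last first.
  apply: (@integrableS _ _ _ leb `]0, (t + 1)[%classic) => //; last exact: integrable_invLr.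
  by move=> x /=; rewrite !in_itv/= => /andP[x0 xt]; lra.
rewrite (@Rintegral_ftc _ (invLr (mu + 1)))//.
- by rewrite (@invLr_le0 _ 0)// subr0.
- by move=> x _; rewrite -[in invLr mu x](addrK 1 mu); exact: rderive_invLr.
- by move=> x _; exact: invLr_continuous.
Qed.

Lemma RLintegrable_invLr b mu t : 0 < b -> RLintegrable b (invLr mu) t.
Proof.
move=> b0; right.
have [M M0 hM] := invL_bound nu0 nu1 a0 mu ltr01.
have i := integrableZR (measurable_itv _) M (integrable_RL_kernel t b0 ltr01).
apply: (@integrableS _ _ _ leb `]-oo, t[%classic) => //.
  by move=> x /=; rewrite !in_itv/= => /andP[].
apply: (@le_integrableR _ _ _ (fun x => M * ((t - x) `^ (b - 1) * expR (1 * x))) _ _ _ i) => //.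
- apply: measurable_funTS; apply: measurable_funM.
    apply: (measurableT_comp (measurable_powR _)); exact: measurable_funB.
  by apply: continuous_measurable_fun => x; exact: invLr_continuous.
- move=> x _; rewrite normrM ger0_norm ?powR_ge0//.
  rewrite mulrCA ler_wpM2l ?powR_ge0//.
  by have := hM x; rewrite (invLrE _ _ ltr01) cmod_real mul1r.
Qed.

(** [cint_RL_invL] integrates from -oo, and [invLr_le0] cuts the range down to []0, t[]. *)
Lemma RLint_invLr b mu t : 0 < b -> 0 < t ->
  RLint b (invLr mu) t = invLr (mu + b) t.
Proof.
move=> b0 t0; rewrite /RLint gt_eqF//.
apply: (mulfI (x := Gamma b)); first by rewrite gt_eqF// Gamma_gt0.
rewrite mulVKf ?gt_eqF ?Gamma_gt0//.
have := cint_RL_invL nu0 nu1 a0 mu t b0 ltr01.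
move=> /(congr1 (@complex.Re R)); rewrite Re_realM => <-.
rewrite (_ : `]0, t[%classic = `]-oo, t[%classic `&` `]0, +oo[%classic); last first.
  apply/seteqP; split => x /=; rewrite !in_itv/= ?andbT; first by case/andP.
  by move=> [-> ->].
rewrite Rintegral_mkcondr; apply: eq_Rintegral => x _.
rewrite patchE; case: ifPn => [_|]; first by rewrite Re_realM.
move=> xn; have x0 : x <= 0.
  by move: xn; rewrite notin_setE/= in_itv/= andbT => /negP; rewrite -leNgt.
by rewrite Re_realM -/(invLr mu x) (invLr_le0 mu x0) mulr0.
Qed.

Lemma inverse_laplace_invLr c mu : 0 <= c -> inverse_laplace c (F mu) (invLr mu).
Proof.
move=> c0; split => [t _|s cs]; first exact: invLr_continuous.
by apply: laplace_invLr; exact: le_lt_trans cs.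
Qed.

Lemma invLr_equations mu (C : Prop) (y : R -> R) :
  (forall t, 0 < t -> y t = invLr mu t) ->
  [/\ y t @[t --> 0^'+] --> 0,
      forall t, 0 < t ->
        [/\ leb.-integrable `]0, t[ (EFin \o y), RLintegrable (1 - nu) y t &
            a * nu * RLint (1 - nu) y t =
            t * y t - mu * \int[leb]_(tau in `]0, t[) y tau] &
      C -> forall t, 0 < t ->
        [/\ derivable y t 1, RLderivable nu y t, caputo_derivable nu y t,
            a * nu * RLderiv nu y t = a * nu * caputo nu y t &
            a * nu * caputo nu y t = t * derive1 y t + (1 - mu) * y t]].
Proof.
move=> E; have nu1' : 0 < 1 - nu by rewrite subr_gt0.
apply: (fractional_equations nu0 (ltW nu1) E (yr := invLr (mu + (1 - nu)))
  (y' := invLr (mu - 1)) (yr' := invLr (mu + (1 - nu) - 1))).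
- apply: cvg_at_right_filter; rewrite -[X in _ --> X](invLr_le0 mu (lexx 0)).
  exact: invLr_continuous.
- move=> t t0; split; [exact: integrable_invLr|exact: RLintegrable_invLr|exact: RLint_invLr|].
  by rewrite Rintegral_invLr// invLr_mulX addrA; ring.
- move=> _ t t0; split.
  + exact: rderive_invLr.
  + exact: rderive_invLr.
  + exact: RLintegrable_invLr.
  + by rewrite RLint_invLr// addrAC.
  (* The product formula at [mu - 1], whereas the integral equation used it at [mu]. *)
  + by rewrite invLr_mulX subrK (_ : mu + (1 - nu) - 1 = mu - nu); ring.
Qed.

End inverse_laplace_real.

(** * Uniqueness of inverse Laplace transforms *)

Section weierstrass.
Context (R : realType).
Implicit Types (f g h : R -> R) (n : nat) (s x : R).

(* [(bernstein n g s).[x]] is the mean of [g (s + N)] for a binomial variable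
   [N] with parameters [n] and [x]. *)
Fixpoint bernstein n g s : {poly R} :=
  if n is m.+1 then 'X * bernstein m g (s + 1) + (1 - 'X) * bernstein m g s
  else (g s)%:P.

Lemma bernsteinS n g s x : (bernstein n.+1 g s).[x] =
  x * (bernstein n g (s + 1)).[x] + (1 - x) * (bernstein n g s).[x].
Proof. by rewrite /= !hornerE. Qed.

Lemma le_bernstein n g h s x : 0 <= x <= 1 ->
  (forall u, s <= u <= s + n%:R -> g u <= h u) ->
  (bernstein n g s).[x] <= (bernstein n h s).[x].
Proof.
move=> /andP[x0 x1]; have x1' : 0 <= 1 - x by rewrite subr_ge0.
elim: n s => [|n IH] s gh; first by rewrite /= !hornerE gh// addr0 lexx.
have n0 : 0 <= n%:R :> R by [].
rewrite -natr1 in gh; rewrite !bernsteinS lerD// ler_wpM2l// IH// => u /andP[u1 u2];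
  by rewrite gh//; apply/andP; split; lra.
Qed.

(** The mean s + n x and the variance n x (1 - x) of the shifted binomial law. *)
Lemma bernstein_sqr n (A B C : R) s x :
  (bernstein n (fun u => A + B * (u - C) ^+ 2) s).[x] =
  A + B * ((s + n%:R * x - C) ^+ 2 + n%:R * (x * (1 - x))).
Proof.
elim: n s => [|n IH] s; first by rewrite /= !hornerE; ring.
by rewrite bernsteinS !IH -natr1; ring.
Qed.

Lemma uniformly_continuous01 f (e : R) : continuous f -> 0 < e ->
  exists2 d : R, 0 < d & forall x y, 0 <= x <= 1 -> `|x - y| < d -> `|f x - f y| < e.
Proof.
move=> cf e0.
have e20 : 0 < e / 2 by rewrite divr_gt0.
have /compact_near_coveringP/(_ R (0:R)^'+
  (fun d x => forall y, `|x - y| < d -> `|f x - f y| < e)) :=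
  @segment_compact R 0 1.
case=> [x _|d /= d0 hd].
- have /cvgrPdist_lt/(_ _ e20)/nbhs_ballP[d /= d0 hd] := cf x.
  have d20 : 0 < d / 2 by rewrite divr_gt0.
  exists (ball x (d / 2), [set d' | d' < d / 2]) => /=.
    by split; [exact: nbhsx_ballx|exact: nbhs_right_lt].
  move=> [z d'] /= [+ hd'] y zy; rewrite /ball/= => xz.
  have {}zy := lt_trans zy hd'.
  have h1 : `|f x - f z| < e / 2 by apply: hd; rewrite /ball/=; lra.
  have h2 : `|f x - f y| < e / 2.
    by apply: hd; rewrite /ball/= (splitr d) -(subrK z x) -addrA (le_lt_trans (ler_normD _ _))// ltrD.
  rewrite (splitr e) -(subrK (f x) (f z)) -addrA (le_lt_trans (ler_normD _ _))// ltrD//.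
  by rewrite distrC.
- exists (d / 2); first by rewrite divr_gt0.
  move=> x y x01; apply: (hd (d / 2)) => //=.
  + by rewrite sub0r normrN gtr0_norm ?divr_gt0//; lra.
  + by rewrite divr_gt0.
Qed.

Lemma continuous_bounded01 f : continuous f ->
  exists2 M : R, 0 <= M & forall x, 0 <= x <= 1 -> `|f x| <= M.
Proof.
move=> cf.
have [c _ h] := @EVT_max R (fun x => `|f x|) 0 1 ler01 (continuous_subspaceT (fun x => cvg_norm (cf x))).
by exists `|f c| => // x x01; apply: h; rewrite in_itv.
Qed.

(** Chebyshev's argument with a quadratic majorant: |f x - f y| <= e / 2 + K (x - y)^2, by uniform
    continuity when |x - y| < d and by the bound 2 M otherwise. Taking binomial means leaves e / 2 +
    K x (1 - x) / N. *)
Theorem weierstrass f (e : R) : continuous f -> 0 < e ->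
  exists p : {poly R}, forall x, 0 <= x <= 1 -> `|f x - p.[x]| <= e.
Proof.
move=> cf e0; have e20 : 0 < e / 2 by rewrite divr_gt0.
have [d d0 hd] := uniformly_continuous01 cf e20.
have [M M0 hM] := continuous_bounded01 cf.
pose K := 2 * M / d ^+ 2.
have K0 : 0 <= K by apply: divr_ge0; [exact: mulr_ge0|exact: sqr_ge0].
have hK (x y : R) : 0 <= x <= 1 -> 0 <= y <= 1 -> `|f x - f y| <= e / 2 + K * (x - y) ^+ 2.
  move=> x01 y01; have [xy|xy] := ltP `|x - y| d.
    by rewrite (le_trans (ltW (hd _ _ x01 xy)))// lerDl mulr_ge0// sqr_ge0.
  rewrite (@le_trans _ _ (2 * M))//.
    by rewrite (le_trans (ler_normB _ _))// mulr2n mulrDl !mul1r lerD// hM.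
  have d1 : 1 <= (x - y) ^+ 2 / d ^+ 2.
    rewrite ler_pdivlMr ?exprn_gt0// mul1r -[leRHS]real_normK ?num_real//.
    by rewrite lerXn2r// ?nnegrE ltW.
  have M2 : 0 <= 2 * M by exact: mulr_ge0.
  have -> : K * (x - y) ^+ 2 = 2 * M * ((x - y) ^+ 2 / d ^+ 2) by rewrite /K; ring.
  have := ler_wpM2l M2 d1; rewrite mulr1; lra.
pose N := (Num.truncn (K / (e / 2))).+1.
have N0 : 0 < N%:R :> R by rewrite ltr0n.
have KN : K / N%:R <= e / 2.
  by rewrite ler_pdivrMr// mulrC -ler_pdivrMr// ltW// truncnS_gt.
pose g (u : R) := f (u / N%:R); exists (bernstein N g 0) => x x01.
have [x0 x1] := andP x01.
have B : K / N%:R ^+ 2 * ((0 + N%:R * x - N%:R * x) ^+ 2 + N%:R * (x * (1 - x))) <= e / 2.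
  rewrite add0r subrr expr0n add0r /=.
  rewrite (_ : _ * _ = K / N%:R * (x * (1 - x))); last by field; rewrite gt_eqF.
  rewrite (le_trans _ KN)// ler_piMr//; first by rewrite divr_ge0// ltW.
  by rewrite mulr_ile1//; lra.
have U (u : R) : 0 <= u <= 0 + N%:R -> `|f x - g u| <= e / 2 + K / N%:R ^+ 2 * (u - N%:R * x) ^+ 2.
  move=> /andP[u0 uN]; rewrite /g.
  have u01 : 0 <= u / N%:R <= 1 by rewrite divr_ge0 ?(ltW N0)//= ler_pdivrMr// mul1r -[leRHS]add0r.
  apply: (le_trans (hK _ _ x01 u01)); rewrite lerD2l.
  by rewrite le_eqVlt; apply/orP; left; apply/eqP; field; rewrite gt_eqF.
have h1 : (bernstein N g 0).[x] <=
    (bernstein N (fun u => (f x + e / 2) + K / N%:R ^+ 2 * (u - N%:R * x) ^+ 2) 0).[x].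
  apply: le_bernstein => // u /U; move: (K / _ * _) => k; rewrite ler_norml; lra.
have h2 : (bernstein N (fun u => (f x - e / 2) + - (K / N%:R ^+ 2) * (u - N%:R * x) ^+ 2) 0).[x] <=
    (bernstein N g 0).[x].
  apply: le_bernstein => // u /U; rewrite mulNr; move: (K / _ * _) => k; rewrite ler_norml; lra.
move: h1 h2 B; rewrite !bernstein_sqr mulNr ler_norml => *.
by apply/andP; split; lra.
Qed.

End weierstrass.

(** * Lerch's theorem for continuous functions *)

Section lerch.
Context (R : realType).
Implicit Types (y f : R -> R) (c s t : R).

Lemma Rintegral_pos (F : R -> R) t0 : 0 < t0 -> (forall t, 0 < t -> 0 <= F t) ->
  {for t0, continuous F} -> 0 < F t0 ->
  leb.-integrable `]0, +oo[ (EFin \o F) -> 0 < \int[leb]_(t in `]0, +oo[) F t.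
Proof.
move=> t00 F0 cF Ft i.
have e0 : 0 < F t0 / 2 by rewrite divr_gt0.
have /cvgrPdist_lt/(_ _ e0)/nbhs_ballP[d /= d0 hd] := cF.
pose u := t0 + d / 2.
have sub : `[t0, u]%classic `<=` (`]0, +oo[%classic : set R).
  by move=> x /=; rewrite !in_itv/= andbT => /andP[+ _]; exact: lt_le_trans.
have i12 : leb.-integrable `[t0, u] (EFin \o F).
  exact: (@integrableS _ _ _ leb `]0, +oo[%classic).
have tu : t0 < u by rewrite /u ltrDl divr_gt0.
rewrite (@lt_le_trans _ _ (F t0 / 2 * (u - t0)))//.
  by rewrite mulr_gt0// subr_gt0.
rewrite (@le_trans _ _ (\int[leb]_(t in `[t0, u]) F t))//.
  rewrite (@le_trans _ _ (\int[leb]_(t in `[t0, u]) (F t0 / 2 : R)))//.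
    by rewrite Rintegral_cst//= lebesgue_measure_itv/= lte_fin tu.
  apply: (@le_Rintegral _ _ _ leb `[t0, u]%classic) => //.
    apply: measurable_bounded_integrable => //.
      by rewrite /= lebesgue_measure_itv/= lte_fin tu ltry.
    by exists `|F t0 / 2|; split; [exact: num_real|move=> y cy t _ /=; exact: ltW].
  move=> t /=; rewrite in_itv/= => /andP[t1 t2].
  have := hd t; rewrite /ball/= => /(_ _)/ltW.
  have tn : `|t0 - t| < d by rewrite distrC ger0_norm ?subr_ge0//; move: t2; rewrite /u; lra.
  by move=> /(_ tn); rewrite ler_norml => /andP[_]; lra.
rewrite /Rintegral fine_le//; [exact: integrable_fin_num i12|exact: integrable_fin_num i|].
apply: ge0_subset_integral => //=.
  by have /integrableP[] := i.
by move=> t; rewrite in_itv/= andbT => tp; rewrite lee_fin F0.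
Qed.

Lemma horner_Rintegral0 (g : R -> R) (p : {poly R}) :
  (forall k : nat, leb.-integrable `]0, +oo[ (EFin \o (fun t : R => expR (- t) ^+ k * g t)) /\
     \int[leb]_(t in `]0, +oo[) (expR (- t) ^+ k * g t) = 0) ->
  leb.-integrable `]0, +oo[ (EFin \o (fun t : R => p.[expR (- t)] * g t)) /\
  \int[leb]_(t in `]0, +oo[) (p.[expR (- t)] * g t) = 0.
Proof.
move=> H.
rewrite (_ : (fun t : R => _) =
  fun t : R => (\sum_(i < size p) p`_i * expR (- t) ^+ i) * g t); last first.
  by apply/funext => t; rewrite horner_coef.
elim: (size p) => [|n [IHi IH]].
  have E : (fun t => (\sum_(i < 0) p`_i * expR (- t) ^+ i) * g t) = fun t => 0 * (expR (- t) ^+ 0 * g t).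
    by apply/funext => t; rewrite big_ord0 !mul0r.
  have [i0 e0] := H 0%N.
  by rewrite E (@RintegralZl _ _ _ leb)// mul0r; split=> //; exact: integrableZR.
have [i1 e1] := H n.
have E : (fun t => (\sum_(i < n.+1) p`_i * expR (- t) ^+ i) * g t) =
   fun t => (\sum_(i < n) p`_i * expR (- t) ^+ i) * g t + p`_n * (expR (- t) ^+ n * g t).
  by apply/funext => t; rewrite big_ord_recr/= mulrDl mulrA.
have i2 := integrableZR (measurable_itv _) p`_n i1.
rewrite E (@RintegralD _ _ _ leb)// IH (@RintegralZl _ _ _ leb)// e1 mulr0 addr0.
by split => //; exact: integrableDR.
Qed.

(* If [y t0 > 0], integrate [y] against a bump at [t0] which is a function of
   [e^-t], hence a uniform limit of polynomials in [e^-t]. *)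
Lemma lerch_le y c t0 : 0 < t0 -> {for t0, continuous y} ->
  (forall s, c < s ->
     leb.-integrable `]0, +oo[ (EFin \o (fun t : R => expR (- (s * t)) * y t)) /\
     \int[leb]_(t in `]0, +oo[) (expR (- (s * t)) * y t) = 0) ->
  y t0 <= 0.
Proof.
move=> t00 cy H; rewrite leNgt; apply/negP => yt0.
(* The shift by c + 1 brings all the exponents s = c + 1 + k with k >= 0 into the range s > c: the
   moments of [g] against powers of e^(-t) vanish, the zeroth included. *)
pose g t := expR (- ((c + 1) * t)) * y t.
have Hg (k : nat) : leb.-integrable `]0, +oo[ (EFin \o (fun t : R => expR (- t) ^+ k * g t)) /\
     \int[leb]_(t in `]0, +oo[) (expR (- t) ^+ k * g t) = 0.
  have cs : c < c + 1 + k%:R by rewrite -addrA ltrDl ltr_wpDr.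
  have := H _ cs.
  rewrite (_ : (fun t : R => _) = (fun t : R => expR (- t) ^+ k * g t))//.
  apply/funext => t; rewrite /g mulrA; congr (_ * _).
  by rewrite -expRM_natl -expRD; congr expR; ring.
have ig : leb.-integrable `]0, +oo[ (EFin \o g).
  have [+ _] := Hg 0%N; apply: (@eq_integrable _ _ _ leb _ (measurable_itv _)) => t _.
  by rewrite /= expr0 mul1r.
have me : measurable_fun setT (fun t : R => expR (- t)).
  by apply: measurableT_comp => //; exact: measurable_funN.
have e01 t : 0 < t -> 0 <= expR (- t) <= 1.
  by move=> tp; rewrite expR_ge0/= -[leRHS]expR0 ler_expR oppr_le0 ltW.
have int f : continuous f ->
    leb.-integrable `]0, +oo[ (EFin \o (fun t : R => f (expR (- t)) * g t)).
  move=> cf; have [M M0 hM] := continuous_bounded01 cf.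
  have ig' := integrableZR (measurable_itv _) M (integrable_norm ig).
  apply: (le_integrableR _ _ _ ig') => //.
    apply: measurable_funM; last by apply/measurable_EFinP; case/integrableP: ig.
    apply: measurable_funTS; apply: measurableT_comp => //.
    exact: continuous_measurable_fun.
  move=> t /=; rewrite in_itv/= andbT => tp.
  by rewrite normrM ler_wpM2r// hM// e01.
have zero f : continuous f -> \int[leb]_(t in `]0, +oo[) (f (expR (- t)) * g t) = 0.
  move=> cf; apply/eqP; rewrite -normr_le0; apply/ler_addgt0Pl => e e0.
  pose G := \int[leb]_(t in `]0, +oo[) `|g t|.
  have G0 : 0 <= G by apply: Rintegral_ge0.
  have [p hp] := weierstrass cf (divr_gt0 e0 (ltr_wpDl G0 ltr01)).
  have [ip zp] := horner_Rintegral0 p Hg.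
  have ifp := integrableBR (measurable_itv _) (int _ cf) ip.
  have := @RintegralB _ _ _ leb _ _ _ (measurable_itv _) (int _ cf) ip.
  rewrite zp subr0 addr0 => <-.
  rewrite (le_trans (le_normr_Rintegral _ ifp))//.
  rewrite (@le_trans _ _ (\int[leb]_(t in `]0, +oo[) (e / (G + 1) * `|g t|)))//.
    apply: (@le_Rintegral _ _ _ leb) => //.
    - exact: integrable_norm ifp.
    - apply: integrableZR => //; exact: integrable_norm.
    - move=> t; rewrite /= in_itv/= andbT => tp.
      by rewrite -mulrBl normrM ler_wpM2r// hp// e01.
  rewrite (@RintegralZl _ _ _ leb)//; last exact: integrable_norm.
  rewrite -/G mulrAC ler_pdivrMr ?ltr_wpDl// ler_pM2l//; lra.
have [d d0 hd] : exists2 d : R, 0 < d & forall t, 0 < t ->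
    `|expR (- t) - expR (- t0)| < d -> 0 < y t.
  have /cvgrPdist_lt/(_ _ yt0)/nbhs_ballP[r /= r0 hr] := cy.
  (* The smaller of the distances from e^(-t0) to the images of t0 + r and t0 - r; the exponential
     being monotone, closeness of images forces |t - t0| < r. *)
  exists (Num.min (expR (- t0) - expR (- (t0 + r))) (expR (- (t0 - r)) - expR (- t0))).
    by rewrite lt_min !subr_gt0 !ltr_expR !ltrN2; apply/andP; split; lra.
  move=> t tp; rewrite lt_min => /andP[h1 h2].
  have tr : `|t0 - t| < r.
    rewrite ltr_norml; apply/andP; split.
    - have : expR (- (t0 + r)) < expR (- t) by move: h1; rewrite ltr_norml; lra.
      by rewrite ltr_expR; lra.
    - have : expR (- t) < expR (- (t0 - r)) by move: h2; rewrite ltr_norml; lra.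
      by rewrite ltr_expR; lra.
  by have := hr t; rewrite /ball/= => /(_ tr); rewrite ltr_norml; lra.
(* A tent of height [d] at e^(-t0), zero wherever the sign of [y] is not controlled. *)
pose f x := Num.max 0 (d - `|x - expR (- t0)|).
have cf : continuous f.
  move=> x; apply: (@continuous_max _ _ (fun=> 0) (fun x => d - `|x - expR (- t0)|)).
    exact: cst_continuous.
  apply: continuousB; first exact: cst_continuous.
  apply: (@continuous_comp _ _ _ (fun x => x - expR (- t0)) (fun x => `|x|)).
    exact: (rderive_continuous (rderiveD (rderive_id x) (rderive_cst _ x))).
  exact: norm_continuous.
suff : 0 < \int[leb]_(t in `]0, +oo[) (f (expR (- t)) * g t) by rewrite zero// ltxx.
have ce : {for t0, continuous (fun t : R => expR (- t))}.
  by apply: (@rderive_continuous _ _ _ (expR (- t0) * - 1)); rder.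
apply: (@Rintegral_pos _ t0) => //; last exact: int.
- move=> t tp; rewrite /f /Num.max; case: ifPn => h; last by rewrite mul0r.
  rewrite subr_gt0 in h.
  by rewrite mulr_ge0 ?subr_ge0 ?(ltW h)// mulr_ge0 ?expR_ge0// ltW// (hd _ tp h).
- apply: continuousM.
    by apply: (@continuous_comp _ _ _ (fun t : R => expR (- t)) f) => //; exact: cf.
  apply: continuousM => //; apply: (@rderive_continuous _ _ _ (expR (- ((c + 1) * t0)) * - (c + 1))).
  by apply: rderive_eq; [rder|rewrite /=; ring].
- by rewrite /f subrr normr0 subr0 /Num.max d0 mulr_gt0// mulr_gt0// expR_gt0.
Qed.

Lemma lerch y c : (forall t, 0 < t -> {for t, continuous y}) ->
  (forall s, c < s ->
     leb.-integrable `]0, +oo[ (EFin \o (fun t : R => expR (- (s * t)) * y t)) /\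
     \int[leb]_(t in `]0, +oo[) (expR (- (s * t)) * y t) = 0) ->
  forall t, 0 < t -> y t = 0.
Proof.
move=> cy H t t0; apply/le_anti/andP; split; first exact: lerch_le (cy _ t0) H.
rewrite -oppr_le0; apply: (@lerch_le (fun t => - y t) c _ t0).
  by apply: continuousN; exact: cy.
move=> s cs; have [i e] := H _ cs.
rewrite (_ : (fun t : R => _) = (fun t : R => -1 * (expR (- (s * t)) * y t))); last first.
  by apply/funext => u; ring.
by split; [exact: integrableZR|rewrite (@RintegralZl _ _ _ leb)// e mulr0].
Qed.

End lerch.

(** * Test functions, and distributions vanishing on exponentials *)

Section test_functions.
Context (R : realType).
Implicit Types (phi psi : R -> R) (d : nat -> R -> R) (c s t x : R).
Implicit Types (T : (R -> R) -> R) (p : nat -> R).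

(** Iterated derivatives are supplied as a sequence, each term the derivative of the previous one,
    so that explicit formulas can stand for [derive1n]. *)
Lemma derive1n_seq d : (forall n t, rderive (d n) t (d n.+1 t)) ->
  forall n, derive1n n (d 0%N) = d n.
Proof.
move=> hd; elim=> [//|n IH].
by rewrite derive1nS IH; apply/funext => t; exact: rderive1.
Qed.

Lemma smooth_seq d : (forall n t, rderive (d n) t (d n.+1 t)) -> smooth (d 0%N).
Proof. by move=> hd n t; rewrite derive1n_seq//; case: (hd n t). Qed.

Lemma smooth_rderive phi n t : smooth phi ->
  rderive (derive1n n phi) t (derive1n n.+1 phi t).
Proof. by move=> /(_ n t) h; rewrite derive1nS derive1E; exact: DeriveDef. Qed.

Lemma test_function_seq c eta d : (forall n t, rderive (d n) t (d n.+1 t)) ->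
  c < eta ->
  (forall n, exists M, forall t, 0 <= t -> expR (eta * t) * `|d n t| <= M) ->
  test_function c (d 0%N).
Proof.
move=> hd ce H; split; first exact: smooth_seq.
exists eta => // n; have [M hM] := H n; exists M => t t0.
by rewrite derive1n_seq// hM.
Qed.

Lemma derive1n_lin (k : R) phi psi n : smooth phi -> smooth psi ->
  derive1n n (fun t => k * phi t + psi t) =
  fun t => k * derive1n n phi t + derive1n n psi t.
Proof.
move=> s1 s2; apply: (@derive1n_seq (fun n t => k * derive1n n phi t + derive1n n psi t)).
move=> m t; apply: rderive_eq.
  exact: rderiveD (rderiveM (rderive_cst k t) (smooth_rderive m t s1)) (smooth_rderive m t s2).
by rewrite mulr0 addr0.
Qed.

Lemma test_function_lin c (k : R) phi psi :
  test_function c phi -> test_function c psi ->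
  test_function c (fun t => k * phi t + psi t).
Proof.
move=> [s1 [e1 ce1 H1]] [s2 [e2 ce2 H2]].
have D := derive1n_lin k _ s1 s2.
split.
  apply: (@smooth_seq (fun n t => k * derive1n n phi t + derive1n n psi t)) => m t.
  apply: rderive_eq.
    exact: rderiveD (rderiveM (rderive_cst k t) (smooth_rderive m t s1)) (smooth_rderive m t s2).
  by rewrite mulr0 addr0.
exists (Num.min e1 e2); first by rewrite lt_min ce1.
move=> n; have [M1 h1] := H1 n; have [M2 h2] := H2 n.
exists (`|k| * M1 + M2) => t t0; rewrite D.
have m1 : Num.min e1 e2 <= e1 by rewrite ge_min lexx.
have m2 : Num.min e1 e2 <= e2 by rewrite ge_min lexx orbT.
have b1 : expR (Num.min e1 e2 * t) <= expR (e1 * t) by rewrite ler_expR ler_wpM2r.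
have b2 : expR (Num.min e1 e2 * t) <= expR (e2 * t) by rewrite ler_expR ler_wpM2r.
rewrite (le_trans (ler_wpM2l (expR_ge0 _) (ler_normD _ _)))// mulrDr lerD//.
  rewrite normrM mulrCA ler_wpM2l// (le_trans _ (h1 _ t0))// ler_wpM2r//.
by rewrite (le_trans _ (h2 _ t0))// ler_wpM2r.
Qed.

(** The index [n] counts derivatives: this is the n-th derivative of the sum of the p_k e^(- (eta +
    k) t), that is, of e^(- eta t) times a polynomial in e^(-t). *)
Definition expsum (N : nat) (p : nat -> R) (eta : R) (n : nat) (t : R) : R :=
  \sum_(k < N) p k * (- (eta + k%:R)) ^+ n * expR (- ((eta + k%:R) * t)).

Lemma rderive_expsum N p eta n t :
  rderive (expsum N p eta n) t (expsum N p eta n.+1 t).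
Proof.
elim: N => [|N IH].
  have -> : expsum 0 p eta n = fun=> 0 by apply/funext => x; rewrite /expsum big_ord0.
  by rewrite /expsum big_ord0; exact: rderive_cst.
have -> : expsum N.+1 p eta n = fun t => expsum N p eta n t +
    p N * (- (eta + N%:R)) ^+ n * expR (- ((eta + N%:R) * t)).
  by apply/funext => x; rewrite /expsum big_ord_recr.
apply: rderive_eq; first by apply: rderiveD IH _; rder.
by rewrite [RHS]/expsum big_ord_recr/= exprS; congr (_ + _); ring.
Qed.

Lemma expsum_bound N p eta n t : 0 <= t ->
  expR (eta * t) * `|expsum N p eta n t| <= \sum_(k < N) `|p k * (- (eta + k%:R)) ^+ n|.
Proof.
move=> t0; rewrite (le_trans (ler_wpM2l (expR_ge0 _) (ler_norm_sum _ _ _)))//.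
rewrite mulr_sumr ler_sum// => k _; rewrite normrM [`|expR _|]ger0_norm ?expR_ge0//.
rewrite mulrCA ler_piMr// -expRD -[leRHS]expR0 ler_expR.
by rewrite mulrDl opprD addrA subrr add0r oppr_le0 mulr_ge0.
Qed.

Lemma test_function_expsum N p c eta : c < eta -> test_function c (expsum N p eta 0).
Proof.
move=> ce; apply: test_function_seq ce _; first exact: rderive_expsum.
by move=> n; eexists; exact: expsum_bound.
Qed.

Lemma rderive_le0_decr (f : R -> R) (f' : R -> R) (x y : R) : x <= y ->
  (forall z, x <= z <= y -> rderive f z (f' z)) ->
  (forall z, x <= z <= y -> f' z <= 0) -> f y <= f x.
Proof.
move=> xy df f0.
have [z] : exists2 z, z \in `[x, y] & f y - f x = f' z * (y - x).
  apply: (@MVT_segment _ f f') => //.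
    by move=> z; rewrite in_itv/= => /andP[h1 h2]; apply: df; rewrite !ltW.
  apply: continuous_in_subspaceT => z; rewrite inE/= in_itv/= => zxy.
  exact: rderive_continuous (df _ zxy).
rewrite in_itv/= => zxy E; rewrite -subr_le0 E mulr_le0_ge0 ?subr_ge0//.
exact: f0.
Qed.

(* Integrate [u'] from infinity. *)
Lemma le_exp_of_derive (u u' : R -> R) (e K eta : R) : 0 < eta -> 0 <= e ->
  (forall t, rderive u t (u' t)) ->
  (forall t, 0 <= t -> `|u t| <= K * expR (- (eta * t))) ->
  (forall t, 0 <= t -> `|u' t| <= e * expR (- (eta * t))) ->
  forall t, 0 <= t -> `|u t| <= e / eta * expR (- (eta * t)).
Proof.
move=> eta0 e0 du Hu Hu'.
have side (s : R) t : s = 1 \/ s = -1 -> 0 <= t -> 0 <= s * u t + e / eta * expR (- (eta * t)).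
  move=> s1 t0; have s1' : `|s| = 1 by case: s1 => ->; rewrite ?normrN normr1.
  (* For either sign [s], [v] is nonincreasing on [0, +oo[ and tends to 0 at infinity, hence is
     nonnegative there. *)
  pose v x := s * u x + e / eta * expR (- (eta * x)).
  have dv x : rderive v x (s * u' x - e * expR (- (eta * x))).
    apply: rderive_eq.
      apply: rderiveD; first exact: rderiveM (rderive_cst s x) (du x).
      by apply: rderiveM (rderive_cst _ x) _; rder.
    by rewrite /=; field; rewrite gt_eqF.
  have v0 : v x @[x --> +oo] --> 0.
    have h : (K + e / eta) * expR (- (eta * x)) @[x --> +oo] --> 0.
      by rewrite -(mulr0 (K + e / eta)); apply: cvgM; [exact: cvg_cst|exact: cvgy_expRN].
    apply/norm_cvg0P/(squeeze_cvgr _ (cvg_cst 0) h); exists 0; split; first exact: num_real.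
    move=> x x0; rewrite normr_ge0/= (le_trans (ler_normD _ _))// mulrDl lerD//.
      by rewrite normrM s1' mul1r Hu// ltW.
    by rewrite ger0_norm// mulr_ge0 ?expR_ge0// divr_ge0// ltW.
  rewrite leNgt; apply/negP => vt; have vt' : 0 < - v t by rewrite oppr_gt0.
  have [M [_ hM]] := cvgr0_norm_lt _ v0 _ vt'.
  pose x := Num.max t (M + 1).
  have tx : t <= x by rewrite le_max lexx.
  have Mx : M < x by rewrite lt_max ltrDl ltr01 orbT.
  have vx : v x <= v t.
    apply: (rderive_le0_decr tx (fun z _ => dv z)) => z /andP[tz _].
    rewrite subr_le0 (le_trans (ler_norm _))// normrM s1' mul1r Hu'//.
    exact: le_trans tz.
  by have := hM _ Mx; rewrite ltr_norml; lra.
move=> t t0; have := side 1 t (or_introl erefl) t0; have := side (-1) t (or_intror erefl) t0.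
by rewrite ler_norml mul1r mulN1r => *; apply/andP; split; lra.
Qed.

Lemma distribution_expsum c T N p eta : Defs.distribution c T -> c < eta ->
  (forall s, c < s -> T (fun t => expR (- (s * t))) = 0) ->
  T (expsum N p eta 0) = 0.
Proof.
move=> [lin _] ce H; elim: N => [|N IH].
  have t0 : test_function c (expsum 0 p eta 0) by exact: test_function_expsum.
  have := lin (-1) _ _ t0 t0; rewrite mulN1r addNr => E; rewrite -[RHS]E; congr T.
  by apply/funext => t; rewrite /expsum big_ord0 mulr0 addr0.
have cs : c < eta + N%:R by rewrite ltr_wpDr.
have -> : expsum N.+1 p eta 0 = fun t => p N * expR (- ((eta + N%:R) * t)) + expsum N p eta 0 t.
  by apply/funext => t; rewrite /expsum big_ord_recr/= expr0 mulr1 addrC.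
rewrite lin ?IH ?H ?mulr0 ?addr0//; last exact: test_function_expsum.
have -> : (fun t => expR (- ((eta + N%:R) * t))) = expsum 1 (fun=> 1) (eta + N%:R) 0.
  by apply/funext => t; rewrite /expsum big_ord1 expr0 !mul1r addr0.
exact: test_function_expsum.
Qed.

(** The function e^(eta1 t) psi(t) in the variable x = e^(-t), extended by 0. The gap between [eta1]
    and [eta] leaves a factor x^(eta - eta1), which gives continuity at 0, the image of t = +oo. *)
Lemma continuous_exp_ln (psi : R -> R) (eta1 eta M : R) : continuous psi ->
  eta1 < eta -> (forall t, 0 <= t -> expR (eta * t) * `|psi t| <= M) ->
  continuous (fun x => if 0 < x then expR (eta1 * - ln x) * psi (- ln x) else 0).
Proof.
move=> cpsi ee hM; set h := fun x => _; rewrite /continuous_at => x.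
have [x0|x0|->] := ltgtP (x : R) 0.
- have c0 : {for x, continuous (fun=> 0 : R)} by exact: cst_continuous.
  apply: cvg_trans (_ : (fun=> 0 : R) @ x --> h x); last first.
    by rewrite /h ltNge (ltW x0)/=; exact: c0.
  apply: near_eq_cvg; near=> z; have z0 : z < 0 by near: z; exact: lt_nbhsl.
  by rewrite /h ltNge (ltW z0).
- have ln0 : {for x, continuous (fun x => - ln x)}.
    by apply: (@rderive_continuous _ _ _ (- (x^-1 * 1))); rder.
  have c0 : {for x, continuous (fun x => expR (eta1 * - ln x) * psi (- ln x))}.
    apply: continuousM.
      apply: (@continuous_comp _ _ _ (fun x => - ln x) (fun t => expR (eta1 * t))) => //.
      by apply: (@rderive_continuous _ _ _ (expR (eta1 * - ln x) * eta1)); apply: rderive_eq; [rder|rewrite /=; ring].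
    by apply: (@continuous_comp _ _ _ (fun x => - ln x) psi) => //; exact: cpsi.
  apply: cvg_trans (_ : (fun x => expR (eta1 * - ln x) * psi (- ln x)) @ x --> h x); last first.
    by rewrite /h x0; exact: c0.
  apply: near_eq_cvg; near=> z; have z0 : 0 < z by near: z; exact: near_pos.
  by rewrite /h z0.
- apply/left_right_continuousP; rewrite {2 4}/h ltxx; split.
    apply/cvgrPdist_lt => e e0; near=> z.
    have z0 : z < 0 by near: z; exact: nbhs_left_lt.
    by rewrite /h (lt_gtF z0) subr0 normr0.
  have p0 : M * z `^ (eta - eta1) @[z --> (0:R)^'+] --> 0.
    rewrite -[X in _ --> X](mulr0 M); apply: cvgM; first exact: cvg_cst.
    by apply: powR_cvg0; rewrite subr_gt0.
  apply/norm_cvg0P/(squeeze_cvgr _ (cvg_cst 0) p0); near=> z.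
  have z0 : 0 < z by near: z; exact: nbhs_right_gt.
  have z1 : z <= 1 by near: z; exact: nbhs_right_le.
  have l0 : 0 <= - ln z by rewrite oppr_ge0 ln_le0.
  rewrite normr_ge0/= /h z0 normrM ger0_norm ?expR_ge0//.
  have -> : z `^ (eta - eta1) = expR (- (eta * - ln z)) * expR (eta1 * - ln z).
    by rewrite /powR (gt_eqF z0) -expRD; congr expR; ring.
  rewrite mulrA [leRHS]mulrC ler_wpM2l ?expR_ge0//.
  by rewrite expRN ler_pdivlMr ?expR_gt0// mulrC hM.
Unshelve. all: end_near. Qed.

(** Continuity of [T] involves derivatives up to some order m. An exponential sum is fitted to the
    m-th derivative of [phi]; the lower derivatives are then close as well, each integration from
    infinity costing only a factor 1 / eta1. *)
Theorem distribution_eq0 c T : 0 <= c -> Defs.distribution c T ->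
  (forall s, c < s -> T (fun t => expR (- (s * t))) = 0) ->
  forall phi, test_function c phi -> T phi = 0.
Proof.
move=> c0 dT H phi tphi; have [lin cont] := dT.
have [sphi [eta ceta hphi]] := tphi.
(* Above [c], so that continuity of [T] applies; below [eta], so that the weighted derivative
   vanishes at infinity. *)
pose eta1 := (c + eta) / 2.
have ce1 : c < eta1 by rewrite /eta1; lra.
have e1e : eta1 < eta by rewrite /eta1; lra.
have e10 : 0 < eta1 by exact: le_lt_trans ce1.
have [C [m HC]] := cont _ ce1.
pose K := \sum_(j < m.+1) eta1^-1 ^+ j.
have K0 j : (j <= m)%N -> eta1^-1 ^+ j <= K.
  move=> jm; rewrite /K (bigD1 (Ordinal (jm : (j < m.+1)%N)))//= lerDl sumr_ge0// => i _.
  by rewrite exprn_ge0// invr_ge0 ltW.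
have K1 : 0 <= K by rewrite (le_trans _ (K0 0%N _))// expr0.
apply/eqP; rewrite -normr_le0; apply/ler_addgt0Pl => e e0; rewrite addr0.
pose e' := e / (`|C| * K + 1).
have CK : 0 < `|C| * K + 1 by rewrite ltr_wpDl// mulr_ge0.
have e'0 : 0 < e' by rewrite divr_gt0.
have [Mm hMm] := hphi m.
have cpsi : continuous (derive1n m phi).
  by move=> t; exact: rderive_continuous (smooth_rderive m t sphi).
have [p hp] := weierstrass (continuous_exp_ln cpsi e1e hMm) e'0.
(* Dividing the coefficients undoes m differentiations: the m-th derivative of [q 0] is e^(- eta1 t)
   times the value of [p] at e^(-t). *)
pose q := expsum (size p) (fun k => p`_k / (- (eta1 + k%:R)) ^+ m) eta1.
have hq t : 0 <= t -> `|derive1n m phi t - q m t| <= e' * expR (- (eta1 * t)).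
  move=> t0; have := hp (expR (- t)); rewrite expR_gt0 expRK opprK.
  have -> : 0 <= expR (- t) <= 1.
    by rewrite expR_ge0/= -[leRHS]expR0 ler_expR oppr_le0.
  move=> /(_ isT) h.
  have -> : q m t = expR (- (eta1 * t)) * p.[expR (- t)].
    rewrite horner_coef mulr_sumr; apply: eq_bigr => k _.
    rewrite divfK; last by rewrite expf_neq0// oppr_eq0 gt_eqF// ltr_wpDr.
    by rewrite -expRM_natl mulrCA -expRD; congr (_ * expR _); ring.
  have -> : derive1n m phi t = expR (- (eta1 * t)) * (expR (eta1 * t) * derive1n m phi t).
    by rewrite mulrA -expRD addNr expR0 mul1r.
  by rewrite -mulrBr normrM ger0_norm ?expR_ge0// mulrC ler_wpM2r ?expR_ge0.
have bound j : (j <= m)%N -> forall t, 0 <= t ->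
    `|derive1n (m - j) phi t - q (m - j)%N t| <= e' * eta1^-1 ^+ j * expR (- (eta1 * t)).
  elim: j => [_ t t0|j IH jm]; first by rewrite subn0 expr0 mulr1 hq.
  have {}IH := IH (ltnW jm).
  have [n nE] : exists n, (m - j = n.+1)%N by exists (m - j.+1)%N; rewrite subnSK.
  have n'E : (m - j.+1 = n)%N by rewrite subnS nE.
  rewrite nE in IH; rewrite n'E exprSr mulrA.
  have [Mn hMn] := hphi n.
  apply: (@le_exp_of_derive (fun t => derive1n n phi t - q n t)
    (fun t => derive1n n.+1 phi t - q n.+1 t) _
    (Mn + \sum_(k < size p) `|p`_k / (- (eta1 + k%:R)) ^+ m * (- (eta1 + k%:R)) ^+ n|)) => //.
  + by rewrite mulr_ge0 ?exprn_ge0 ?invr_ge0 ?ltW.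
  + move=> t; apply: rderiveD; first exact: smooth_rderive.
    by apply: rderiveN; exact: rderive_expsum.
  + move=> t t0; rewrite expRN ler_pdivlMr ?expR_gt0// mulrC.
    rewrite (le_trans (ler_wpM2l (expR_ge0 _) (ler_normB _ _)))// mulrDr lerD//.
      by rewrite (le_trans _ (hMn _ t0))// ler_wpM2r// ler_expR ler_wpM2r// (ltW e1e).
    exact: expsum_bound.
have tq : test_function c (q 0%N) by exact: test_function_expsum.
have Tq : T (q 0%N) = 0 by exact: distribution_expsum ce1 H.
have E : T phi = T (fun t => -1 * q 0%N t + phi t).
  by rewrite lin// Tq mulr0 add0r.
have sq : smooth (q 0%N) by case: tq.
rewrite E (le_trans (HC _ (e' * K) (test_function_lin _ tq tphi) _))//.
  move=> n t nm t0; rewrite derive1n_lin// (derive1n_seq (rderive_expsum _ _ _)).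
  have := bound (m - n)%N (leq_subr _ _) t t0; rewrite subKn// => h.
  rewrite mulN1r [- _ + _]addrC (le_trans (ler_wpM2l (expR_ge0 _) h))//.
  rewrite mulrCA -expRD subrr expR0 mulr1 ler_wpM2l ?(ltW e'0)// K0// leq_subr//.
rewrite mulrCA (@le_trans _ _ (e' * (`|C| * K + 1)))//; last by rewrite /e' divfK// gt_eqF.
rewrite ler_wpM2l ?(ltW e'0)// (@le_trans _ _ (`|C| * K))//; last by rewrite lerDl.
by rewrite ler_wpM2r// ler_norm.
Qed.

End test_functions.

Section uniqueness.
Context (R : realType).
Implicit Types (c s t : R) (F : R[i] -> R[i]).

Lemma laplace_kernel_real s t : laplace_kernel s%:C t = (expR (- (s * t)))%:C.
Proof. by rewrite /laplace_kernel -rmorphM -rmorphN cexp_real. Qed.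

Lemma inverse_laplace_unique c F y1 y2 : inverse_laplace c F y1 ->
  inverse_laplace c F y2 -> forall t, 0 < t -> y1 t = y2 t.
Proof.
move=> [cy1 L1] [cy2 L2] t t0; apply/eqP; rewrite -subr_eq0; apply/eqP.
apply: (@lerch _ (fun t => y1 t - y2 t) c) => // [u u0|s cs].
  by apply: continuousB; [exact: cy1|exact: cy2].
have e (y : R -> R) : (fun t : R => Re (laplace_kernel s%:C t) * y t) =
    fun t => expR (- (s * t)) * y t.
  by apply/funext => u; rewrite laplace_kernel_real.
have [[i1 _] l1] := L1 s%:C cs; have [[i2 _] l2] := L2 s%:C cs.
have l : Re (laplace y1 s%:C) = Re (laplace y2 s%:C) by rewrite l1 l2.
rewrite /= !e in i1 i2 l.
rewrite (_ : (fun t : R => _) =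
    fun t => expR (- (s * t)) * y1 t - expR (- (s * t)) * y2 t); last first.
  by apply/funext => u; rewrite mulrBr.
split; first exact: integrableBR.
by rewrite (@RintegralB _ _ _ leb)// l subrr.
Qed.

Lemma inverse_dlaplace_unique c F T1 T2 : 0 <= c -> inverse_dlaplace c F T1 ->
  inverse_dlaplace c F T2 -> forall phi, test_function c phi -> T1 phi = T2 phi.
Proof.
move=> c0 [[lin1 cont1] L1] [[lin2 cont2] L2] phi tphi.
apply/eqP; rewrite -subr_eq0; apply/eqP.
apply: (@distribution_eq0 _ c (fun phi => T1 phi - T2 phi)) => // [|s cs].
  split=> [k f g tf tg|eta ce]; first by rewrite lin1// lin2//; ring.
  have [C1 [m1 H1]] := cont1 _ ce; have [C2 [m2 H2]] := cont2 _ ce.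
  exists (C1 + C2), (maxn m1 m2) => f M tf hM.
  rewrite (le_trans (ler_normB _ _))// mulrDl lerD//.
    by apply: H1 => // n t nm; apply: hM; rewrite (leq_trans nm)// leq_maxl.
  by apply: H2 => // n t nm; apply: hM; rewrite (leq_trans nm)// leq_maxr.
have -> : (fun t => expR (- (s * t))) = (fun t => Re (laplace_kernel s%:C t)).
  by apply/funext => t; rewrite laplace_kernel_real.
have := congr1 (@complex.Re R) (L1 s%:C cs).
by rewrite -(L2 s%:C cs) /= => ->; rewrite subrr.
Qed.

End uniqueness.

(** * The case nu = 1 *)

Lemma Rintegral_extend0 (R : realType) (D E : set R) (f g : R -> R) :
  measurable D -> measurable E -> E `<=` D -> (forall x, E x -> f x = g x) ->
  (forall x, D x -> ~ E x -> f x = 0) -> leb.-integrable E (EFin \o g) ->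
  leb.-integrable D (EFin \o f) /\
  \int[leb]_(x in D) f x = \int[leb]_(x in E) g x.
Proof.
move=> mD mE ED fg f0 ig.
have patch x : D x -> (g \_ E) x = f x.
  move=> Dx; rewrite patchE; case: ifPn => [|xE].
    by rewrite inE => Ex; rewrite fg.
  by rewrite f0//; rewrite notin_setE in xE.
have DE : E = D `&` E by apply/seteqP; split => x; [split => //; exact: ED|case].
split.
  apply/(@integrable_mkcond _ _ _ leb D (EFin \o f) mD).
  move/(@integrable_mkcond _ _ _ leb E (EFin \o g) mE): ig.
  apply: (@eq_integrable _ _ _ leb _ measurableT) => x _.
  rewrite !patchE; have [xD|xD] := boolP (x \in D).
    by rewrite inE in xD; rewrite /= -(patch _ xD) patchE; case: ifP.
  case: ifPn => // /[!inE]/ED Dx; by rewrite notin_setE in xD.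
rewrite DE Rintegral_mkcondr; apply: eq_Rintegral => x; rewrite inE => Dx.
by rewrite patch.
Qed.

(** * Truncated powers *)

Section truncated_power.
Context (R : realType) (a : R).
Implicit Types (b t : R) (s : R[i]).

(** The power (t - a)_+^b, with value 0 at [a] also for b = 0. The test discards the conventional
    values of powers of negative numbers. *)
Definition tpow b t : R := if a < t then (t - a) `^ b else 0.

Lemma tpow_le b t : t <= a -> tpow b t = 0.
Proof. by move=> ta; rewrite /tpow ltNge ta. Qed.

Lemma tpow_gt b t : a < t -> tpow b t = (t - a) `^ b.
Proof. by move=> ta; rewrite /tpow ta. Qed.

Lemma tpowS b t : (t - a) * tpow b t = tpow (b + 1) t.
Proof.
have [ta|ta] := leP t a; first by rewrite !tpow_le// mulr0.
have ta0 : 0 < t - a by rewrite subr_gt0.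
rewrite !tpow_gt// powRD; last by rewrite (gt_eqF ta0) implybT.
by rewrite powRr1 ?ltW// mulrC.
Qed.

Lemma rderive_tpow_lt b t : t < a -> rderive (tpow b) t 0.
Proof.
move=> ta; apply: rderive_near (rderive_cst 0 t).
near=> u; rewrite tpow_le//; apply/ltW; near: u; exact: lt_nbhsl.
Unshelve. all: end_near. Qed.

Lemma rderive_tpow_gt b t : a < t -> rderive (tpow b) t (b * tpow (b - 1) t).
Proof.
move=> ta; have ta0 : 0 < t - a by rewrite subr_gt0.
have d : rderive (fun u => (u - a) `^ b) t (b * tpow (b - 1) t).
  apply: rderive_eq; first by rder.
  by rewrite tpow_gt//= addr0 mulr1.
apply: rderive_near d.
near=> u; rewrite tpow_gt//; near: u; exact: lt_nbhsr.
Unshelve. all: end_near. Qed.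

Lemma tpow_continuous b t : 0 < b -> {for t, continuous (tpow b)}.
Proof.
move=> b0; have [ta|ta|->] := ltgtP t a.
- exact: rderive_continuous (rderive_tpow_lt b ta).
- exact: rderive_continuous (rderive_tpow_gt b ta).
apply/left_right_continuousP; rewrite tpow_le//; split.
  apply/cvgrPdist_lt => e e0; near=> u.
  rewrite tpow_le ?subrr ?normr0//; apply/ltW; near: u; exact: nbhs_left_lt.
have h : (u - a) `^ b @[u --> a^'+] --> 0.
  apply/cvgrPdist_lt => e e0; have /cvgrPdist_lt/(_ _ e0)[d /= d0 hd] := @powR_cvg0 R b b0.
  exists d => // u /=; rewrite distrC => ud ua; apply: hd; last by rewrite subr_gt0.
  by rewrite /= sub0r normrN.
apply: (cvg_trans _ h); apply: near_eq_cvg; near=> u.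
by rewrite tpow_gt//; near: u; exact: nbhs_right_gt.
Unshelve. all: end_near. Qed.

(** The delicate point is [a], where the difference quotient is itself [tpow (b - 1)], which tends
    to 0 because b > 1. *)
Lemma rderive_tpow b t : 1 < b -> rderive (tpow b) t (b * tpow (b - 1) t).
Proof.
move=> b1; have [ta|ta|->] := ltgtP t a.
- by rewrite [tpow (b - 1) t]tpow_le ?ltW// mulr0; exact: rderive_tpow_lt.
- exact: rderive_tpow_gt.
rewrite [tpow (b - 1) a]tpow_le// mulr0.
have b10 : 0 < b - 1 by rewrite subr_gt0.
have H : h^-1 *: ((tpow b \o shift a) (h *: (1 : R)) - tpow b a) @[h --> (0:R)^'] --> (0:R).
  have c : tpow (b - 1) (h + a) @[h --> (0:R)^'] --> (0:R).
    have c : {for 0, continuous (fun h => tpow (b - 1) (h + a))}.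
      apply: (@continuous_comp _ _ _ (fun h => h + a) (tpow (b - 1))).
        exact: (rderive_continuous (rderiveD (rderive_id 0) (rderive_cst a 0))).
      exact: tpow_continuous.
    have {}c : tpow (b - 1) (h + a) @[h --> (0:R)] --> tpow (b - 1) (0 + a) := c.
    by apply: cvg_within_filter; rewrite add0r [tpow _ a]tpow_le// in c.
  apply: (cvg_trans _ c); apply: near_eq_cvg; near=> h.
  have h0 : h != 0 by near: h; exact: nbhs_dnbhs_neq.
  rewrite /= [tpow b a]tpow_le// subr0 [h *: 1]mulr1 -[b in RHS](subrK 1 b).
  by rewrite -tpowS addrK [RHS]mulKf.
split; first by apply/cvg_ex; exists 0.
exact/cvg_lim.
Unshelve. all: end_near. Qed.

Lemma integrable_shifted_powR_expR b (x : R) : 0 < b -> 0 < x ->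
  leb.-integrable `]a, +oo[ (EFin \o (fun t => (t - a) `^ (b - 1) * expR (- (x * t)))).
Proof.
move=> b0 x0; have b1 : -1 < b - 1 by lra.
have i := @integrableZR _ _ (measurable_itv _) (expR (- (x * a))) _ (integrable_powR_expR b1 x0).
have mphi : measurable_fun setT (fun t : R => t + - a) by exact: measurable_funD.
have := integrable_mp mphi (@pushforward_leb_shift _ (- a)) (measurable_itv _) i.
rewrite (_ : (fun t : R => t + - a) @^-1` `]0, +oo[ = `]a, +oo[%classic); last first.
  by apply/seteqP; split => t /=; rewrite !in_itv/= ?andbT subr_gt0.
apply: (@eq_integrable _ _ _ leb _ (measurable_itv _)) => u _ /=; congr EFin.
rewrite mulrCA -expRD; congr (_ * expR _); ring.
Qed.

Lemma cmeas_shifted_power b s :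
  cmeas setT (fun t : R => ((t - a) `^ (b - 1))%:C * laplace_kernel s t).
Proof.
apply: cmeasM; last exact: cmeas_laplace_kernel.
by apply: cmeas_real; apply: (measurableT_comp (measurable_powR _)); exact: measurable_funB.
Qed.

Lemma cinteg_shifted_power b s : 0 < b -> 0 < Re s ->
  cinteg `]a, +oo[ (fun t : R => ((t - a) `^ (b - 1))%:C * laplace_kernel s t).
Proof.
move=> b0 s0; apply: cinteg_le (integrable_shifted_powR_expR b0 s0) => //.
  by apply: cmeasS => //; exact: cmeas_shifted_power.
by move=> t _; rewrite cmodM cmod_real ger0_norm ?powR_ge0// cmod_laplace_kernel.
Qed.

Lemma cint_shifted_power b s : 0 < b -> 0 < Re s ->
  cint `]a, +oo[ (fun t : R => ((t - a) `^ (b - 1))%:C * laplace_kernel s t) =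
  (Gamma b)%:C * Rsymbol b 1 a s.
Proof.
move=> b0 s0; rewrite (cint_shift a (measurable_itv _)); last first.
  by apply: cmeasS => //; exact: cmeas_shifted_power.
rewrite (_ : [set x | _] = `]0, +oo[%classic); last first.
  by apply/seteqP; split => x /=; rewrite !in_itv/= ?andbT; lra.
rewrite (@eq_cint _ _ _ (fun u => cexp (- (a%:C * s)) *
   ((u `^ (b - 1))%:C * laplace_kernel s u))); last first.
  move=> u _; rewrite addrK mulrCA !laplace_kernelE -cexpD; congr (_ * cexp _).
  by rewrite rmorphD; ring.
rewrite cintZ//; last exact: cinteg_gamma.
have := gamma_intE b0 s0; rewrite /gamma_int => ->.
by rewrite /Rsymbol cpow1//; ring.
Qed.

Hypothesis a0 : 0 < a.

Lemma laplace_tpow b s : 0 < b -> 0 < Re s ->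
  laplace_integrable (fun t => (Gamma b)^-1 * tpow (b - 1) t) s /\
  laplace (fun t => (Gamma b)^-1 * tpow (b - 1) t) s = Rsymbol b 1 a s.
Proof.
move=> b0 s0; have G0 := Gamma_gt0 b0.
have [i1 i2] := cinteg_shifted_power b0 s0.
have E := cint_shifted_power b0 s0.
have sub : `]a, +oo[%classic `<=` (`]0, +oo[%classic : set R).
  by move=> t /=; rewrite !in_itv/= !andbT; exact: lt_trans.
have K (k : R -> R) : leb.-integrable `]a, +oo[ (EFin \o (fun t => (t - a) `^ (b - 1) * k t)) ->
    leb.-integrable `]0, +oo[ (EFin \o (fun t => k t * ((Gamma b)^-1 * tpow (b - 1) t))) /\
    \int[leb]_(t in `]0, +oo[) (k t * ((Gamma b)^-1 * tpow (b - 1) t)) =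
    (Gamma b)^-1 * \int[leb]_(t in `]a, +oo[) ((t - a) `^ (b - 1) * k t).
  move=> i; rewrite -(@RintegralZl _ _ _ leb)//.
  apply: Rintegral_extend0 => //.
  - by move=> x /=; rewrite in_itv/= andbT => ax; rewrite tpow_gt//; ring.
  - move=> x _ /=; rewrite in_itv/= andbT => /negP; rewrite -leNgt => xa.
    by rewrite tpow_le// !mulr0.
  - exact: integrableZR.
have e1 : (fun x : R => Re (((x - a) `^ (b - 1))%:C * laplace_kernel s x)) =
          fun x : R => (x - a) `^ (b - 1) * Re (laplace_kernel s x).
  by apply/funext => x; rewrite Re_realM.
have e2 : (fun x : R => Im (((x - a) `^ (b - 1))%:C * laplace_kernel s x)) =
          fun x : R => (x - a) `^ (b - 1) * Im (laplace_kernel s x).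
  by apply/funext => x; rewrite Im_realM.
rewrite e1 in i1; rewrite e2 in i2.
have [j1 E1] := K _ i1; have [j2 E2] := K _ i2.
split; first by split.
have G1 : (Gamma b)%:C != 0 :> R[i] by rewrite eq_complex /= eqxx andbT gt_eqF.
apply: (mulfI G1); rewrite -E; apply: complex_eq.
  by rewrite Re_realM /= E1 mulVKf ?gt_eqF//; congr Rintegral; rewrite e1.
by rewrite Im_realM /= E2 mulVKf ?gt_eqF//; congr Rintegral; rewrite e2.
Qed.

Lemma Rintegral_tpow b t : 0 < b -> 0 < t ->
  leb.-integrable `]0, t[ (EFin \o tpow b) /\
  (b + 1) * \int[leb]_(u in `]0, t[) tpow b u = tpow (b + 1) t.
Proof.
move=> b0 t0.
have ic x : leb.-integrable `[0, x] (EFin \o tpow b).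
  apply: continuous_compact_integrable; first exact: segment_compact.
  by apply: continuous_subspaceT => u; exact: tpow_continuous.
have io x : leb.-integrable `]0, x] (EFin \o tpow b).
  apply: (@integrableS _ _ _ leb `[0, x]%classic) => //.
  by move=> u /=; rewrite !in_itv/= => /andP[u0 ->]; rewrite ltW.
have ioo : leb.-integrable `]0, t[ (EFin \o tpow b).
  apply: (@integrableS _ _ _ leb `[0, t]%classic) => //.
  by move=> u /=; rewrite !in_itv/= => /andP[u0 ut]; rewrite !ltW.
split => //; rewrite Rintegral_itv_bndo_bndc// Rintegral_itv_obnd_cbnd//.
have b1 : 0 < b + 1 by exact: addr_gt0.
rewrite (@Rintegral_ftc _ (fun u => (b + 1)^-1 * tpow (b + 1) u))//.
- by rewrite (@tpow_le _ 0) ?ltW// mulr0 subr0 mulVKf ?gt_eqF.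
- move=> x _; apply: rderive_eq.
    by apply: rderiveM (rderive_cst _ x) (rderive_tpow x _); rewrite ltrDr.
  by rewrite mulr0 addr0 addrK mulKf ?gt_eqF.
- by move=> x _; exact: tpow_continuous.
Qed.

(** The fractional integral of order 1 - nu is now the identity, and the equations reduce to (t - a)
    (t - a)_+^b = (t - a)_+^(b + 1). At t = a the function (t - a)_+^(mu - 1) is continuous for mu >
    1 and differentiable for mu > 2, whence the two thresholds. *)
Lemma tpow_equations mu (y : R -> R) : 1 < mu ->
  (forall t, 0 < t -> y t = (Gamma mu)^-1 * tpow (mu - 1) t) ->
  [/\ y t @[t --> 0^'+] --> 0,
      forall t, 0 < t ->
        [/\ leb.-integrable `]0, t[ (EFin \o y), RLintegrable (1 - 1) y t &
            a * 1 * RLint (1 - 1) y t =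
            t * y t - mu * \int[leb]_(tau in `]0, t[) y tau] &
      2 < mu -> forall t, 0 < t ->
        [/\ derivable y t 1, RLderivable 1 y t, caputo_derivable 1 y t,
            a * 1 * RLderiv 1 y t = a * 1 * caputo 1 y t &
            a * 1 * caputo 1 y t = t * derive1 y t + (1 - mu) * y t]].
Proof.
move=> mu1 E; set G := (Gamma mu)^-1.
pose y0 t := G * tpow (mu - 1) t; pose y' t := G * ((mu - 1) * tpow (mu - 1 - 1) t).
have m10 : 0 < mu - 1 by rewrite subr_gt0.
apply: (fractional_equations ltr01 (lexx 1) E (yr := y0) (y' := y') (yr' := y')).
- have c : {for 0, continuous y0}.
    by apply: continuousM; [exact: cst_continuous|exact: tpow_continuous].
  have {}c : y0 t @[t --> (0:R)] --> y0 0 := c.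
  by apply: cvg_at_right_filter; rewrite [y0 0]/y0 tpow_le ?ltW// mulr0 in c.
- move=> t t0; have [i I] := Rintegral_tpow m10 t0; rewrite subrK in I.
  split; [exact: integrableZR|by left; rewrite subrr|by rewrite /RLint subrr eqxx|].
  rewrite (@RintegralZl _ _ _ leb)// [mu * _]mulrCA I /y0 -/G.
  by have := tpowS (mu - 1) t; rewrite subrK => <-; ring.
- move=> mu2 t t0; have d : rderive y0 t (y' t).
    apply: rderive_eq.
      by apply: rderiveM (rderive_cst _ t) (rderive_tpow t _); lra.
    by rewrite mulr0 addr0.
  split => //; [by left; rewrite subrr|by rewrite /RLint subrr eqxx|].
  have := tpowS (mu - 1 - 1) t; rewrite subrK /y' /y0.
  move: (tpow _ t) (tpow _ t) => A B AB.
  rewrite -/G -AB; ring.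
Qed.

End truncated_power.

(** * Operations on test functions *)

Section test_function_operations.
Context (R : realType).
Implicit Types (phi g : R -> R) (c eta M t x : R).

Lemma integrable_tail_expRN x eta : 0 < eta ->
  leb.-integrable `]x, +oo[ (EFin \o (fun t => expR (- (eta * t)))).
Proof.
move=> e0; have := integrable_shifted_powR_expR x ltr01 e0.
apply: (@eq_integrable _ _ _ leb _ (measurable_itv _)) => t _ /=.
by rewrite subrr powRr0 mul1r.
Qed.

(** Test functions are controlled only for t >= 0; compactness extends the exponential bound to [[x,
    +oo[] for negative [x]. *)
Lemma tail_bound eta g M : continuous g ->
  (forall t, 0 <= t -> expR (eta * t) * `|g t| <= M) ->
  forall x, exists M', forall t, x <= t -> `|g t| <= M' * expR (- (eta * t)).
Proof.
move=> cg hM x.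
have ce (t : R) : {for t, continuous (fun t => expR (eta * t) * `|g t|)}.
  apply: continuousM.
    apply: (@rderive_continuous _ _ _ (expR (eta * t) * eta)).
    by apply: rderive_eq; [rder|rewrite /=; ring].
  by apply: cvg_norm; exact: cg.
have xx : - `|x| <= 0 by rewrite oppr_le0.
have [z _ hz] := EVT_max xx (continuous_subspaceT ce).
exists (Num.max M (expR (eta * z) * `|g z|)) => t xt.
rewrite expRN ler_pdivlMr ?expR_gt0// mulrC le_max.
have [t0|t0] := leP 0 t; first by rewrite hM.
rewrite hz ?orbT// in_itv/= (ltW t0) andbT (le_trans _ xt)//.
by rewrite lerNl -normrN ler_norm.
Qed.

Lemma tail_integrable eta g M : 0 < eta -> continuous g ->
  (forall t, 0 <= t -> expR (eta * t) * `|g t| <= M) ->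
  forall x, leb.-integrable `]x, +oo[ (EFin \o g).
Proof.
move=> e0 cg hM x; have [M' hM'] := tail_bound cg hM x.
have i := integrableZR (measurable_itv _) M' (integrable_tail_expRN x e0).
apply: (le_integrableR _ _ _ i) => //.
  by apply: measurable_funTS; exact: continuous_measurable_fun.
by move=> t; rewrite /= in_itv/= andbT => /ltW; exact: hM'.
Qed.

Lemma tail_cvgy eta g M : 0 < eta ->
  (forall t, 0 <= t -> expR (eta * t) * `|g t| <= M) -> g t @[t --> +oo] --> 0.
Proof.
move=> e0 hM.
have h : M * expR (- (eta * t)) @[t --> +oo] --> 0.
  by rewrite -[X in _ --> X](mulr0 M); apply: cvgM; [exact: cvg_cst|exact: cvgy_expRN].
apply/norm_cvg0P/(squeeze_cvgr _ (cvg_cst 0) h); exists 0; split; first exact: num_real.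
move=> t /ltW t0; rewrite normr_ge0/= expRN ler_pdivlMr ?expR_gt0// mulrC.
exact: hM.
Qed.

Lemma smooth_continuous phi n : smooth phi -> continuous (derive1n n phi).
Proof. by move=> s t; exact: rderive_continuous (smooth_rderive n t s). Qed.

Lemma test_function_derive c phi : test_function c phi -> test_function c (derive1 phi).
Proof.
move=> [s [eta ce H]].
apply: (test_function_seq (d := fun n => derive1n n.+1 phi)) ce _ => [n t|n].
  exact: smooth_rderive.
exact: H.
Qed.

Lemma test_function_mulX c phi : test_function c phi ->
  test_function c (fun t => t * phi t).
Proof.
move=> [s [eta ce H]].
(* Leibniz' rule; at n = 0 the truncated index [n.-1] is multiplied by 0. *)
pose d n t := t * derive1n n phi t + n%:R * derive1n n.-1 phi t.
have d0 : d 0%N = fun t => t * phi t by apply/funext => t; rewrite /d mul0r addr0.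
(* Part of the exponential decay is spent on the factor t. *)
pose e := (c + eta) / 2; have ce' : c < e by rewrite /e; lra.
have ee : e < eta by rewrite /e; lra.
rewrite -d0; apply: test_function_seq ce' _ => [n t|n].
  apply: rderive_eq.
    apply: rderiveD; first exact: rderiveM (rderive_id t) (smooth_rderive n t s).
    exact: rderiveM (rderive_cst _ t) (smooth_rderive n.-1 t s).
  by rewrite /d; case: n => [|n] /=; rewrite -?natr1; ring.
have [M1 h1] := H n; have [M2 h2] := H n.-1.
exists ((eta - e)^-1 * M1 + n%:R * M2) => t t0.
have e1 : expR (e * t) <= expR (eta * t) by rewrite ler_expR ler_wpM2r// ltW.
have e2 : expR (e * t) * t <= (eta - e)^-1 * expR (eta * t).
  have -> : eta * t = e * t + (eta - e) * t by ring.
  rewrite expRD mulrCA ler_wpM2l ?expR_ge0// ler_pdivlMl ?subr_gt0//.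
  by rewrite (le_trans _ (expR_ge1Dx _))// lerDr.
rewrite (le_trans (ler_wpM2l (expR_ge0 _) (ler_normD _ _)))// mulrDr lerD//.
  rewrite normrM (ger0_norm t0) mulrA (le_trans (ler_wpM2r (normr_ge0 _) e2))//.
  by rewrite -mulrA ler_wpM2l ?h1// invr_ge0 subr_ge0 ltW.
rewrite normrM ger0_norm// mulrCA ler_wpM2l// (le_trans _ (h2 _ t0))//.
by rewrite ler_wpM2r.
Qed.

Definition tail_int phi t : R := \int[leb]_(u in `]t, +oo[) phi u.

Lemma tail_int_shift phi t : continuous phi ->
  tail_int phi t = \int[leb]_(u in `]0, +oo[) phi (t + u).
Proof.
move=> cphi.
have mphi : measurable_fun setT (fun u : R => u + t) by exact: measurable_funD.
rewrite /tail_int (Rintegral_mp mphi (@pushforward_leb_shift _ t))//; last first.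
  by apply: measurable_funTS; exact: continuous_measurable_fun.
rewrite (_ : (fun u : R => u + t) @^-1` `]t, +oo[ = `]0, +oo[%classic).
  by apply: eq_Rintegral => u _; rewrite addrC.
by apply/seteqP; split => u /=; rewrite !in_itv/= ?andbT ltrDr.
Qed.

Lemma tail_int_derive eta phi M t : 0 < eta ->
  (forall t, rderive phi t (derive1 phi t)) -> continuous (derive1 phi) ->
  (forall t, 0 <= t -> expR (eta * t) * `|derive1 phi t| <= M) ->
  phi t @[t --> +oo] --> 0 -> tail_int (derive1 phi) t = - phi t.
Proof.
move=> e0 dphi cphi hM phi0; rewrite /tail_int -[RHS]sub0r.
apply: (@Rintegraly_ftc _ phi).
- by move=> x _; exact: dphi.
- by move=> x _; exact: cphi.
- exact: tail_integrable e0 cphi hM t.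
- by apply: cvg_at_right_filter; exact: rderive_continuous (dphi t).
- exact: phi0.
Qed.

Lemma integrable_translate eta g M t : 0 < eta -> continuous g ->
  (forall t, 0 <= t -> expR (eta * t) * `|g t| <= M) ->
  leb.-integrable `]0, +oo[ (EFin \o (fun u => g (t + u))).
Proof.
move=> e0 cg hM; have i := tail_integrable e0 cg hM t.
have mphi : measurable_fun setT (fun u : R => u + t) by exact: measurable_funD.
have := integrable_mp mphi (@pushforward_leb_shift _ t) (measurable_itv _) i.
rewrite (_ : (fun u : R => u + t) @^-1` `]t, +oo[ = `]0, +oo[%classic); last first.
  by apply/seteqP; split => u /=; rewrite !in_itv/= ?andbT ltrDr.
by apply: (@eq_integrable _ _ _ leb _ (measurable_itv _)) => u _ /=; rewrite addrC.
Qed.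

(** A translation fixes the domain of integration, so one differentiates under the integral; the
    integral of phi' over the tail is then - phi t. *)
Lemma rderive_tail_int c phi t : 0 <= c -> test_function c phi ->
  rderive (tail_int phi) t (- phi t).
Proof.
move=> c0 [s [eta ce H]]; have e0 : 0 < eta by exact: le_lt_trans ce.
have [M0 h0] := H 0%N; have [M1 h1] := H 1%N.
have c1 : continuous phi by exact: (@smooth_continuous phi 0).
have c2 : continuous (derive1 phi) by exact: (@smooth_continuous phi 1).
have d1 u : rderive phi u (derive1 phi u) by exact: (@smooth_rderive _ phi 0).
rewrite -(tail_int_derive t e0 d1 c2 h1 (tail_cvgy e0 h0)) tail_int_shift//.
rewrite (_ : tail_int phi = fun t => \int[leb]_(u in `]0, +oo[) phi (t + u)); last first.
  by apply/funext => x; exact: tail_int_shift.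
have [M' hM'] := tail_bound c2 h1 (t - 1).
have M'0 : 0 <= M'.
  have := hM' t; rewrite gerBl => /(_ ler01) h.
  by have := le_trans (normr_ge0 _) h; rewrite pmulr_lge0 ?expR_gt0.
apply: (@rderive_Rintegral _ _ (fun x u => phi (x + u)) (fun x u => derive1 phi (x + u))
   (fun u => M' * expR (- (eta * (t - 1))) * expR (- (eta * u))) _ (t - 1) (t + 1)) => //.
- by apply/andP; split; lra.
- by move=> x _; exact: integrable_translate h0.
- move=> x u _ _; apply: rderive_eq.
    by apply: rderive_comp (d1 _) _; exact: rderiveD (rderive_id x) (rderive_cst u x).
  by rewrite addr0 mulr1.
- by apply: integrableZR => //; exact: integrable_tail_expRN.
- move=> x u /andP[x1 _]; rewrite /= in_itv/= andbT => u0.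
  rewrite -mulrA -expRD -opprD -mulrDr; apply: (le_trans (hM' _ _)); first by lra.
  apply: (ler_wpM2l M'0); rewrite ler_expR lerN2; apply: (ler_wpM2l (ltW e0)); lra.
Qed.

Lemma test_function_tail_int c phi : 0 <= c -> test_function c phi ->
  test_function c (tail_int phi).
Proof.
move=> c0 tphi; have [s [eta ce H]] := tphi.
have e0 : 0 < eta by exact: le_lt_trans ce.
apply: (test_function_seq
  (d := fun n => if n is m.+1 then fun t => - derive1n m phi t else tail_int phi)) ce _.
  move=> [|n] t; first exact: rderive_tail_int c0 tphi.
  by apply: rderiveN; exact: smooth_rderive.
have cphi : continuous phi by exact: (@smooth_continuous phi 0).
move=> [|n]; last by have [M hM] := H n; exists M => t t0; rewrite normrN hM.
have [M hM] := H 0%N.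
exists (M * \int[leb]_(u in `]0, +oo[) expR (- (eta * u))) => t t0.
rewrite tail_int_shift//.
have i := integrable_translate t e0 cphi hM.
have j := integrable_tail_expRN 0 e0.
have ni : leb.-integrable `]0, +oo[ (EFin \o (fun u => `|phi (t + u)|)) := integrable_norm i.
rewrite (le_trans (ler_wpM2l (expR_ge0 _) (le_normr_Rintegral _ i)))//.
rewrite -(@RintegralZl _ _ _ leb)//.
rewrite -(@RintegralZl _ _ _ leb)//.
apply: (@le_Rintegral _ _ _ leb) => //.
- exact: integrableZR.
- exact: integrableZR.
- move=> u; rewrite /= in_itv/= andbT => u0.
  have tu : 0 <= t + u by rewrite addr_ge0// ltW.
  rewrite [leRHS]mulrC expRN ler_pdivlMl ?expR_gt0// mulrA -expRD.
  by rewrite -mulrDr [u + t]addrC hM.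
Qed.

End test_function_operations.

Section compactly_supported.
Context (R : realType).
Implicit Types (phi : R -> R) (c u v t : R).

Lemma derive1n_vanish phi u v n : (forall t, ~~ (u <= t <= v) -> phi t = 0) ->
  forall t, ~~ (u <= t <= v) -> derive1n n phi t = 0.
Proof.
move=> phi0; elim: n => [//|n IH] t tuv.
rewrite derive1nS; apply: rderive1; apply: rderive_near (rderive_cst 0 t).
move: tuv; rewrite negb_and -!ltNge => /orP[tu|vt].
  near=> x; rewrite IH// negb_and -ltNge; apply/orP; left.
  by near: x; exact: lt_nbhsl.
near=> x; rewrite IH// negb_and -!ltNge; apply/orP; right.
by near: x; exact: lt_nbhsr.
Unshelve. all: end_near. Qed.

Lemma test_function_compact c phi u v : smooth phi ->
  (forall t, ~~ (u <= t <= v) -> phi t = 0) -> test_function c phi.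
Proof.
move=> s phi0; split => //; exists (c + 1); first by rewrite ltrDl.
move=> n; have vv : 0 <= `|v| by [].
have ce (t : R) : {for t, continuous (fun t => expR ((c + 1) * t) * `|derive1n n phi t|)}.
  apply: continuousM.
    apply: (@rderive_continuous _ _ _ (expR ((c + 1) * t) * (c + 1))).
    by apply: rderive_eq; [rder|rewrite /=; ring].
  by apply: cvg_norm; exact: (smooth_continuous s).
have [z _ hz] := EVT_max vv (continuous_subspaceT ce).
exists (expR ((c + 1) * z) * `|derive1n n phi z|) => t t0.
have [tv|tv] := leP t v.
  by rewrite hz// in_itv/= t0 (le_trans tv)// ler_norm.
have -> : derive1n n phi t = 0.
  by apply: (derive1n_vanish n phi0); rewrite negb_and -!ltNge tv orbT.
by rewrite normr0 mulr0 mulr_ge0// expR_ge0.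
Qed.

End compactly_supported.

(** * The inverse transform as a distribution at nu = 1 *)

Section delta_power.
Context (R : realType) (a mu b : R).
Hypotheses (a0 : 0 < a) (mu0 : 0 <= mu) (bE : b - 1 = mu).
Implicit Types (phi g : R -> R) (T : (R -> R) -> R) (c eta M t : R) (s : R[i]).

Let b0 : 0 < b. Proof. by rewrite -(subrK 1 b) bE ltr_wpDl. Qed.

(** The distributional derivative of (t - a)_+^mu / Gamma(mu + 1), a function for every mu >= 0; at
    mu = 0 it is the Dirac delta at [a]. The exponent mu + 1 is a variable [b] with [bE], to match
    the lemmas on powers b - 1. *)
Definition powT phi : R :=
  - (Gamma b)^-1 * \int[leb]_(t in `]a, +oo[) ((t - a) `^ mu * derive1 phi t).

Lemma integrable_powT_bound (p eta : R) : 0 <= p -> 0 < eta ->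
  leb.-integrable `]a, +oo[ (EFin \o (fun t => (t - a) `^ p * expR (- (eta * t)))).
Proof.
move=> p0 e0; have p1 : 0 < p + 1 by lra.
by have := integrable_shifted_powR_expR a p1 e0; rewrite addrK.
Qed.

Lemma integrable_powT (p eta : R) g M : 0 <= p -> 0 < eta -> continuous g ->
  (forall t, 0 <= t -> expR (eta * t) * `|g t| <= M) ->
  leb.-integrable `]a, +oo[ (EFin \o (fun t => (t - a) `^ p * g t)).
Proof.
move=> p0 e0 cg hM.
have i := integrableZR (measurable_itv _) M (integrable_powT_bound p0 e0).
apply: (le_integrableR _ _ _ i) => //.
  apply: measurable_funTS; apply: measurable_funM; last exact: continuous_measurable_fun.
  by apply: (measurableT_comp (measurable_powR _)); exact: measurable_funB.
move=> t; rewrite /= in_itv/= andbT => ta.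
rewrite normrM ger0_norm ?powR_ge0// mulrCA ler_wpM2l ?powR_ge0//.
rewrite expRN ler_pdivlMr ?expR_gt0// mulrC hM//.
by apply/ltW; exact: lt_trans ta.
Qed.

Lemma powT_integrable c n phi : 0 <= c -> test_function c phi ->
  leb.-integrable `]a, +oo[ (EFin \o (fun t => (t - a) `^ mu * derive1n n phi t)).
Proof.
move=> c0 [s [eta ce /(_ n)[M hM]]].
by apply: (integrable_powT mu0 (le_lt_trans c0 ce) _ hM); exact: smooth_continuous.
Qed.

Lemma powT_lin c (k : R) phi psi : 0 <= c -> test_function c phi ->
  test_function c psi ->
  powT (fun t => k * phi t + psi t) = k * powT phi + powT psi.
Proof.
move=> c0 t1 t2.
have i1 := powT_integrable 1 c0 t1; have i2 := powT_integrable 1 c0 t2.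
have D := derive1n_lin k 1 t1.1 t2.1.
rewrite /powT; set I1 := \int[leb]_(t in _) (_ * derive1 phi t).
set I2 := \int[leb]_(t in _) (_ * derive1 psi t).
suff -> : \int[leb]_(t in `]a, +oo[) ((t - a) `^ mu * derive1 (fun t => k * phi t + psi t) t) =
   k * I1 + I2 by ring.
rewrite -(@RintegralZl _ _ _ leb)// -(@RintegralD _ _ _ leb)//; last exact: integrableZR.
apply: eq_Rintegral => t _; rewrite [derive1 _ t](congr1 (@^~ t) D) /=; ring.
Qed.

Lemma distribution_powT c : 0 <= c -> Defs.distribution c powT.
Proof.
move=> c0; split; first by move=> k phi psi; exact: powT_lin.
move=> eta ce; have e0 : 0 < eta by exact: le_lt_trans ce.
have i := integrable_powT_bound mu0 e0.
exists ((Gamma b)^-1 * \int[leb]_(t in `]a, +oo[) ((t - a) `^ mu * expR (- (eta * t)))), 1%N.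
move=> phi M tphi hM; have i1 := powT_integrable 1 c0 tphi.
have ni : leb.-integrable `]a, +oo[ (EFin \o (fun t => `|(t - a) `^ mu * derive1n 1 phi t|))
  := integrable_norm i1.
have G0 := Gamma_gt0 b0.
rewrite -mulrA /powT normrM normrN [`|_^-1|]ger0_norm ?invr_ge0 ?(ltW G0)//.
rewrite ler_wpM2l ?invr_ge0 ?(ltW G0)// (le_trans (le_normr_Rintegral _ i1))//.
rewrite mulrC -(@RintegralZl _ _ _ leb)//.
apply: (@le_Rintegral _ _ _ leb) => //; first exact: integrableZR.
move=> t; rewrite /= in_itv/= andbT => ta.
rewrite normrM ger0_norm ?powR_ge0// mulrCA ler_wpM2l ?powR_ge0//.
rewrite expRN ler_pdivlMr ?expR_gt0// mulrC; apply: (hM 1%N) => //.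
by apply/ltW; exact: lt_trans ta.
Qed.

Lemma dlaplace_powT s : 0 < Re s -> dlaplace powT s = Rsymbol mu 1 a s.
Proof.
move=> s0; have G0 := Gamma_gt0 b0.
have G1 : (Gamma b)%:C != 0 :> R[i] by rewrite eq_complex /= eqxx andbT gt_eqF.
have E := cint_shifted_power a b0 s0; rewrite bE in E.
have i := cinteg_shifted_power a b0 s0; rewrite bE in i.
have mE : Rsymbol mu 1 a s = s * Rsymbol b 1 a s by rewrite Rsymbol_mulz// bE.
have e t : ((t - a) `^ mu)%:C * (- s * laplace_kernel s t) =
   - s * (((t - a) `^ mu)%:C * laplace_kernel s t) by ring.
have E2 : cint `]a, +oo[ (fun t => ((t - a) `^ mu)%:C * (- s * laplace_kernel s t)) =
    - s * ((Gamma b)%:C * Rsymbol b 1 a s).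
  by rewrite -E -cintZ//; apply: eq_cint.
have -> : dlaplace powT s = (- (Gamma b)^-1)%:C *
    cint `]a, +oo[ (fun t => ((t - a) `^ mu)%:C * (- s * laplace_kernel s t)).
  apply: complex_eq; [rewrite Re_realM|rewrite Im_realM]; rewrite /dlaplace /powT /cint /=;
    congr (_ * _); apply: eq_Rintegral => t _.
    rewrite Re_realM; congr (_ * _).
    by apply: rderive1; have [] := cderive_laplace_kernel s t.
  rewrite Im_realM; congr (_ * _).
  by apply: rderive1; have [] := cderive_laplace_kernel s t.
rewrite E2 mE rmorphN mulNr mulNr mulrN opprK mulrCA; congr (_ * _).
by rewrite mulrA -rmorphM mulVf ?gt_eqF// mul1r.
Qed.

(** After expanding the derivatives of t phi and of the tail integral, the two sides differ by a
    multiple of the integral over []a, +oo[] of the derivative of (t - a)^(mu + 1) phi, which is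
    0. *)
Lemma powT_equation c phi : 0 <= c -> test_function c phi ->
  a * powT phi = powT (fun t => t * phi t) - mu * powT (tail_int phi).
Proof.
move=> c0 tphi.
have [s [eta ce H]] := tphi; have e0 : 0 < eta by exact: le_lt_trans ce.
have [M0 h0] := H 0%N; have [M1 h1] := H 1%N.
have cphi : continuous phi by exact: (@smooth_continuous _ phi 0).
have cphi' : continuous (derive1 phi) by exact: (@smooth_continuous _ phi 1).
have dphi t : rderive phi t (derive1 phi t) by exact: (@smooth_rderive _ phi 0).
have i0 := powT_integrable 0 c0 tphi.
have i1 := powT_integrable 1 c0 tphi.
have mu1 : 0 <= mu + 1 by exact: addr_ge0.
have j1 := integrable_powT mu1 e0 cphi' h1.
have E t : a < t -> (t - a) `^ (mu + 1) = (t - a) `^ mu * (t - a).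
  move=> ta; have ta0 : 0 < t - a by rewrite subr_gt0.
  by rewrite powRD ?powRr1 ?ltW// (gt_eqF ta0) implybT.
pose f t := (mu + 1) * ((t - a) `^ mu * phi t) + (t - a) `^ (mu + 1) * derive1 phi t.
have Z : \int[leb]_(t in `]a, +oo[) f t = 0 - 0.
  apply: (@Rintegraly_ftc _ (fun t => (t - a) `^ (mu + 1) * phi t)).
  - move=> t ta; have ta0 : 0 < t - a by rewrite subr_gt0.
    apply: rderive_eq; first by apply: rderiveM (dphi t); rder.
    by rewrite /f /= addrK; ring.
  - move=> t ta; have ta0 : 0 < t - a by rewrite subr_gt0.
    have cp p : {for t, continuous (fun t => (t - a) `^ p)}.
      by apply: (@rderive_continuous _ _ _ (p * (t - a) `^ (p - 1) * (1 + 0))); rder.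
    apply: continuousD; last by apply: continuousM => //; exact: cphi'.
    apply: continuousM; first exact: cst_continuous.
    by apply: continuousM => //; exact: cphi.
  - by apply: integrableDR => //; exact: integrableZR.
  - have p0 : 0 < mu + 1 by rewrite ltr_wpDl.
    have k : {for a, continuous (fun t => tpow a (mu + 1) t * phi t)}.
      by apply: continuousM; [exact: tpow_continuous|exact: cphi].
    have {}k : tpow a (mu + 1) t * phi t @[t --> a] --> tpow a (mu + 1) a * phi a := k.
    rewrite tpow_le// mul0r in k.
    apply: (cvg_trans _ (cvg_at_right_filter k)); apply: near_eq_cvg; near=> t.
    by rewrite tpow_gt//; near: t; exact: nbhs_right_gt.
  - have e20 : 0 < eta / 2 by rewrite divr_gt0.
    have [C C0 hC] := powR_expR_bounded mu1 e20.
    have h : C * M0 * expR (- (eta / 2 * t)) @[t --> +oo] --> 0.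
      by rewrite -[X in _ --> X](mulr0 (C * M0)); apply: cvgM; [exact: cvg_cst|exact: cvgy_expRN].
    apply/norm_cvg0P/(squeeze_cvgr _ (cvg_cst 0) h); exists a; split; first exact: num_real.
    move=> t ta; have ta0 : 0 <= t - a by rewrite subr_ge0 ltW.
    have t0 : 0 <= t by rewrite ltW// (lt_trans a0).
    rewrite normr_ge0/= normrM ger0_norm ?powR_ge0//.
    have pt : (t - a) `^ (mu + 1) <= t `^ (mu + 1).
      by apply: ge0_ler_powR => //; rewrite lerBlDr lerDl ltW.
    have ft : `|phi t| <= M0 * (expR (- (eta / 2 * t)) * expR (- (eta / 2 * t))).
      rewrite -expRD -opprD -mulrDl -splitr expRN ler_pdivlMr ?expR_gt0// mulrC.
      exact: h0.
    apply: (le_trans (ler_pM (powR_ge0 _ _) (normr_ge0 _) pt ft)).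
    have M00 : 0 <= M0 by apply: le_trans (h0 0 (lexx 0)); rewrite mulr_ge0// expR_ge0.
    rewrite (_ : t `^ _ * _ = t `^ (mu + 1) * expR (- (eta / 2 * t)) * (M0 * expR (- (eta / 2 * t)))); last by ring.
    rewrite -[leRHS]mulrA ler_wpM2r ?mulr_ge0 ?expR_ge0// hC//.
    exact: lt_trans ta.
have e1 : \int[leb]_(t in `]a, +oo[) f t =
   (mu + 1) * \int[leb]_(t in `]a, +oo[) ((t - a) `^ mu * phi t) +
   \int[leb]_(t in `]a, +oo[) ((t - a) `^ (mu + 1) * derive1 phi t).
  rewrite (@RintegralD _ _ _ leb)//; last exact: integrableZR.
  by rewrite (@RintegralZl _ _ _ leb).
have e2 : \int[leb]_(t in `]a, +oo[) ((t - a) `^ mu * derive1 (fun t => t * phi t) t) =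
   \int[leb]_(t in `]a, +oo[) ((t - a) `^ mu * phi t) +
   (\int[leb]_(t in `]a, +oo[) ((t - a) `^ (mu + 1) * derive1 phi t) +
    a * \int[leb]_(t in `]a, +oo[) ((t - a) `^ mu * derive1 phi t)).
  rewrite -(@RintegralZl _ _ _ leb)// -(@RintegralD _ _ _ leb)//; last exact: integrableZR.
  rewrite -(@RintegralD _ _ _ leb)//; last by apply: integrableDR => //; exact: integrableZR.
  apply: eq_Rintegral => t; rewrite inE/= in_itv/= andbT => ta; rewrite E//.
  rewrite (rderive1 (rderiveM (rderive_id t) (dphi t))); ring.
have e3 : \int[leb]_(t in `]a, +oo[) ((t - a) `^ mu * derive1 (tail_int phi) t) =
   -1 * \int[leb]_(t in `]a, +oo[) ((t - a) `^ mu * phi t).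
  rewrite -(@RintegralZl _ _ _ leb)//; apply: eq_Rintegral => t _.
  rewrite (rderive1 (rderive_tail_int t c0 tphi)); ring.
rewrite /powT e2 e3; move: Z; rewrite e1.
move: (Rintegral _ _ _) (Rintegral _ _ _) (Rintegral _ _ _) (Gamma b)^-1 => A B C G Z.
by move: Z; rewrite subrr => /eqP; rewrite addrC addr_eq0 => /eqP ->; ring.
Unshelve. all: end_near. Qed.

End delta_power.

Lemma Rintegral_eq0 (R : realType) (D : set R) (f : R -> R) :
  (forall x, D x -> f x = 0) -> \int[leb]_(x in D) f x = 0.
Proof. by move=> f0; rewrite /Rintegral integral0_eq// => x Dx; rewrite f0. Qed.

Section delta_power_properties.
Context (R : realType) (a mu c : R).
Hypotheses (a0 : 0 < a) (mu0 : 0 <= mu) (c0 : 0 <= c).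
Implicit Types (phi : R -> R) (T : (R -> R) -> R).
Let b := mu + 1.
Let bE : b - 1 = mu. Proof. exact: addrK. Qed.

Lemma inverse_dlaplace_powT : inverse_dlaplace c (Rsymbol mu 1 a) (powT a mu b).
Proof.
split; first exact: distribution_powT.
by move=> s cs; apply: dlaplace_powT => //; exact: le_lt_trans cs.
Qed.

Lemma dRLderiv1 T phi : dRLderiv 1 T phi = - T (derive1 phi).
Proof.
rewrite /dRLderiv (nceil1 ltr01 (lexx 1)) /= /dderiv /dRLint; congr (- T _).
by apply/funext => t; rewrite /right_RLint subrr eqxx.
Qed.

Lemma dcaputo1 T phi : dcaputo 1 T phi = - T (derive1 phi).
Proof.
rewrite /dcaputo (nceil1 ltr01 (lexx 1)) /= /dderiv /dRLint; congr (- T (derive1 _)).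
by apply/funext => t; rewrite /right_RLint subrr eqxx.
Qed.

Lemma dRLint0 T phi : dRLint (1 - 1) T phi = T phi.
Proof.
rewrite /dRLint; congr T.
by apply/funext => t; rewrite /right_RLint subrr eqxx.
Qed.

(** By uniqueness [T] is [powT] on test functions. The differential equation is the integral
    equation tested against phi', since both fractional derivatives of order 1 are the ordinary
    one. *)
Lemma powT_properties T : inverse_dlaplace c (Rsymbol mu 1 a) T ->
  [/\ dcvg_at_right0 T 0,
      forall phi, test_function c phi ->
        a * 1 * dRLint (1 - 1) T phi = dmulX T phi - mu * dprim T phi &
      forall phi, test_function c phi ->
        a * 1 * dRLderiv 1 T phi = a * 1 * dcaputo 1 T phi /\
        a * 1 * dcaputo 1 T phi = dmulX (dderiv T) phi + (1 - mu) * T phi].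
Proof.
move=> HT; have E := inverse_dlaplace_unique c0 HT inverse_dlaplace_powT.
have eq phi : test_function c phi ->
    a * T phi = T (fun t => t * phi t) - mu * T (tail_int phi).
  move=> tphi; rewrite !E//; [exact: powT_equation c0 tphi|exact: test_function_tail_int|].
  exact: test_function_mulX.
split.
(* The distribution lives on [a, +oo[, so it is the zero function on []0, a[]. *)
- exists a => //; exists (fun=> 0); split => [t _||phi u v s u0 va phi0].
  + exact: cst_continuous.
  + exact: cvg_cst.
  rewrite E; last exact: test_function_compact s phi0.
  rewrite [RHS]Rintegral_eq0 => [|t _]; last by rewrite mul0r.
  rewrite /powT Rintegral_eq0 ?mulr0// => t; rewrite /= in_itv/= andbT => at'.
  rewrite -[derive1 phi t]/(derive1n 1 phi t) (derive1n_vanish 1 phi0) ?mulr0//.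
  by rewrite negb_and -!ltNge (lt_trans va at') orbT.
- by move=> phi tphi; rewrite dRLint0 mulr1 eq.
- move=> phi tphi; rewrite dRLderiv1 dcaputo1; split => //.
  have [s [eta ce H]] := tphi.
  have e0 : 0 < eta by exact: le_lt_trans ce.
  have [M0 h0] := H 0%N; have [M1 h1] := H 1%N.
  have d t : rderive phi t (derive1 phi t) by exact: (@smooth_rderive _ phi 0).
  have cphi' : continuous (derive1 phi) by exact: (@smooth_continuous _ phi 1).
  have t1 := test_function_derive tphi.
  have t2 := test_function_mulX t1.
  have lin := HT.1.1.
  have := eq _ t1.
  (* Written as k phi + psi, the shape in which linearity of distributions is stated; likewise for
     the derivative of t phi below. *)
  have -> : tail_int (derive1 phi) = fun t => -2 * phi t + phi t.
    apply/funext => t; rewrite mulNr mulr_natl mulr2n opprD addrNK.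
    exact: tail_int_derive e0 d cphi' h1 (tail_cvgy e0 h0).
  rewrite /dmulX /dderiv.
  have -> : derive1 (fun t => t * phi t) = fun t => 1 * (t * derive1 phi t) + phi t.
    by apply/funext => t; rewrite (rderive1 (rderiveM (rderive_id t) (d t))); ring.
  by rewrite !lin// mulr1 mulrN => ->; ring.
Qed.

End delta_power_properties.

Local Close Scope complex_scope.

(** At nu = 1 the inverse transform is a continuous function only for mu > 1, and it is
    differentiable at t = a only for mu > 2; the distributional half covers every mu >= 0 there.
    Both halves establish existence and then treat an arbitrary inverse transform, by uniqueness. *)
Theorem proposition2p3 (R : realType) (mu nu a c : R)
    (hmu : 0 <= mu) (hnu0 : 0 < nu) (hnu1 : nu <= 1) (ha : 0 < a)
    (hc : 0 <= c) :
  (* R_{mu,nu}(a, .) as a continuous function *)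
  (nu < 1 \/ 1 < mu ->
     (exists y : R -> R, inverse_laplace c (Rsymbol mu nu a) y) /\
     forall y : R -> R, inverse_laplace c (Rsymbol mu nu a) y ->
       [/\ y t @[t --> 0^'+] --> 0,
           forall t, 0 < t ->
             [/\ lebesgue_measure.-integrable `]0, t[ (EFin \o y),
                 RLintegrable (1 - nu) y t &
                 a * nu * RLint (1 - nu) y t =
                 t * y t - mu * \int[lebesgue_measure]_(tau in `]0, t[) y tau] &
           nu < 1 \/ 2 < mu -> forall t, 0 < t ->
             [/\ derivable y t 1, RLderivable nu y t, caputo_derivable nu y t,
                 a * nu * RLderiv nu y t = a * nu * caputo nu y t &
                 a * nu * caputo nu y t = t * derive1 y t + (1 - mu) * y t]]) /\
  (* R_{mu,1}(a, .) as a distribution *)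
  (nu = 1 ->
     (exists T : (R -> R) -> R, inverse_dlaplace c (Rsymbol mu nu a) T) /\
     forall T : (R -> R) -> R, inverse_dlaplace c (Rsymbol mu nu a) T ->
       [/\ dcvg_at_right0 T 0,
           forall phi : R -> R, test_function c phi ->
             a * nu * dRLint (1 - nu) T phi =
             dmulX T phi - mu * dprim T phi &
           forall phi : R -> R, test_function c phi ->
             a * nu * dRLderiv nu T phi = a * nu * dcaputo nu T phi /\
             a * nu * dcaputo nu T phi =
             dmulX (dderiv T) phi + (1 - mu) * T phi]).
Proof.
split=> [cond|nu1]; last first.
  rewrite nu1; split=> [|T]; last exact: powT_properties.
  by exists (powT a mu (mu + 1)); exact: inverse_dlaplace_powT.
have [lt1|le1] := ltP nu 1.
  have ex := inverse_laplace_invLr hnu0 lt1 ha mu hc.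
  split=> [|y hy]; first by exists (invLr nu a mu).
  apply: (invLr_equations hnu0 lt1 ha) => t t0.
  exact: inverse_laplace_unique hy ex t t0.
have nuE : nu = 1 by apply/le_anti; rewrite hnu1.
have mu1 : 1 < mu by case: cond => //; rewrite ltNge le1.
have mu0 : 0 < mu by exact: lt_trans mu1.
rewrite nuE.
have ex : inverse_laplace c (Rsymbol mu 1 a) (fun t => (Gamma mu)^-1 * tpow a (mu - 1) t).
  split=> [t _|s cs].
    by apply: continuousM; [exact: cst_continuous|apply: tpow_continuous; rewrite subr_gt0].
  by apply: laplace_tpow => //; exact: le_lt_trans cs.
split=> [|y hy]; first by eexists; exact: ex.
have [|lim eq1 eq2] := @tpow_equations R a ha mu y mu1.
  by move=> t t0; exact: inverse_laplace_unique hy ex t t0.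
split=> // mu2; apply: eq2; case: mu2 => //; by rewrite ltxx.
Qed.
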